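(* 1) For every semifinite zigzag growth model $(t,w)$ the function $\varphi_{t,w}$ is a semifinite indecomposable harmonic function on the graph $\mathcal{Z}(t)$. 2) Let $t$ be a semifinite template. Every strictly positive semifinite indecomposable harmonic function on the graph $\mathcal{Z}(t)$ is proportional to $\varphi_{t,w}$ for some semifinite zigzag growth model $(t,w)$. 3) The functions $\varphi_{t,w}$ are distinct for distinct semifinite zigzag growth models $(t,w)$ (where $\varphi_{t,w}$ is regarded as a function on the whole zigzag graph $\mathcal{Z}$ by extending it by $0$ outside $\mathcal{Z}(t)$).
   Context: **Zigzag graph.** A binary word is a finite word in the symbols $+,-$; $|a|$ is its length; $\sqcup$ is concatenation. A nonempty zigzag $\lambda$ is a composition of a natural number $n=|\lambda|\ge 1$, drawn as a ribbon of $n$ boxes going from top-left to bottom-right. It is encoded by the binary word $\mathsf{bw}(\lambda)$ of length $n-1$ whose $j$-th symbol is $+$ if box $j+1$ is to the right of box $j$ and $-$ if it is below box $j$; this is a bijection between nonempty zigzags and binary words (the one-box zigzag $\square$ corresponds to the empty word). The zigzag graph $\mathcal{Z}$ is the graded graph with vertex set all nonempty zigzags, graded by $|\lambda|$, together with one vertex $\varnothing$ in level $0$. Edges (simple, oriented upwards): $\varnothing\nearrow\square$, and $\lambda\nearrow\mu$ for nonempty $\lambda,\mu$ iff $|\mu|=|\lambda|+1$ and $\mathsf{bw}(\lambda)$ is obtained from $\mathsf{bw}(\mu)$ by deleting one symbol. **Templates.** A cluster is a symbol $+$ or $-$ with a multiplicity in $\{1,2,\dots\}\cup\{\infty\}$;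 it is infinite or finite according to its multiplicity. A template is a finite sequence of clusters with alternating signs, at least one of which is infinite. More generally, for a finite sequence $r$ of clusters with signs $s_1,\dots,s_n$ and multiplicities $k_1,\dots,k_n$ (signs not necessarily alternating), $\mathcal{Z}(r)\subset\mathcal{Z}$ consists of $\varnothing$ and all $\lambda$ such that $\mathsf{bw}(\lambda)=s_1^{l_1}s_2^{l_2}\cdots s_n^{l_n}$ for some integers $0\le l_i\le k_i$, $l_i<\infty$. It is regarded as a graded graph with the induced edges. A separating cluster of a template is a finite cluster of multiplicity $1$ which is neither first nor last and whose two neighbours are both infinite. A template is finite if all of its finite clusters are separating, and semifinite otherwise. Let $t$ be a semifinite template. A section of $t$ is a maximal collection of consecutive clusters forming a finite template. If $t_1,\dots,t_k$ are the sections from left to right, then $t=(a_0,t_1,a_1,\dots,a_{k-1},t_k,a_k)$, where each $a_i$ is a binary word composed of the consecutive finite non-separating clusters standing there ($a_0$ and $a_k$ may be empty). The tuple $(a_0,\dots,a_k)$ is the zigzag flange of $t$. Put $J(t)=\bigcup_r\mathcal{Z}(r)$, the union over all $r$ obtained from $t$ by decreasing by one the multiplicity of one finite non-separating cluster (deleting the cluster if its multiplicity becomes $0$). For each $\lambda\in\mathcal{Z}(t)\setminus J(t)$ there are unique nonempty zigzags $\lambda^{(i)}\in\mathcal{Z}(t_i)$ with $\mathsf{bw}(\lambda)=a_0\sqcup\mathsf{bw}(\lambda^{(1)})\sqcup a_1\sqcup\dots\sqcup\mathsf{bw}(\lambda^{(k)})\sqcup a_k$. **Growth models and $\varphi_{t,w}$.**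 A semifinite zigzag growth model is a pair $(t,w)$, where $t$ is a semifinite template with $m$ infinite clusters and $w=(w_1,\dots,w_m)$ are positive reals with $w_1+\dots+w_m=1$; $w_j$ is assigned to the $j$-th infinite cluster from the left. Let $v_i$ be the subtuple of $w$ of numbers assigned to infinite clusters of $t_i$, each number being given the sign of its cluster as an orientation. For an ordered tuple $u=(u_1,\dots,u_p)$ of positive reals with orientations in $\{+,-\}$ and a zigzag $\lambda$, put $F_\lambda(u)=\sum u_1^{|\lambda(1)|}\cdots u_p^{|\lambda(p)|}$, the sum over all splittings of the sequence of boxes of $\lambda$ (from top-left to bottom-right) into $p$ consecutive, possibly empty, pieces $\lambda(1),\dots,\lambda(p)$ such that $\lambda(i)$ is a row if $u_i$ is positively oriented and a column if $u_i$ is negatively oriented (a single box is both; the empty piece is both). For $\lambda\in\mathcal{Z}(t)$ set $$\varphi_{t,w}(\lambda)=\begin{cases}F_{\lambda^{(1)}}(v_1)\cdots F_{\lambda^{(k)}}(v_k),&\lambda\in\mathcal{Z}(t)\setminus J(t),\\ +\infty,&\lambda\in J(t).\end{cases}$$ **Harmonic functions.** Let $\Gamma$ be a graded graph. A harmonic function is $\varphi:\Gamma\to\mathbb{R}_{\ge0}\cup\{+\infty\}$ with $\varphi(\lambda)=\sum_{\mu:\lambda\nearrow\mu}\varphi(\mu)$ for all $\lambda$. It is finite if it never equals $+\infty$. Its finiteness ideal is $\{\lambda:\varphi(\lambda)<+\infty\}$. $\mathrm{K}_0(\Gamma)$ is the real vector space spanned by the vertices modulo $\lambda=\sum_{\mu:\lambda\nearrow\mu}\mu$;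 $\mathrm{K}_0^+(\Gamma)$ is the cone of nonnegative combinations of vertices; $a\ge_K b$ iff $a-b\in\mathrm{K}_0^+(\Gamma)$. A harmonic $\varphi$ extends to an $\mathbb{R}_{\ge0}$-linear map $\mathrm{K}_0^+(\Gamma)\to\mathbb{R}_{\ge0}\cup\{+\infty\}$. $\varphi$ is semifinite if it is not finite and for all $a\in\mathrm{K}_0^+(\Gamma)$: $\varphi(a)=\sup\{\varphi(b): b\in\mathrm{K}_0^+(\Gamma),\ b\le_K a,\ \varphi(b)<+\infty\}$. A semifinite harmonic function $\varphi$ is indecomposable if every finite or semifinite harmonic function $\varphi'\le\varphi$ which does not vanish identically on the finiteness ideal of $\varphi$ is a constant multiple of $\varphi$ on that finiteness ideal. *)

(* Defs.v *)
From HB Require Import structures.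
From mathcomp Require Import all_boot all_order all_algebra finmap zify monalg.
From mathcomp Require Import all_classical all_reals all_analysis.

Set Implicit Arguments.
Unset Strict Implicit.
Unset Printing Implicit Defensive.

Import Order.TTheory GRing.Theory Num.Theory.

Local Open Scope classical_set_scope.
Local Open Scope ring_scope.

Record graded_graph := GradedGraph {
  vertex :> choiceType;
  level : vertex -> nat;
  edge : rel vertex;
  edge_level : forall x y, edge x y -> level y = (level x).+1;
  finite_level : forall n, finite_set [set x | level x = n]
}.

Definition upper (G : graded_graph) (x : G) : set G := [set y | edge x y].

Section InducedSubgraph.
Context (G : graded_graph) (A : set G).

Definition sub_level (x : A) : nat := level (val x).
Definition sub_edge (x y : A) : bool := edge (val x) (val y).

Lemma sub_edge_level x y : sub_edge x y -> sub_level y = (sub_level x).+1.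
Proof. exact: edge_level. Qed.

Lemma sub_finite_level n : finite_set [set x | sub_level x = n].
Proof.
have -> : [set x | sub_level x = n] = val @^-1` [set x : G | level x = n] by [].
by apply: finite_preimage => [x y _ _|]; [exact: val_inj|exact: finite_level].
Qed.

Definition subgraph : graded_graph :=
  @GradedGraph (set_type A) sub_level sub_edge sub_edge_level sub_finite_level.

End InducedSubgraph.

Section K0.
Context (R : realType) (G : graded_graph).

Definition free_vertex (x : G) : {malg R[G]} := << x >>.

Definition K0_relator (x : G) : {malg R[G]} :=
  free_vertex x - \sum_(y \in upper x) free_vertex y.

(* The linear span of the relators; [s] lists coefficients and vertices. *)
Definition K0_relations : {pred {malg R[G]}} := fun a =>
  `[< exists s : seq (R * G), a = \sum_(p <- s) p.1 *: K0_relator p.2 >].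

Lemma K0_relationsZ (c : R) a : a \in K0_relations -> c *: a \in K0_relations.
Proof.
move=> /asboolP[s ->]; apply/asboolP; exists [seq (c * p.1, p.2) | p <- s].
by rewrite big_map scaler_sumr; apply: eq_bigr => p _; rewrite scalerA.
Qed.

Lemma K0_relations_zmod_closed : zmod_closed K0_relations.
Proof.
split=> [|a b]; first by apply/asboolP; exists [::]; rewrite big_nil.
move=> /asboolP[s ->] /(K0_relationsZ (-1)) /asboolP[r]; rewrite scaleN1r => rE.
by apply/asboolP; exists (s ++ r); rewrite big_cat rE.
Qed.

HB.instance Definition _ :=
  GRing.isZmodClosed.Build {malg R[G]} K0_relations K0_relations_zmod_closed.

Definition K0 : Type := Quotient.quot K0_relations.
HB.instance Definition _ := GRing.Zmodule.on K0.

Definition K0_class (a : {malg R[G]}) : K0 := (\pi_(Quotient.quot K0_relations) a)%qT.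

Lemma K0_classE a b : (K0_class a == K0_class b) = (a - b \in K0_relations).
Proof. by rewrite -Quotient.idealrBE. Qed.

Lemma K0_classD : {morph K0_class : a b / a + b}.
Proof. by move=> a b; exact: raddfD. Qed.

Definition K0_scale (c : R) (q : K0) : K0 := K0_class (c *: repr q).

Lemma K0_classZ c a : K0_class (c *: a) = K0_scale c (K0_class a).
Proof.
apply/eqP; rewrite K0_classE -scalerBr; apply: K0_relationsZ.
by rewrite -K0_classE /K0_class reprK.
Qed.

Lemma K0_classP (q : K0) : exists a, q = K0_class a.
Proof. by exists (repr q); rewrite /K0_class reprK. Qed.

Lemma K0_scaleA a b q : K0_scale a (K0_scale b q) = K0_scale (a * b) q.
Proof. by have [x ->] := K0_classP q; rewrite -!K0_classZ scalerA. Qed.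

Lemma K0_scale1 : left_id 1 K0_scale.
Proof. by move=> q; have [x ->] := K0_classP q; rewrite -K0_classZ scale1r. Qed.

Lemma K0_scaleDr : right_distributive K0_scale +%R.
Proof.
move=> c q r; have [x ->] := K0_classP q; have [y ->] := K0_classP r.
by rewrite -K0_classD -!K0_classZ -K0_classD scalerDr.
Qed.

Lemma K0_scaleDl q : {morph K0_scale^~ q : a b / a + b}.
Proof.
move=> a b; have [x ->] := K0_classP q.
by rewrite -!K0_classZ -K0_classD scalerDl.
Qed.

HB.instance Definition _ := GRing.Zmodule_isLmodule.Build R K0
  K0_scaleA K0_scale1 K0_scaleDr K0_scaleDl.

Definition malg_nonneg (a : {malg R[G]}) : Prop := forall x, 0 <= a@_x.

Definition K0_cone : set K0 := [set K0_class a | a in malg_nonneg].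

Definition K0_le (b a : K0) : Prop := K0_cone (a - b).

End K0.

Section Harmonic.
Context (R : realType) (G : graded_graph).
Local Open Scope ereal_scope.
Implicit Type phi : G -> \bar R.

Definition harmonic_function phi : Prop :=
  (forall x, 0 <= phi x) /\ (forall x, phi x = \sum_(y \in upper x) phi y).

Definition finite_harmonic phi : Prop := harmonic_function phi /\ forall x, phi x < +oo.

Definition finiteness_ideal phi : set G := [set x | phi x < +oo].

Definition malg_ext phi (a : {malg R[G]}) : \bar R :=
  \sum_(x <- msupp a) (a@_x)%:E * phi x.

(* On [K0_cone]: evaluate [phi] on a nonnegative representative. For harmonic
   [phi] the value does not depend on the representative. *)
Definition K0_ext phi (q : K0 R G) : \bar R :=
  malg_ext phi (xget 0%R [set a | malg_nonneg a /\ K0_class a = q]).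

Definition semifinite_harmonic phi : Prop :=
  [/\ harmonic_function phi,
      exists x, phi x = +oo &
      forall a : K0 R G, K0_cone a ->
        K0_ext phi a =
        ereal_sup [set K0_ext phi b | b in
          [set b | [/\ K0_cone b, K0_le b a & K0_ext phi b < +oo]]]].

Definition indecomposable phi : Prop :=
  forall psi : G -> \bar R,
    finite_harmonic psi \/ semifinite_harmonic psi ->
    (forall x, psi x <= phi x) ->
    (exists2 x, finiteness_ideal phi x & psi x != 0) ->
    exists c : R, forall x, finiteness_ideal phi x -> psi x = c%:E * phi x.

End Harmonic.

Local Open Scope nat_scope.

(* Binary words: [true] is the symbol +, [false] the symbol -. *)
Notation word := (seq bool).

(* [None] is the empty zigzag, [Some w] the nonempty zigzag whose binary word
   is [w]; it has [(size w).+1] boxes, and box [j.+1] (counting from 0) is to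
   the right of box [j] if the [j]-th symbol of [w] is +, below it otherwise. *)
Notation zigzag := (option word).

Definition zigzag_size (l : zigzag) : nat := if l is Some w then (size w).+1 else 0.

Definition delete_symbol (w : word) (i : nat) : word := take i w ++ drop i.+1 w.

Definition zigzag_edge (l m : zigzag) : bool :=
  match l, m with
  | None, Some w => w == [::]
  | Some v, Some w => [exists i : 'I_(size w), v == delete_symbol w i]
  | _, None => false
  end.

Lemma zigzag_edge_size l m :
  zigzag_edge l m -> zigzag_size m = (zigzag_size l).+1.
Proof.
case: l m => [v|] [w|] //=; last by move=> /eqP ->.
case/existsP=> i /eqP ->; congr _.+1; rewrite /delete_symbol size_cat.
by rewrite size_take ltn_ord size_drop; have := ltn_ord i; lia.
Qed.

Lemma finite_zigzag_level n : finite_set [set l | zigzag_size l = n].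
Proof.
case: n => [|n].
  by apply: sub_finite_set (finite_set1 None) => -[].
apply: (@sub_finite_set _ _ ((fun w : n.-tuple bool => Some (val w)) @` setT)).
  case=> // w [/eqP wn]; exists (Tuple wn) => //.
by apply: finite_image; exact: finite_finset.
Qed.

Definition zigzag_graph : graded_graph :=
  @GradedGraph zigzag zigzag_size zigzag_edge zigzag_edge_size finite_zigzag_level.

(* A sign and a multiplicity, [None] standing for infinity. *)
Notation signed_cluster := (bool * option nat)%type.

Implicit Types (c : signed_cluster) (r t : seq signed_cluster).

Definition cluster_wf c : bool := c.2 != Some 0.
Definition infinite_cluster c : bool := c.2 == None.
Definition finite_cluster c : bool := ~~ infinite_cluster c.

Definition cluster0 : signed_cluster := (true, None).

Definition is_template t : bool :=
  [&& all cluster_wf t, sorted (fun c d => c.1 != d.1) t & has infinite_cluster t].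

Definition fits_multiplicity (l : nat) c : bool := if c.2 is Some k then l <= k else true.

(* Z(r); the signs in [r] need not alternate. *)
Definition zigzags_of r : set zigzag :=
  [set x | if x is Some w then
     exists l : seq nat, [/\ size l = size r,
       forall i, i < size r -> fits_multiplicity (nth 0 l i) (nth cluster0 r i) &
       w = flatten [seq nseq p.1 p.2.1 | p <- zip l r]]
   else True].

Definition separating t (i : nat) : bool :=
  [&& 0 < i, i.+1 < size t, (nth cluster0 t i).2 == Some 1,
      infinite_cluster (nth cluster0 t i.-1) &
      infinite_cluster (nth cluster0 t i.+1)].

Definition nonseparating_finite t (i : nat) : bool :=
  [&& i < size t, finite_cluster (nth cluster0 t i) & ~~ separating t i].

Definition finite_template t : bool :=
  is_template t && all (fun i => ~~ nonseparating_finite t i) (iota 0 (size t)).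

Definition semifinite_template t : bool := is_template t && ~~ finite_template t.

(* The pair [(i, j)] stands for the consecutive clusters number i, ..., j - 1. *)
Definition slice t (p : nat * nat) : seq signed_cluster := drop p.1 (take p.2 t).

(* In lexicographic order, so that the sections below come from left to right. *)
Definition intervals t : seq (nat * nat) :=
  [seq (i, j) | i <- iota 0 (size t).+1, j <- iota 0 (size t).+1].

Definition is_section t (p : nat * nat) : bool :=
  finite_template (slice t p) &&
  all (fun q : nat * nat => [&& q.1 <= p.1, p.2 <= q.2 & finite_template (slice t q)]
              ==> (q == p)) (intervals t).

Definition section_intervals t : seq (nat * nat) :=
  [seq p <- intervals t | is_section t p].

Definition sections t : seq (seq signed_cluster) := map (slice t) (section_intervals t).

Definition cluster_word c : word := if c.2 is Some k then nseq k c.1 else [::].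

(* The words between consecutive sections, and before the first and after the
   last one. *)
Definition flange t : seq word :=
  let s := section_intervals t in
  [seq flatten (map cluster_word (slice t p))
  | p <- zip (0 :: unzip2 s) (rcons (unzip1 s) (size t))].

Definition decrease_cluster t (i : nat) : seq signed_cluster :=
  let c := nth cluster0 t i in
  let c' := if c.2 is Some k.+2 then [:: (c.1, Some k.+1)] else [::] in
  take i t ++ c' ++ drop i.+1 t.

(* J(t), a union of sets Z(r). *)
Definition template_ideal t : set zigzag :=
  \bigcup_(i in [set i | nonseparating_finite t i]) zigzags_of (decrease_cluster t i).

Fixpoint interleave (a l : seq word) : word :=
  match a, l with
  | a0 :: a', l0 :: l' => a0 ++ l0 ++ interleave a' l'
  | _, _ => flatten a
  end.

(* The binary words of zigzags lambda^(1), ..., lambda^(k) decomposing [w]. *)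
Definition decomposition t (w : word) (ls : seq word) : Prop :=
  [/\ size ls = size (sections t),
      forall i, i < size (sections t) ->
        zigzags_of (nth [::] (sections t) i) (Some (nth [::] ls i)) &
      w = interleave (flange t) ls].

Definition decompose t (w : word) : seq word := xget [::] (decomposition t w).

Definition template_graph t : graded_graph := @subgraph zigzag_graph (zigzags_of t).

Section GrowthModel.
Context (R : realType).
Local Open Scope ring_scope.
Implicit Types (u : seq (R * bool)) (w : seq R).

(* Word of the piece of [l] boxes of the zigzag with word [x] that starts after
   the first [o] boxes. *)
Definition piece (x : word) (o l : nat) : word := take l.-1 (drop o x).

(* A positively oriented piece has to be a row, a negatively oriented one a
   column. *)
Definition is_splitting (x : word) u (n : seq nat) : bool :=
  (sumn n == (size x).+1) &&
  all (fun i => all (pred1 (nth (0, true) u i).2)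
                    (piece x (sumn (take i n)) (nth 0%N n i)))
      (iota 0 (size u)).

(* [F_lambda(u)], for lambda the nonempty zigzag with binary word [x]; the n_i
   are the numbers of boxes in the pieces. *)
Definition Fsum (x : word) u : R :=
  \sum_(n : (size u).-tuple 'I_(size x).+2 | is_splitting x u (map val n))
    \prod_(i < size u) (nth (0, true) u i).1 ^+ tnth n i.

Definition growth_model t w : Prop :=
  [/\ semifinite_template t, size w = count infinite_cluster t,
      all (fun a => 0 < a) w & \sum_(a <- w) a = 1].

(* The parameters of the infinite clusters in the slice [p] of [t], with signs. *)
Definition oriented_weights t w (p : nat * nat) : seq (R * bool) :=
  zip (drop (count infinite_cluster (take p.1 t)) w)
      [seq c.1 | c <- slice t p & infinite_cluster c].

Local Open Scope ereal_scope.

Definition phi t w (x : template_graph t) : \bar R :=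
  if val x \in template_ideal t then +oo else
  let ls := decompose t (odflt [::] (val x)) in
  let s := section_intervals t in
  (\prod_(i < size s)
     Fsum (nth [::] ls i) (oriented_weights t w (nth (0, 0)%N s i)))%R%:E.

Definition phi_zero_ext t w (x : zigzag) : \bar R :=
  if insub x is Some y then phi w (y : template_graph t) else 0.

End GrowthModel.

(* Main.v *)
Require Import Defs.
From mathcomp Require Import all_boot all_order all_algebra finmap zify monalg.
From mathcomp Require Import all_classical all_reals all_analysis.
From mathcomp Require Import ring lra.

(* The words of Z(t) in which every finite cluster is full and every infinite one
   is nonempty form an upward closed copy of N^m, where n has the upper neighbours
   n + e_j and where phi_{t,w} is a constant times w^n. A harmonic function on this
   lattice has a least harmonic extension to Z(t), and least extensions are
   automatically finite or semifinite. phi_{t,w} is the least extension psi of its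
   restriction: off J(t), a splitting of lambda that contributes w^n to phi(lambda)
   yields a lattice word above lambda, so that psi >= d phi for a constant d > 0;
   then phi - (phi - psi)/(1 - d) is again a superharmonic majorant of the
   restriction, which forces psi = phi. On J(t), psi is infinite because infinitely
   many disjoint families of paths leave J(t), each carrying the same mass.
   Indecomposability reduces to the Choquet-Deny theorem: bounded harmonic functions
   of the walk on N^m with steps e_j are constant.
   Conversely, an indecomposable f is finite on a translate of the lattice; the least
   extension of n |-> f(n + e_j) lies below f, so f(n + e_j) = w_j f(n), and f and
   phi_{t,w} are least extensions of proportional functions. Finally the support of
   phi_{t,w} determines t, and its growth along the lattice determines w. *)

Set Implicit Arguments.
Unset Strict Implicit.
Unset Printing Implicit Defensive.

Import Order.TTheory GRing.Theory Num.Theory.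
Local Open Scope nat_scope.

(** In a full word every cluster is present and the signs alternate, so its exponents are its run
    lengths ([run_unique]). This rigidity makes the lattice injective and upward closed, keeps it
    off J(t), and recovers t from Z(t). It also explains the role of separating clusters. When a
    nonseparating finite cluster loses a symbol, the resulting word still determines [n]; when a
    separating one is lost, two infinite clusters fuse and only the sum of their exponents survives,
    so that the paths leaving the ideal would no longer be disjoint. Two obstacles come from the
    value +oo. First, a harmonic function cannot be evaluated on differences, so the independence of
    its value on K_0 from the representative is proved through finite truncations. Second, a
    difference such as f - psi is controlled only where f is finite; minimality is therefore stated
    against superharmonic functions, for which a jump to +oo outside the finiteness ideal does no
    harm. *)

Section MonotoneSums.
Local Open Scope ring_scope.
Local Open Scope ereal_scope.
Context (R : realType) (I : Type).

Lemma sup_sum (s : seq I) (u : I -> nat -> \bar R) :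
  (forall i k, 0 <= u i k) -> (forall i, {homo u i : k l / (k <= l)%N >-> k <= l}) ->
  \sum_(i <- s) ereal_sup (range (u i)) = ereal_sup (range (fun k => \sum_(i <- s) u i k)).
Proof.
move=> u0 um.
have hm : {homo (fun k => \sum_(i <- s) u i k) : k l / (k <= l)%N >-> k <= l}.
  by move=> k l kl; apply: lee_sum => i _; exact: um.
have := ereal_nondecreasing_cvgn hm; apply: cvg_unique => //.
apply: cvg_nnesum => i _; last exact: ereal_nondecreasing_cvgn.
by apply: nearW => k.
Qed.

End MonotoneSums.

(** * Sums over upward paths and least harmonic extensions *)

Section Paths.
Local Open Scope ring_scope.
Local Open Scope ereal_scope.
Context (R : realType) (G : graded_graph).
Implicit Types (f h : G -> \bar R) (x y : G).

Lemma finite_upper x : finite_set (upper x).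
Proof.
apply: (sub_finite_set _ (@finite_level G (level x).+1)) => y; exact: edge_level.
Qed.

Definition upper_seq x : seq G := fset_set (upper x).

Lemma mem_upper_seq x y : (y \in upper_seq x) = edge x y.
Proof.
rewrite /upper_seq in_fset_set; last exact: finite_upper.
by apply/idP/idP => [/set_mem//|e]; exact/mem_set.
Qed.

Lemma uniq_upper_seq x : uniq (upper_seq x).
Proof. exact: fset_uniq. Qed.

Lemma upper_sumE f x : \sum_(y \in upper x) f y = \sum_(y <- upper_seq x) f y.
Proof. by rewrite fsbig_finite //; exact: finite_upper. Qed.

(** The sum of [h] over the endpoints of all upward paths of [k] steps from [x]; the nonnegative
    functions fixed by [push _ 1] are the harmonic ones. *)
Fixpoint push h (k : nat) x : \bar R :=
  if k is k'.+1 then \sum_(y <- upper_seq x) push h k' y else h x.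

Lemma push_ge0 h k x : (forall y, 0 <= h y) -> 0 <= push h k x.
Proof.
by move=> h0; elim: k x => //= k IH x; apply: sume_ge0 => y _.
Qed.

Lemma le_push h f k x : (forall y, h y <= f y) -> push h k x <= push f k x.
Proof.
by move=> hf; elim: k x => //= k IH x; apply: lee_sum => y _.
Qed.

Lemma push_harmonic f k x : harmonic_function f -> push f k x = f x.
Proof.
case=> _ fh; elim: k x => //= k IH x; rewrite fh upper_sumE.
exact: eq_bigr.
Qed.

Lemma push_sup (u : G -> nat -> \bar R) k x :
  (forall y l, 0 <= u y l) -> (forall y, {homo u y : i j / (i <= j)%N >-> i <= j}) ->
  push (fun y => ereal_sup (range (u y))) k x =
  ereal_sup (range (fun l => push (u^~ l) k x)).
Proof.
move=> u0 um; elim: k x => //= k IH x.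
rewrite -sup_sum //; first by apply: eq_bigr => y _; rewrite IH.
  by move=> y l; apply: push_ge0.
by move=> y i j ij; apply: le_push => z; exact: um.
Qed.

Section Extension.
Context (h : G -> \bar R).
Hypotheses (h0 : forall x, 0 <= h x) (hsub : forall x, h x <= push h 1 x).

Definition harm_ext x : \bar R := ereal_sup (range (push h ^~ x)).

Lemma push_homo x : {homo push h ^~ x : i j / (i <= j)%N >-> i <= j}.
Proof.
apply: homo_leq => [//|a b c|]; first exact: le_trans.
move=> k; elim: k x => [|k IH] x; first exact: hsub.
by apply: lee_sum => y _; exact: IH.
Qed.

Lemma harm_ext_ge0 x : 0 <= harm_ext x.
Proof.
apply: (@le_trans _ _ (h x)) => //.
by apply: ereal_sup_ubound; exists 0%N.
Qed.

Lemma harm_ext_ge x : h x <= harm_ext x.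
Proof. by apply: ereal_sup_ubound; exists 0%N. Qed.

Lemma harm_ext_harmonic : harmonic_function harm_ext.
Proof.
split=> [x|x]; first exact: harm_ext_ge0.
rewrite upper_sumE /harm_ext sup_sum; last 2 first.
- by move=> y k; apply: push_ge0.
- exact: push_homo.
apply/eqP; rewrite eq_le; apply/andP; split; apply: ge_ereal_sup => _ [k _ <-].
- apply: (@le_trans _ _ (push h k.+1 x)); first exact: push_homo.
  by apply: ereal_sup_ubound; exists k.
- by apply: ereal_sup_ubound; exists k.+1.
Qed.

(** Iterating the inequality for [f] keeps every [push h k] below it. Competitors that are merely
    superharmonic are allowed because the differences used later are no better. *)
Lemma harm_ext_min f x : (forall y, \sum_(z <- upper_seq y) f z <= f y) ->
  (forall y, h y <= f y) -> harm_ext x <= f x.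
Proof.
move=> fs hf; apply: ge_ereal_sup => _ [k _ <-]; apply: le_trans (le_push k x hf) _.
by elim: k x => //= k IH x; apply: le_trans (fs x); exact: lee_sum.
Qed.

End Extension.

(** * Values of a harmonic function on the cone of K_0 *)

Section ConeValues.
Implicit Types (a b : {malg R[G]}).

Fixpoint rpush (e : G -> R) (k : nat) x : R :=
  (if k is k'.+1 then \sum_(y <- upper_seq x) rpush e k' y else e x)%R.

Lemma push_EFin (e : G -> R) k x : push (fun y => (e y)%:E) k x = (rpush e k x)%:E.
Proof.
by elim: k x => //= k IH x; rewrite -sumEFin; apply: eq_bigr => y _.
Qed.

Lemma sup_truncation (c : \bar R) : 0 <= c ->
  c = ereal_sup (range (fun M : nat => Order.min c M%:R%:E)).
Proof.
move=> c0; apply/eqP; rewrite eq_le; apply/andP; split; last first.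
  by apply: ge_ereal_sup => _ [M _ <-]; rewrite ge_min lexx.
case: c c0 => [r|_|//].
  rewrite lee_fin => r0; apply: (@le_trans _ _ (Order.min r%:E (Num.truncn r).+1%:R%:E)).
    by rewrite le_min lexx lee_fin ltW// truncnS_gt.
  by apply: ereal_sup_ubound; exists (Num.truncn r).+1.
rewrite (eq_infty (x := ereal_sup _))// => r.
apply: (@le_trans _ _ (Num.truncn r).+1%:R%:E); first by rewrite lee_fin ltW// truncnS_gt.
by apply: ereal_sup_ubound; exists (Num.truncn r).+1 => //; rewrite minye.
Qed.

(** Real counterpart of [malg_ext]: being finite, it respects differences and can be evaluated on
    relators. *)
Definition mlin (e : G -> R) a : R := (\sum_(x <- msupp a) a@_x * e x)%R.

Lemma mlinE e a (d : {fset G}) : (msupp a `<=` d)%fset ->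
  mlin e a = (\sum_(x <- d) a@_x * e x)%R.
Proof.
move=> sd; apply: (big_fset_incl _ sd) => x _ /mcoeff_outdom ->.
by rewrite mul0r.
Qed.

Lemma mlinD e a b : mlin e (a + b) = (mlin e a + mlin e b)%R.
Proof.
pose d := (msupp a `|` msupp b)%fset.
rewrite (@mlinE e (a + b) d) ?msuppD_le// (@mlinE e a d) ?fsubsetUl//.
rewrite (@mlinE e b d) ?fsubsetUr// -big_split/=.
by apply: eq_bigr => x _; rewrite mcoeffD mulrDl.
Qed.

Lemma mlinZ e (c : R) a : mlin e (c *: a) = (c * mlin e a)%R.
Proof.
rewrite (@mlinE e (c *: a) (msupp a)) ?msuppZ_le// mulr_sumr.
by apply: eq_bigr => x _; rewrite mcoeffZ mulrA.
Qed.

Lemma mlin0 e : mlin e 0 = 0%R.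
Proof. by rewrite /mlin msupp0 big_seq_fset0. Qed.

Lemma mlinB e a b : mlin e (a - b) = (mlin e a - mlin e b)%R.
Proof. by rewrite -scaleN1r mlinD mlinZ mulN1r. Qed.

Lemma mlin_sum e (I : Type) (s : seq I) (F : I -> {malg R[G]}) :
  mlin e (\sum_(i <- s) F i)%R = (\sum_(i <- s) mlin e (F i))%R.
Proof.
elim: s => [|i s IH]; first by rewrite !big_nil mlin0.
by rewrite !big_cons mlinD IH.
Qed.

Lemma mlin_vertex e x : mlin e (free_vertex R x) = e x.
Proof. by rewrite /mlin /free_vertex msuppU oner_eq0 big_seq_fset1 mcoeffUU mul1r. Qed.

Lemma mlin_relator e x : mlin e (K0_relator R x) = (e x - \sum_(y <- upper_seq x) e y)%R.
Proof.
rewrite /K0_relator mlinB mlin_vertex fsbig_finite; last exact: finite_upper.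
by rewrite mlin_sum; congr (_ - _)%R; apply: eq_bigr => y _; rewrite mlin_vertex.
Qed.

Lemma malg_extE f a (d : {fset G}) : (msupp a `<=` d)%fset ->
  malg_ext f a = \sum_(x <- d) (a@_x)%:E * f x.
Proof.
move=> sd; apply: (big_fset_incl _ sd) => x _ /mcoeff_outdom ->.
by rewrite mul0e.
Qed.

Lemma malg_ext0 f : malg_ext f 0%R = 0.
Proof. by rewrite /malg_ext msupp0 big_seq_fset0. Qed.

Lemma malg_extD f a b : (forall x, 0 <= f x) -> malg_nonneg a -> malg_nonneg b ->
  malg_ext f (a + b)%R = malg_ext f a + malg_ext f b.
Proof.
move=> f0 a0 b0; pose d := (msupp a `|` msupp b)%fset.
rewrite (@malg_extE f (a + b)%R d) ?msuppD_le// (@malg_extE f a d) ?fsubsetUl//.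
rewrite (@malg_extE f b d) ?fsubsetUr// -big_split/=.
by apply: eq_bigr => x _; rewrite mcoeffD EFinD ge0_muleDl// lee_fin.
Qed.

Lemma malg_extZ f (c : R) a : (forall x, 0 <= f x) -> malg_nonneg a -> (0 <= c)%R ->
  malg_ext f (c *: a)%R = c%:E * malg_ext f a.
Proof.
move=> f0 a0 c0; rewrite (@malg_extE f (c *: a)%R (msupp a)) ?msuppZ_le//.
rewrite /malg_ext ge0_sume_distrr => [|x _]; last by rewrite mule_ge0// lee_fin.
by apply: eq_bigr => x _; rewrite mcoeffZ EFinM muleA.
Qed.

Lemma malg_ext_vertex f x : malg_ext f (free_vertex R x) = f x.
Proof. by rewrite /malg_ext /free_vertex msuppU oner_eq0 big_seq_fset1 mcoeffUU mul1e. Qed.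

Lemma malg_ext_ge0 f a : (forall x, 0 <= f x) -> malg_nonneg a -> 0 <= malg_ext f a.
Proof.
by move=> f0 a0; apply: sume_ge0 => x _; rewrite mule_ge0// lee_fin.
Qed.

(** [f] cut off at [M] on level [N] and pushed down to the lower levels: finite, harmonic below
    level [N], and increasing with [M] to [f] when [f] is harmonic. From level [N] upwards the
    truncated subtraction gives zero steps and leaves the plain cut-off. *)
Definition trunc f (M N : nat) x : R :=
  rpush (fun y => fine (Order.min (f y) M%:R%:E)) (N - level x) x.

Lemma trunc_harmonic f M N x : (level x < N)%N ->
  trunc f M N x = (\sum_(y <- upper_seq x) trunc f M N y)%R.
Proof.
move=> xN; rewrite /trunc (_ : N - level x = (N - (level x).+1).+1)%N; last by lia.
by apply: eq_big_seq => y; rewrite mem_upper_seq => /edge_level ->.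
Qed.

Lemma malg_ext_trunc f a N : harmonic_function f -> malg_nonneg a ->
  (forall x, x \in msupp a -> level x <= N)%N ->
  malg_ext f a = ereal_sup (range (fun M : nat => (mlin (trunc f M N) a)%:E)).
Proof.
move=> fh a0 aN; have f0 := fh.1.
have mE M y : Order.min (f y) M%:R%:E = (fine (Order.min (f y) M%:R%:E))%:E.
  rewrite fineK//; case: (f y) (f0 y) => [r||] // _.
  by rewrite -EFin_min.
(* A harmonic [f] equals its own push from level [N], and pushing commutes with the supremum over
   [M]. *)
have fE x : f x = ereal_sup (range (fun M => (trunc f M N x)%:E)).
  rewrite -{1}(push_harmonic (N - level x) x fh).
  rewrite (_ : push f _ _ =
      push (fun y => ereal_sup (range (fun M : nat => Order.min (f y) M%:R%:E))) (N - level x) x).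
    rewrite push_sup => [|y l|y i j ij]; last 2 first.
    - by rewrite le_min f0 lee_fin ler0n.
    - by rewrite le_min ge_min lexx/= ge_min lee_fin ler_nat ij orbT.
    congr ereal_sup; apply: eq_imagel => M _.
    by rewrite /trunc -push_EFin; congr (push _ _ _); apply/funext => y.
  by congr (push _ _ _); apply/funext => y; exact: sup_truncation.
have tr0 M x : (0 <= trunc f M N x)%R.
  rewrite -lee_fin -push_EFin push_ge0// => y; rewrite -mE.
  by rewrite le_min f0 lee_fin ler0n.
have trm x : {homo trunc f ^~ N ^~ x : i j / (i <= j)%N >-> (i <= j)%R}.
  move=> i j ij; rewrite -lee_fin -!push_EFin le_push// => y; rewrite -!mE.
  by rewrite le_min ge_min lexx/= ge_min lee_fin ler_nat ij orbT.
rewrite /malg_ext; under eq_bigr do rewrite fE.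
transitivity (\sum_(x <- msupp a)
    ereal_sup (range (fun M => (a@_x * trunc f M N x)%:E))).
  apply: eq_bigr => x _; rewrite -ereal_supZl//; last first.
    by apply/set0P; exists (trunc f 0 N x)%:E, 0%N.
  congr ereal_sup; apply/seteqP; split=> [_ [_ [M _ <-] <-]|_ [M _ <-]].
    by exists M.
  by exists (trunc f M N x)%:E => //; exists M.
rewrite sup_sum => [|x k|x i j ij]; last 2 first.
- by rewrite lee_fin mulr_ge0.
- by rewrite lee_fin ler_wpM2l// trm.
by congr ereal_sup; apply: eq_imagel => M _; rewrite sumEFin.
Qed.

(** Infinite values forbid subtraction, so [f] is replaced by its truncations. These kill every
    relator at a vertex below level [N]; once [N] exceeds the levels of all relators involved and
    bounds both supports, they agree on [a] and [b], and the supremum over [M] restores [f]. *)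
Lemma malg_ext_class f a b : harmonic_function f -> malg_nonneg a -> malg_nonneg b ->
  K0_class a = K0_class b -> malg_ext f a = malg_ext f b.
Proof.
move=> fh a0 b0 /eqP; rewrite K0_classE => /asboolP[s abE].
pose N := (\max_(x <- msupp a) level x + \max_(x <- msupp b) level x
  + \max_(p <- s) (level p.2).+1)%N.
have lm (d : seq G) x : x \in d -> (level x <= \max_(y <- d) level y)%N.
  by move=> xd; rewrite (big_rem x xd)/= leq_maxl.
rewrite (@malg_ext_trunc f a N)// ?(@malg_ext_trunc f b N)//; last 2 first.
- by move=> x /lm; rewrite /N; lia.
- by move=> x /lm; rewrite /N; lia.
congr ereal_sup; apply: eq_imagel => M _; congr (_%:E).
apply/eqP; rewrite -subr_eq0 -mlinB abE mlin_sum big_seq big1// => p ps.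
rewrite mlinZ mlin_relator trunc_harmonic ?subrr ?mulr0//.
have : ((level p.2).+1 <= \max_(p <- s) (level p.2).+1)%N.
  by rewrite (big_rem p ps)/= leq_maxl.
by move=> h; apply: (leq_trans h); exact: leq_addl.
Qed.

Lemma K0_extE f a : harmonic_function f -> malg_nonneg a ->
  K0_ext f (K0_class a) = malg_ext f a.
Proof.
move=> fh a0; rewrite /K0_ext; case: xgetP => [b _ [b0 ba]|/(_ a)/not_andP[]//].
exact: malg_ext_class.
Qed.


Lemma K0_coneD (p q : K0 R G) : K0_cone p -> K0_cone q -> K0_cone (p + q)%R.
Proof.
move=> [a a0 <-] [b b0 <-]; exists (a + b)%R; last exact: K0_classD.
by move=> x; rewrite mcoeffD addr_ge0.
Qed.

Lemma K0_cone0 : K0_cone (0 : K0 R G)%R.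
Proof. by exists 0%R; [move=> x; rewrite mcoeff0|exact: raddf0]. Qed.

Lemma K0_coneZ (c : R) (q : K0 R G) : (0 <= c)%R -> K0_cone q -> K0_cone (c *: q)%R.
Proof.
move=> c0 [a a0 <-]; exists (c *: a)%R; last exact: K0_classZ.
by move=> x; rewrite mcoeffZ mulr_ge0.
Qed.

Lemma K0_leD (p q p' q' : K0 R G) : K0_le p q -> K0_le p' q' -> K0_le (p + p')%R (q + q')%R.
Proof. by rewrite /K0_le opprD addrACA; exact: K0_coneD. Qed.

Lemma K0_leZ (c : R) (p q : K0 R G) : (0 <= c)%R -> K0_le p q -> K0_le (c *: p)%R (c *: q)%R.
Proof. by rewrite /K0_le -scalerBr; exact: K0_coneZ. Qed.

Lemma K0_extD f p q : harmonic_function f -> K0_cone p -> K0_cone q ->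
  K0_ext f (p + q)%R = K0_ext f p + K0_ext f q.
Proof.
move=> fh [a a0 <-] [b b0 <-]; rewrite -K0_classD !K0_extE// ?malg_extD//.
  exact: fh.1.
by move=> x; rewrite mcoeffD addr_ge0.
Qed.

Lemma K0_extZ f (c : R) q : harmonic_function f -> (0 <= c)%R -> K0_cone q ->
  K0_ext f (c *: q)%R = c%:E * K0_ext f q.
Proof.
move=> fh c0 [a a0 <-]; rewrite -[(c *: _)%R]K0_classZ !K0_extE// ?malg_extZ//.
  exact: fh.1.
by move=> x; rewrite mcoeffZ mulr_ge0.
Qed.

Lemma K0_ext_ge0 f q : harmonic_function f -> K0_cone q -> 0 <= K0_ext f q.
Proof. by move=> fh [a a0 <-]; rewrite K0_extE// malg_ext_ge0//; exact: fh.1. Qed.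

Lemma K0_ext_le f p q : harmonic_function f -> K0_cone p -> K0_le p q ->
  K0_ext f p <= K0_ext f q.
Proof.
move=> fh cp pq; rewrite [leRHS](_ : _ = K0_ext f (p + (q - p))%R); last by rewrite addrC subrK.
by rewrite (K0_extD fh cp pq) leeDl//; exact: K0_ext_ge0.
Qed.

Definition K0_vertex x : K0 R G := K0_class (free_vertex R x).

Lemma vertex_nonneg x : malg_nonneg (free_vertex R x).
Proof. by move=> y; rewrite mcoeffU mulrb; case: ifP. Qed.

Lemma K0_cone_vertex x : K0_cone (K0_vertex x).
Proof. by exists (free_vertex R x) => //; exact: vertex_nonneg. Qed.

Lemma K0_ext_vertex f x : harmonic_function f -> K0_ext f (K0_vertex x) = f x.
Proof. by move=> fh; rewrite K0_extE ?malg_ext_vertex//; exact: vertex_nonneg. Qed.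

Lemma K0_class_sum (I : Type) (s : seq I) (F : I -> {malg R[G]}) :
  K0_class (\sum_(i <- s) F i)%R = (\sum_(i <- s) K0_class (F i))%R.
Proof. exact: raddf_sum. Qed.

Lemma K0_vertex_upper x : K0_vertex x = (\sum_(y <- upper_seq x) K0_vertex y)%R.
Proof.
rewrite -K0_class_sum; apply/eqP; rewrite K0_classE; apply/asboolP.
exists [:: (1%R, x)]; rewrite big_seq1 scale1r /K0_relator fsbig_finite//.
exact: finite_upper.
Qed.

Lemma K0_class_vertices a :
  K0_class a = (\sum_(x <- msupp a) a@_x *: K0_vertex x)%R.
Proof.
rewrite {1}[a]monalgE K0_class_sum; apply: eq_bigr => x _.
rewrite /K0_vertex -[(_ *: K0_class _)%R]K0_classZ; congr K0_class.
by apply/malgP => y; rewrite mcoeffZ !mcoeffU; case: eqP; rewrite ?mulr1 ?mulr0.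
Qed.

Lemma harmonic_edge f x y : harmonic_function f -> edge x y -> f y <= f x.
Proof.
move=> [f0 fh] xy; rewrite [leRHS]fh upper_sumE (big_rem y) ?mem_upper_seq//=.
by rewrite leeDl// sume_ge0.
Qed.

(** A cone element of finite value has its support in the finiteness ideal, where [f] and [g] agree.
    Semifiniteness writes [f x] as a supremum of such values, each of which is at most [g x]. *)
Lemma semifinite_eq f g : semifinite_harmonic f -> harmonic_function g ->
  (forall x, g x <= f x) -> (forall x, f x < +oo -> g x = f x) -> f = g.
Proof.
move=> [fh _ fs] gh gf gE; apply/funext => x; apply/eqP; rewrite eq_le gf andbT.
rewrite -(K0_ext_vertex x fh) fs; last exact: K0_cone_vertex.
apply: ge_ereal_sup => _ [q [[b b0 <-] qx fq] <-].
rewrite -(K0_ext_vertex x gh); apply: le_trans (K0_ext_le gh _ qx); last by exists b.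
move: fq; rewrite !K0_extE// => fq; rewrite le_eqVlt; apply/orP; left; apply/eqP.
apply: eq_big_seq => y yb; congr (_ * _); rewrite gE//.
move: fq; rewrite /malg_ext (big_rem y yb)/= ltey; apply: contraNT;
    rewrite -leNgt leye_eq => /eqP ->.
have by0 : (0 < b@_y)%R by rewrite lt_neqAle b0 andbT eq_sym mcoeff_neq0.
rewrite gt0_muley// addye// gt_eqF// (lt_le_trans (ltNye 0))// sume_ge0// => z _.
by rewrite mule_ge0 ?lee_fin// fh.1.
Qed.

(** Otherwise [f] would agree with the zero function on its empty finiteness ideal, and hence be
    zero. *)
Lemma semifinite_has_finite f : semifinite_harmonic f -> (forall x, 0 < f x) ->
  exists x, f x < +oo.
Proof.
move=> fs f0; apply/not_existsP => foo; have [fh [x xoo] _] := fs.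
have zh : harmonic_function (cst 0 : G -> \bar R).
  by split=> // y; rewrite upper_sumE big1.
have := f0 x; rewrite (semifinite_eq fs zh) ?ltxx// => y; first exact: fh.1.
by move=> /foo.
Qed.

(** * Least extensions are finite or semifinite *)

Section SemifiniteExtension.
Context (h : G -> \bar R) (A : set G).
Hypotheses (h0 : forall x, 0 <= h x) (hfin : forall x, h x < +oo)
  (Aup : forall x y, A x -> edge x y -> A y)
  (hA : forall x, A x -> h x = \sum_(y <- upper_seq x) h y) (hnA : forall x, ~ A x -> h x = 0).

Lemma supported_sub x : h x <= push h 1 x.
Proof.
by have [/hA ->//|/hnA ->] := pselect (A x); exact: push_ge0.
Qed.

Lemma push_supported k x : A x -> push h k x = h x.
Proof.
elim: k x => //= k IH x Ax; rewrite hA//; apply: eq_big_seq => y.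
by rewrite mem_upper_seq => /(Aup Ax); exact: IH.
Qed.

Lemma harm_ext_supported x : A x -> harm_ext h x = h x.
Proof.
move=> Ax; apply/eqP; rewrite eq_le harm_ext_ge andbT.
by apply: ge_ereal_sup => _ [k _ <-]; rewrite push_supported.
Qed.

Let psi := harm_ext h.
Let psih : harmonic_function psi := harm_ext_harmonic h0 supported_sub.

(** Replace the vertex [k] times by its upper neighbours in K_0 and drop the endpoints outside [A].
    On the endpoints that remain [psi] equals [h], so the value is finite. *)
Lemma push_cone k x : exists q, [/\ K0_cone q, K0_le q (K0_vertex x) &
  K0_ext psi q = push h k x].
Proof.
elim: k x => [|k IH] x.
  have [Ax|nAx] := pselect (A x).
    exists (K0_vertex x); rewrite K0_ext_vertex//; split; last exact: harm_ext_supported.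
      exact: K0_cone_vertex.
    by rewrite /K0_le subrr; exact: K0_cone0.
  exists 0%R; split; first exact: K0_cone0.
    by rewrite /K0_le subr0; exact: K0_cone_vertex.
  rewrite /= hnA// -(raddf0 (@K0_class R G)) K0_extE// ?malg_ext0// => y.
  by rewrite mcoeff0.
have [q qP] := choice IH; exists (\sum_(y <- upper_seq x) q y)%R.
rewrite K0_vertex_upper /=; elim: (upper_seq x) => [|y s [cs les es]].
  rewrite !big_nil; split; [exact: K0_cone0|by rewrite /K0_le subr0; exact: K0_cone0|].
  rewrite -(raddf0 (@K0_class R G)) K0_extE// ?malg_ext0// => y.
  by rewrite mcoeff0.
have [cy ley ey] := qP y.
by rewrite !big_cons; split; [exact: K0_coneD|exact: K0_leD|rewrite K0_extD// ey es].
Qed.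

(** By monotone convergence [psi] of a cone element is the supremum over [k] of its pushes, and
    [push_cone] realizes each push by a smaller cone element of finite value. *)
Lemma harm_ext_semifinite : finite_harmonic psi \/ semifinite_harmonic psi.
Proof.
have [psifin|] := pselect (forall x, psi x < +oo); first by left.
move=> /existsNP[x0 /negP]; rewrite -leNgt leye_eq => /eqP psix0.
right; split; [exact: psih|by exists x0|].
move=> _ [a a0 <-]; apply/eqP; rewrite eq_le; apply/andP; split; last first.
  by apply: ge_ereal_sup => _ [p [cp ple _] <-]; exact: K0_ext_le.
rewrite K0_extE// /malg_ext.
rewrite (_ : \sum_(x <- _) _ = \sum_(x <- msupp a)
    ereal_sup (range (fun k => (a@_x)%:E * push h k x))); last first.
  apply: eq_bigr => x _; rewrite -ereal_supZl//; last first.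
    by apply/set0P; exists (push h 0 x), 0%N.
  congr ereal_sup; apply/seteqP; split=> [_ [_ [k _ <-] <-]|_ [k _ <-]].
    by exists k.
  by exists (push h k x) => //; exists k.
rewrite sup_sum => [|x k|x i j ij]; last 2 first.
- by rewrite mule_ge0 ?lee_fin// push_ge0.
- by rewrite lee_wpmul2l ?lee_fin// push_homo//; exact: supported_sub.
apply: ge_ereal_sup => _ [k _ <-].
have [q qP] := choice (push_cone k).
apply: ereal_sup_ubound; exists (\sum_(x <- msupp a) a@_x *: q x)%R; last first.
  elim: (msupp a : seq G) => [|y s IH].
    rewrite !big_nil -(raddf0 (@K0_class R G)) K0_extE// ?malg_ext0// => y.
    by rewrite mcoeff0.
  have [cy ley ey] := qP y.
  rewrite !big_cons K0_extD ?K0_extZ//; first by rewrite ey IH.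
    exact: K0_coneZ.
  elim: {IH} s => [|z s IH]; first by rewrite big_nil; exact: K0_cone0.
  by rewrite big_cons; apply: K0_coneD => //; apply: K0_coneZ => //; have [] := qP z.
suff [h1 h2 h3] : [/\ K0_cone (\sum_(x <- msupp a) a@_x *: q x)%R,
    K0_le (\sum_(x <- msupp a) a@_x *: q x)%R (\sum_(x <- msupp a) a@_x *: K0_vertex x)%R &
    K0_ext psi (\sum_(x <- msupp a) a@_x *: q x)%R < +oo].
  by split=> //; rewrite K0_class_vertices.
elim: (msupp a : seq G) => [|y s [IH1 IH2 IH3]].
  rewrite !big_nil; split; [exact: K0_cone0|by rewrite /K0_le subr0; exact: K0_cone0|].
  rewrite -(raddf0 (@K0_class R G)) K0_extE// ?malg_ext0// => y.
  by rewrite mcoeff0.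
have [cy ley ey] := qP y.
have cy' := K0_coneZ (a0 y) cy.
rewrite !big_cons; split; [exact: K0_coneD|by apply: K0_leD => //; exact: K0_leZ|].
rewrite K0_extD// K0_extZ// lte_add_pinfty// ey lte_mul_pinfty ?lee_fin//.
have fin : forall z, push h k z \is a fin_num.
  elim: k {qP ey} => [|k IHk] z /=; first by rewrite ge0_fin_numE.
  by apply/sum_fin_numP => v _ _; exact: IHk.
by rewrite -ge0_fin_numE// push_ge0.
Qed.

End SemifiniteExtension.
End ConeValues.
End Paths.

Lemma sumn_incr_nth n i : sumn (incr_nth n i) = (sumn n).+1.
Proof.
elim: n i => [|a n IH] [|i] //=; last by rewrite IH addnS.
by elim: i => //= i ->.
Qed.

Lemma size_incr m n i : size n = m -> (i < m)%N -> size (incr_nth n i) = m.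
Proof. by move=> nm im; rewrite size_incr_nth nm im. Qed.

Lemma lattice_ind (m : nat) (P : seq nat -> Prop) : P (nseq m 0%N) ->
  (forall n i, size n = m -> (i < m)%N -> P n -> P (incr_nth n i)) ->
  forall n, size n = m -> P n.
Proof.
move=> P0 PS n; elim: {n}(sumn n) {-2}n (erefl (sumn n)) => [|s IH] n sn nm.
  suff -> : n = nseq m 0%N by [].
  rewrite -nm; apply/all_pred1P; apply/allP => x xn.
  by move: sn; have /perm_sumn -> /= := perm_to_rem xn; case: x {xn}.
have /hasP[x xn x0] : has (fun x => 0 < x)%N n.
  rewrite -[has _ _]negbK -all_predC; apply/negP => /allP n0.
  suff : sumn n = 0%N by rewrite sn.
  have /all_pred1P -> : all (pred1 0%N) n by apply/allP => x /n0 /=; rewrite lt0n negbK.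
  by rewrite sumn_nseq.
pose i := index x n.
have im : (i < m)%N by rewrite -nm index_mem.
pose n' := set_nth 0%N n i x.-1.
have n'm : size n' = m by rewrite size_set_nth nm; apply/maxn_idPr.
have nE : n = incr_nth n' i.
  apply: (@eq_from_nth _ 0%N) => [|k _]; first by rewrite (@size_incr m)// nm.
  rewrite nth_incr_nth nth_set_nth /= eq_sym; case: eqP => [->|_]; rewrite ?add0n//.
  by rewrite nth_index// add1n prednK.
rewrite nE; apply: PS => //; apply: IH => //.
by move: sn; rewrite nE sumn_incr_nth => -[].
Qed.

(** * The Choquet-Deny theorem for the walk on N^m *)

Section ChoquetDeny.
Local Open Scope ring_scope.
Context (R : realType) (m : nat) (w : nat -> R).
Hypotheses (w0 : forall j, (j < m)%N -> 0 < w j) (w1 : \sum_(j < m) w j = 1).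
Implicit Types (n : seq nat) (q : seq nat -> R).

Definition walk_harmonic q :=
  forall n, size n = m -> q n = \sum_(j < m) w j * q (incr_nth n j).

Let size_incr := @size_incr m.

Lemma incr_nthC n i j : size n = m -> (i < m)%N -> (j < m)%N ->
  incr_nth (incr_nth n i) j = incr_nth (incr_nth n j) i.
Proof.
move=> nm im jm; apply: (@eq_from_nth _ 0%N) => [|k _].
  by rewrite !size_incr_nth !nm !(im, jm) ?nm ?im ?jm.
by rewrite !nth_incr_nth addnCA.
Qed.

(* If an increment of [q] were nearly maximal and positive at [n], harmonicity
   would force it to stay nearly maximal along [n + k e_i], and [q] would grow
   beyond any bound. *)
Lemma walk_harmonic_nonincreasing q (B : R) i : (i < m)%N -> walk_harmonic q ->
  (forall n, size n = m -> `|q n| <= B) ->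
  forall n, size n = m -> q (incr_nth n i) <= q n.
Proof.
move=> im qh qB n0 n0m; rewrite leNgt; apply/negP => lt0.
pose g n := q (incr_nth n i) - q n.
have gh : walk_harmonic g.
  move=> n nm; rewrite /g (qh (incr_nth n i)) ?size_incr// (qh n)// -sumrB.
  by apply: eq_bigr => j _; rewrite -mulrBr incr_nthC.
pose S := [set g n | n in [set n | size n = m]]%classic.
have Sub : has_sup S.
  split; first by exists (g n0), n0.
  exists (2 * B) => _ [n nm <-]; rewrite /g.
  have := qB _ nm; have := qB _ (size_incr nm im).
  rewrite !ler_norml => /andP[_ h1] /andP[h2 _]; lra.
pose M := sup S.
have gM n : size n = m -> g n <= M by move=> nm; apply: ub_le_sup; [exact: Sub.2|exists n].
have M0 : 0 < M by apply: lt_le_trans (gM _ n0m); rewrite subr_gt0.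
(* The deficit [M - g] is nonnegative and harmonic, so one term of its average is bounded by the
   whole. *)
have step n e : size n = m -> M - g n <= e -> M - g (incr_nth n i) <= e / w i.
  move=> nm Me; rewrite ler_pdivlMr ?w0//.
  have : M - g n = \sum_(j < m) w j * (M - g (incr_nth n j)).
    under eq_bigr do rewrite mulrBr.
    by rewrite sumrB -mulr_suml w1 mul1r -gh.
  rewrite (bigD1 (Ordinal im))//= => E.
  rewrite mulrC; apply: le_trans Me; rewrite E lerDl sumr_ge0// => j _.
  by rewrite mulr_ge0 ?subr_ge0 ?gM ?size_incr// ltW// w0.
have wi1 : w i <= 1.
  rewrite -w1 (bigD1 (Ordinal im))//= lerDl sumr_ge0// => j _.
  by rewrite ltW// w0.
(* [K] increments of size [M / 2] exceed [2 * B], the largest possible oscillation of [q]. Each step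
   may divide the deficit by [w i]; starting from at most [e], it stays at most [M / 2] for [K]
   steps. *)
pose K := (Num.truncn (4 * B / M)).+1.
pose e := M / 2 * w i ^+ K.
have e0 : 0 < e by rewrite mulr_gt0 ?divr_gt0 ?exprn_gt0 ?w0.
have [_ [n nm <-] gn] := sup_adherent e0 Sub.
pose nk k := iter k (incr_nth^~ i) n.
have snk k : size (nk k) = m by elim: k => //= k IH; rewrite size_incr.
have gk k : (k <= K)%N -> M / 2 <= g (nk k).
  move=> kK; suff : M - g (nk k) <= M / 2 * w i ^+ (K - k).
    have : M / 2 * w i ^+ (K - k) <= M / 2.
      by rewrite ler_piMr ?divr_ge0 ?exprn_ile1 ?(ltW (w0 _)) ?(ltW M0).
    by lra.
  elim: k kK => [|k IH] kK.
    by rewrite subn0 -/e /= ; move: gn; rewrite -/M; lra.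
  apply: le_trans (step _ _ (snk k) (IH (ltnW kK))) _.
  by rewrite (_ : K - k = (K - k.+1).+1)%N ?exprSr ?mulrA ?mulfK ?gt_eqF ?w0//; lia.
have grow k : (k <= K)%N -> k%:R * (M / 2) <= q (nk k) - q n.
  elim: k => [|k IH] kK; first by rewrite mul0r subrr.
  have := IH (ltnW kK); have := gk k (ltnW kK); rewrite /g /= -/(nk k) -[k.+1%:R]natr1 mulrDl mul1r.
  by lra.
have := grow K (leqnn _); rewrite leNgt => /negP; apply.
have : 4 * B / M < K%:R by exact: truncnS_gt.
rewrite ltr_pdivrMr// => h1.
have := qB _ (snk K); have := qB _ nm.
rewrite !ler_norml => /andP[h2 _] /andP[_ h3]; lra.
Qed.

(** Applied to [q] and to [-q], the monotonicity shows that no step changes [q]. *)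
Lemma walk_harmonic_constant q (B : R) : walk_harmonic q ->
  (forall n, size n = m -> `|q n| <= B) ->
  forall n, size n = m -> q n = q (nseq m 0%N).
Proof.
move=> qh qB.
have step n i : size n = m -> (i < m)%N -> q (incr_nth n i) = q n.
  move=> nm im; apply/eqP; rewrite eq_le (walk_harmonic_nonincreasing im qh qB)//=.
  rewrite -lerN2; apply: (@walk_harmonic_nonincreasing (fun n => - q n) B) => //.
    by move=> k km; rewrite qh// -sumrN; apply: eq_bigr => j _; rewrite mulrN.
  by move=> k km; rewrite normrN qB.
move=> n; apply: (@lattice_ind m (fun n => q n = q (nseq m 0%N))) => // k i km im e.
by rewrite step.
Qed.

End ChoquetDeny.

(** * Lattices inside a graded graph and the extensions from them *)

Section LatticeInGraph.
Local Open Scope ring_scope.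
Local Open Scope ereal_scope.
Context (R : realType) (G : graded_graph) (m : nat) (g : seq nat -> G).
Implicit Types (f h : G -> \bar R) (a : seq nat -> R) (n : seq nat).

Definition embedded_lattice : Prop :=
  {in [pred n | size n == m] &, injective g} /\
  forall n, size n = m -> forall y, edge (g n) y <-> exists2 j, (j < m)%N & y = g (incr_nth n j).

Hypothesis gL : embedded_lattice.

Let size_incr := @size_incr m.

Definition lattice_harmonic a : Prop :=
  forall n, size n = m -> a n = (\sum_(j < m) a (incr_nth n j))%R.

Lemma upper_lattice f n : size n = m ->
  \sum_(y <- upper_seq (g n)) f y = \sum_(j < m) f (g (incr_nth n j)).
Proof.
move=> nm; rewrite -(big_mkord predT (fun j => f (g (incr_nth n j)))) /index_iota subn0.
rewrite -(big_map (fun j => g (incr_nth n j)) predT f).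
apply: perm_big; apply: uniq_perm; first exact: uniq_upper_seq.
  rewrite map_inj_in_uniq ?iota_uniq// => i j; rewrite !mem_iota !add0n /= => im jm.
  by move=> /gL.1; rewrite !inE !size_incr// eqxx => /(_ erefl erefl) /incr_nth_inj.
move=> y; rewrite mem_upper_seq; apply/idP/mapP => [/gL.2 -/(_ nm)[j jm ->]|[j]].
  by exists j => //; rewrite mem_iota.
by rewrite mem_iota => jm ->; apply/gL.2 => //; exists j.
Qed.

Definition lattice_fun a (x : G) : \bar R :=
  if pselect (exists2 n, size n = m & g n = x) is left e then (a (projT1 (cid2 e)))%:E else 0.

Lemma lattice_funE a n : size n = m -> lattice_fun a (g n) = (a n)%:E.
Proof.
move=> nm; rewrite /lattice_fun; case: pselect => [e|[]]; last by exists n.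
case: cid2 => k km /= gk; congr (a _)%:E.
by apply: gL.1 gk; rewrite inE ?km ?nm.
Qed.

Lemma lattice_fun_out a x : ~ (exists2 n, size n = m & g n = x) -> lattice_fun a x = 0.
Proof. by rewrite /lattice_fun; case: pselect. Qed.

Definition lattice_ext a : G -> \bar R := harm_ext (lattice_fun a).

Section Ext.
Context (a : seq nat -> R).
Hypotheses (a0 : forall n, size n = m -> (0 <= a n)%R) (ah : lattice_harmonic a).

Let A : set G := [set x | exists2 n, size n = m & g n = x]%classic.

Let h0 x : 0 <= lattice_fun a x.
Proof.
have [[n nm <-]|nA] := pselect (A x); last by rewrite lattice_fun_out.
by rewrite lattice_funE// lee_fin a0.
Qed.

Let hfin x : lattice_fun a x < +oo.
Proof.
have [[n nm <-]|nA] := pselect (A x); last by rewrite lattice_fun_out.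
by rewrite lattice_funE// ltry.
Qed.

Let Aup x y : A x -> edge x y -> A y.
Proof.
by move=> [n nm <-] /gL.2 -/(_ nm)[j jm ->]; exists (incr_nth n j); rewrite ?size_incr.
Qed.

Let hA x : A x -> lattice_fun a x = \sum_(y <- upper_seq x) lattice_fun a y.
Proof.
move=> [n nm <-]; rewrite upper_lattice// lattice_funE// ah//.
by rewrite -sumEFin; apply: eq_bigr => j _; rewrite lattice_funE// size_incr.
Qed.

Let hnA x : ~ A x -> lattice_fun a x = 0.
Proof. exact: lattice_fun_out. Qed.

Let hsub := supported_sub h0 hA hnA.

Lemma lattice_ext_harmonic : harmonic_function (lattice_ext a).
Proof. exact: harm_ext_harmonic. Qed.

Lemma lattice_ext_lattice n : size n = m -> lattice_ext a (g n) = (a n)%:E.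
Proof.
move=> nm; rewrite /lattice_ext (@harm_ext_supported _ _ _ A)//; last by exists n.
exact: lattice_funE.
Qed.

Lemma lattice_ext_semifinite :
  finite_harmonic (lattice_ext a) \/ semifinite_harmonic (lattice_ext a).
Proof. exact: (@harm_ext_semifinite _ _ _ A). Qed.

Lemma lattice_ext_min f : (forall x, 0 <= f x) ->
  (forall x, \sum_(y <- upper_seq x) f y <= f x) ->
  (forall n, size n = m -> (a n)%:E <= f (g n)) -> forall x, lattice_ext a x <= f x.
Proof.
move=> f0 fs fa x; apply: harm_ext_min => // y.
have [[n nm <-]|nA] := pselect (A y); first by rewrite lattice_funE// fa.
by rewrite lattice_fun_out.
Qed.

Lemma lattice_ext_minZ f (c : R) : (0 <= c)%R -> (forall x, 0 <= f x) ->
  (forall x, \sum_(y <- upper_seq x) f y <= f x) ->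
  (forall n, size n = m -> (c * a n)%:E <= f (g n)) ->
  forall x, c%:E * lattice_ext a x <= f x.
Proof.
rewrite le_eqVlt => /predU1P[<-|c0] f0 fs fa x; first by rewrite mul0e.
rewrite muleC -lee_pdivlMr//; apply: (lattice_ext_min (f := fun x => f x * (c^-1)%:E)).
- by move=> y; rewrite mule_ge0// lee_fin invr_ge0 ltW.
- move=> y; rewrite -ge0_sume_distrl//; apply: lee_wpmul2r => //.
  by rewrite lee_fin invr_ge0 ltW.
- by move=> n nm; rewrite lee_pdivlMr// -EFinM mulrC fa.
Qed.

End Ext.

Lemma harmonic_fine f psi x : (forall y, 0 <= psi y <= f y) ->
  (f x = \sum_(y <- upper_seq x) f y) -> (psi x = \sum_(y <- upper_seq x) psi y) ->
  f x < +oo -> fine (psi x) = (\sum_(y <- upper_seq x) fine (psi y))%R.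
Proof.
move=> pf fh ph fx; have f0 y : 0 <= f y by have /andP[p0] := pf y; exact: le_trans.
have pE y : f y < +oo -> psi y = (fine (psi y))%:E.
  move=> fy; rewrite fineK//; have /andP[p0 pfy] := pf y.
  by rewrite ge0_fin_numE// (le_lt_trans pfy).
apply: EFin_inj; rewrite -pE// -sumEFin ph; apply: eq_big_seq => y yx; apply: pE.
by apply: le_lt_trans (fx); rewrite fh (big_rem y)//= leeDl// sume_ge0.
Qed.

(** Since [u] is real, the difference is infinite wherever [f] is, and the inequality is trivial
    there; elsewhere both functions are harmonic. This produces the competitors for the minimality
    of [lattice_ext]. *)
Lemma superharmonic_gap f (u : G -> R) :
  (forall x, 0 <= f x) ->
  (forall x, f x < +oo -> f x = \sum_(y <- upper_seq x) f y) ->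
  (forall x, f x < +oo -> u x = (\sum_(y <- upper_seq x) u y)%R) ->
  (forall x, (u x)%:E <= f x) ->
  let chi x := f x - (u x)%:E in
  (forall x, 0 <= chi x) /\ (forall x, \sum_(y <- upper_seq x) chi y <= chi x).
Proof.
move=> f0 fh uh uf chi; split=> x; rewrite /chi; first by rewrite sube_ge0// uf.
have [fx|] := boolP (f x < +oo); last first.
  by rewrite -leNgt leye_eq => /eqP ->; rewrite addye// leey.
rewrite (uh x fx) fh// -sumEFin -sumeN; last first.
  by move=> i j _ _; rewrite fin_num_adde_defl.
by rewrite -big_split.
Qed.

Lemma lattice_ext_eq a f (d : R) :
  (forall n, size n = m -> (0 <= a n)%R) -> lattice_harmonic a ->
  (forall x, 0 <= f x) -> (forall n, size n = m -> f (g n) = (a n)%:E) ->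
  (forall x, f x < +oo -> f x = \sum_(y <- upper_seq x) f y) ->
  (0 < d)%R -> (forall x, f x < +oo -> d%:E * f x <= lattice_ext a x) ->
  forall x, f x < +oo -> lattice_ext a x = f x.
Proof.
move=> a0 ah f0 fa fh; wlog d1 : d / (d < 1)%R => [wl d0 df|d0 df].
  (* [d / (1 + d)] is smaller than both [1] and [d]. *)
  apply: (wl (d / (1 + d))%R); rewrite ?divr_gt0 ?ltr_pdivrMr ?ltr_wpDl ?addr_gt0//.
  - by rewrite mul1r ltrDr.
  - move=> x /df; apply: le_trans; rewrite lee_wpmul2r// lee_fin.
    by rewrite ler_pdivrMr ?addr_gt0//; nra.
have sup x : \sum_(y <- upper_seq x) f y <= f x.
  have [/fh <-//|] := boolP (f x < +oo).
  by rewrite -leNgt leye_eq => /eqP ->; rewrite leey.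
have pf x : 0 <= lattice_ext a x <= f x.
  rewrite (lattice_ext_harmonic a0 ah).1/=; apply: lattice_ext_min => // n nm.
  by rewrite fa.
have fin x : f x < +oo -> f x = (fine (f x))%:E /\ lattice_ext a x = (fine (lattice_ext a x))%:E.
  move=> fx; have /andP[p0 pfx] := pf x.
  by rewrite !fineK ?ge0_fin_numE// (le_lt_trans pfx).
have pf2 x : 0 <= f x <= f x by rewrite f0 lexx.
have ph x : lattice_ext a x = \sum_(y <- upper_seq x) lattice_ext a y.
  by rewrite [LHS](lattice_ext_harmonic a0 ah).2 upper_sumE.
(* With psi for the least extension, [u <= f] amounts to [d f <= psi] where [f] is finite, and [u]
   vanishes on the lattice because both functions equal [a] there. *)
pose u x : R := if f x < +oo then ((fine (f x) - fine (lattice_ext a x)) / (1 - d))%R else 0%R.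
have [|x|chi0 chis x fx] := @superharmonic_gap f u f0 fh.
- move=> x fx; rewrite {1}/u fx (harmonic_fine pf2 (fh x fx) (fh x fx) fx).
  rewrite (harmonic_fine pf (fh x fx) (ph x) fx) -sumrB mulr_suml.
  apply: eq_big_seq => y yx; rewrite /u ifT//.
  apply: le_lt_trans (fx); rewrite [leRHS]fh// (big_rem y)//= leeDl// sume_ge0//.
- rewrite /u; case: ifPn => fx; last by rewrite f0.
  have := df x fx; have [fE lE] := fin x fx; have := f0 x; have /andP[_] := pf x.
  rewrite fE lE !lee_fin /= => lf f00 dfl.
  by rewrite ler_pdivrMr ?subr_gt0//; lra.
have [fE lE] := fin x fx.
have : lattice_ext a x <= f x - (u x)%:E.
  apply: (lattice_ext_min (f := fun x => f x - (u x)%:E)) => // n nm;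
      rewrite /u fa// ltry lattice_ext_lattice//=.
  by rewrite subrr mul0r sube0.
rewrite /u fx; have /andP[_] := pf x; rewrite fE lE !lee_fin /= => lf h.
congr EFin; apply/eqP; rewrite eq_le lf/=.
(* Dividing a positive gap by [1 - d < 1] would enlarge it; hence the gap is zero. *)
have : ((fine (f x) - fine (lattice_ext a x)) / (1 - d) <= fine (f x) - fine (lattice_ext a x))%R.
  by lra.
rewrite ler_pdivrMr ?subr_gt0// => h2.
have : (d * (fine (f x) - fine (lattice_ext a x)) <= 0)%R by lra.
by rewrite pmulr_rle0// subr_le0.
Qed.

Definition multiplicative_on (w : nat -> R) a : Prop :=
  forall n j, size n = m -> (j < m)%N -> a (incr_nth n j) = (w j * a n)%R.

Lemma multiplicative_harmonic (w : nat -> R) a : (\sum_(j < m) w j = 1)%R ->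
  multiplicative_on w a -> lattice_harmonic a.
Proof.
move=> w1 wa n nm; under eq_bigr do rewrite wa//.
by rewrite -mulr_suml w1 mul1r.
Qed.

(** The quotient [psi / a] is a Doob transform: multiplicativity of [a] turns the unweighted sums
    over the steps into averages with the weights [w]. The quotient lies in [0, 1], so it is
    constant by Choquet-Deny. *)
Lemma harmonic_proportional (w : nat -> R) a f psi :
  (forall j, (j < m)%N -> 0 < w j)%R -> (\sum_(j < m) w j = 1)%R ->
  multiplicative_on w a -> (forall n, size n = m -> (0 < a n)%R) ->
  (forall n, size n = m -> f (g n) = (a n)%:E) ->
  harmonic_function psi -> (forall x, psi x <= f x) ->
  exists2 c : R, (0 <= c <= 1)%R & forall n, size n = m -> psi (g n) = (c * a n)%:E.
Proof.
move=> w0 w1 wa a0 fa ph pf.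
have pE n : size n = m -> psi (g n) = (fine (psi (g n)))%:E.
  by move=> nm; rewrite fineK// ge0_fin_numE ?ph.1// (le_lt_trans (pf _))// fa// ltry.
pose q n := (fine (psi (g n)) / a n)%R.
have q01 n : size n = m -> (0 <= q n <= 1)%R.
  move=> nm; apply/andP; split.
    by rewrite divr_ge0 ?fine_ge0 ?ph.1// ltW ?a0.
  by rewrite /q ler_pdivrMr ?a0// mul1r -lee_fin -pE// -fa.
have qh : walk_harmonic m w q.
  move=> n nm; rewrite /q; apply: (mulIf (lt0r_neq0 (a0 n nm))).
  rewrite divfK ?gt_eqF ?a0// mulr_suml.
  apply: EFin_inj; rewrite -pE// ph.2 upper_sumE upper_lattice// -sumEFin.
  apply: eq_bigr => j _; rewrite [LHS]pE ?size_incr//; congr EFin.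
  by rewrite wa//; field; rewrite !lt0r_neq0 ?w0 ?a0.
exists (q (nseq m 0%N)); first by apply: q01; rewrite size_nseq.
move=> n nm; rewrite -(@walk_harmonic_constant _ _ _ w0 w1 q 1 qh _ n nm).
  by rewrite /q divfK ?gt_eqF ?a0// pE.
by move=> k /q01 /andP[q0 q1]; rewrite ger0_norm.
Qed.

(** With [psi = c a] on the lattice, minimality of [f] gives [c f <= psi]. The gap [f - psi] is
    superharmonic and equals [(1 - c) a] on the lattice, so minimality also gives
    [(1 - c) f <= f - psi] on the finiteness ideal. *)
Lemma lattice_ext_indecomposable (w : nat -> R) a f :
  (forall j, (j < m)%N -> 0 < w j)%R -> (\sum_(j < m) w j = 1)%R ->
  multiplicative_on w a -> (forall n, size n = m -> (0 < a n)%R) ->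
  f = lattice_ext a -> indecomposable f.
Proof.
move=> w0 w1 wa a0 fE psi psi_h pf _.
have {}psi_h : harmonic_function psi by case: psi_h => [[]|[]].
have a00 n : size n = m -> (0 <= a n)%R by move=> nm; rewrite ltW ?a0.
have ah := multiplicative_harmonic w1 wa.
have fa n : size n = m -> f (g n) = (a n)%:E.
  by move=> nm; rewrite fE lattice_ext_lattice.
have fh : harmonic_function f by rewrite fE; exact: lattice_ext_harmonic.
have [c /andP[c0 c1] psiE] := harmonic_proportional w0 w1 wa a0 fa psi_h pf.
exists c => x fx.
have psih' y : psi y = \sum_(z <- upper_seq y) psi z by rewrite -upper_sumE -psi_h.2.
have fh' y : f y = \sum_(z <- upper_seq y) f z by rewrite -upper_sumE -fh.2.
have lb : c%:E * f x <= psi x.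
  rewrite fE; apply: lattice_ext_minZ => //; first exact: psi_h.1.
    by move=> y; rewrite -psih'.
  by move=> n nm; rewrite psiE.
have pf' y : 0 <= psi y <= f y by rewrite psi_h.1 pf.
pose u y : R := if f y < +oo then fine (psi y) else 0%R.
have psifin y : f y < +oo -> psi y = (fine (psi y))%:E.
  by move=> fy; rewrite fineK// ge0_fin_numE ?psi_h.1// (le_lt_trans (pf y)).
have [|y|chi0 chis] := @superharmonic_gap f u fh.1 (fun y _ => fh' y).
- move=> y fy; rewrite {1}/u fy (harmonic_fine pf' (fh' y) (psih' y) fy).
  apply: eq_big_seq => z zy; rewrite /u ifT//; apply: le_lt_trans (fy).
  by apply: harmonic_edge => //; rewrite -mem_upper_seq.
- by rewrite /u; case: ifPn => fy; [rewrite -psifin|exact: fh.1].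
have ub : (1 - c)%:E * f x <= f x - (u x)%:E.
  rewrite [in leLHS]fE; apply: (lattice_ext_minZ (f := fun y => f y - (u y)%:E) _ chi0 chis _ x).
    by rewrite subr_ge0.
  move=> n nm; rewrite fa// /u fa// ltry psiE//= lee_fin; lra.
apply/eqP; rewrite eq_le lb andbT.
have fxE : f x = (fine (f x))%:E by rewrite fineK// ge0_fin_numE ?fh.1.
move: ub; rewrite /u fx (psifin x fx) fxE lee_fin => h.
rewrite lee_fin; move: h; rewrite /=; lra.
Qed.

Lemma indecomposable_lattice f :
  semifinite_harmonic f -> indecomposable f ->
  (forall n, size n = m -> 0 < f (g n) < +oo) ->
  let a n := fine (f (g n)) in
  exists w : nat -> R, [/\ forall j, (j < m)%N -> (0 < w j)%R, (\sum_(j < m) w j = 1)%R,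
    multiplicative_on w a & f = lattice_ext a].
Proof.
move=> fs fi f0 a; have fh : harmonic_function f by case: fs.
have aE n : size n = m -> f (g n) = (a n)%:E.
  by move=> nm; rewrite fineK// ge0_fin_numE ?fh.1//; have /andP[] := f0 n nm.
have a0 n : size n = m -> (0 < a n)%R.
  by move=> nm; rewrite -lte_fin -aE//; have /andP[] := f0 n nm.
have a00 n : size n = m -> (0 <= a n)%R by move=> nm; rewrite ltW ?a0.
have ah : lattice_harmonic a.
  move=> n nm; apply: EFin_inj; rewrite -aE// fh.2 upper_sumE upper_lattice// -sumEFin.
  by apply: eq_bigr => j _; rewrite aE// size_incr.
have fsup x : \sum_(y <- upper_seq x) f y <= f x by rewrite -upper_sumE -fh.2.
pose z := nseq m 0%N; have zm : size z = m by rewrite size_nseq.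
have fin n : size n = m -> finiteness_ideal f (g n).
  by move=> nm; have /andP[] := f0 n nm.
(* The least extension of any such [b] lies below [f] and is finite or semifinite, so
   indecomposability applies to it. This is used for the translates of [a] by unit vectors and for
   [a] itself. *)
have key b : (forall n, size n = m -> (0 < b n)%R) -> lattice_harmonic b ->
    (forall n, size n = m -> (b n <= a n)%R) ->
    exists2 c : R, (forall x, finiteness_ideal f x -> lattice_ext b x = c%:E * f x) &
      forall n, size n = m -> b n = (c * a n)%R.
  move=> b0 bh ba.
  have b00 n : size n = m -> (0 <= b n)%R by move=> nm; rewrite ltW ?b0.
  have [| |c cE] := fi (lattice_ext b) (lattice_ext_semifinite b00 bh).
  - apply: lattice_ext_min => //; first exact: fh.1.
    by move=> n nm; rewrite aE// lee_fin ba.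
  - exists (g z); first exact: fin.
    by rewrite lattice_ext_lattice// gt_eqF// lte_fin b0.
  - exists c => // n nm; apply: EFin_inj; rewrite EFinM -aE// -cE; last exact: fin.
    by rewrite lattice_ext_lattice.
have shift j : (j < m)%N -> exists c : R, forall n, size n = m -> a (incr_nth n j) = (c * a n)%R.
  move=> jm; have [| | |c _ cE] := key (fun n => a (incr_nth n j)).
  - by move=> n nm; rewrite a0// size_incr.
  - move=> n nm; rewrite ah ?size_incr//; apply: eq_bigr => i _.
    by rewrite (@incr_nthC m).
  - move=> n nm; rewrite [leRHS]ah// (bigD1 (Ordinal jm))//= lerDl.
    by apply: sumr_ge0 => i _; rewrite a00// size_incr.
  - by exists c.
have /choice[w wP] : forall j, exists c : R, (j < m)%N ->
    forall n, size n = m -> a (incr_nth n j) = (c * a n)%R.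
  move=> j; case: (ltnP j m) => [/shift[c cP]|_]; first by exists c.
  by exists 0%R.
exists w; split.
- move=> j jm; have := wP j jm z zm.
  move=> /(congr1 (fun r => r / a z)%R); rewrite mulfK ?gt_eqF ?a0// => <-.
  by rewrite divr_gt0 ?a0 ?size_incr.
- apply: (mulIf (lt0r_neq0 (a0 z zm))); rewrite mul1r [RHS]ah// mulr_suml.
  by apply: eq_bigr => j _; rewrite wP.
- by move=> n j nm jm; exact: wP.
(* For [b = a] the factor is 1, so the least extension agrees with [f] on the finiteness ideal;
   semifiniteness of [f] extends this to all vertices. *)
- have [c cE /(_ z zm)] := key a a0 ah (fun n _ => lexx _).
  move=> /(congr1 (fun r => r / a z)%R); rewrite mulfK ?divff ?gt_eqF ?a0// => c1.
  apply: semifinite_eq => //; first exact: lattice_ext_harmonic.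
    apply: lattice_ext_min => //; first exact: fh.1.
    by move=> n nm; rewrite aE.
  by move=> x /cE ->; rewrite -c1 mul1e.
Qed.

End LatticeInGraph.

(** * Words, insertions and subsequences *)

Section Words.
Implicit Types (x y z u v : word).

Definition insertion x y : Prop := exists u c v, x = u ++ v /\ y = u ++ c :: v.

Lemma zigzag_edgeP x y : zigzag_edge (Some x) (Some y) <-> insertion x y.
Proof.
split=> [/existsP[i /eqP ->]|[u [c [v [-> ->]]]]].
  exists (take i y), (nth true y i), (drop i.+1 y); split=> //.
  by rewrite -drop_nth// cat_take_drop.
have iy : size u < size (u ++ c :: v) by rewrite size_cat /= -addSnnS leq_addr.
apply/existsP; exists (Ordinal iy) => /=; rewrite /delete_symbol take_size_cat//.
by rewrite -cat_rcons drop_size_cat// size_rcons.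
Qed.

Lemma insertion_size x y : insertion x y -> size y = (size x).+1.
Proof. by move=> [u [c [v [-> ->]]]]; rewrite !size_cat addnS. Qed.

Lemma insertion_subseq x y : insertion x y -> subseq x y.
Proof. by move=> [u [c [v [-> ->]]]]; rewrite cat_subseq// subseq_cons. Qed.

Lemma insertion_catl x y z : insertion x y -> insertion (z ++ x) (z ++ y).
Proof. by move=> [u [c [v [-> ->]]]]; exists (z ++ u), c, v; rewrite !catA. Qed.

Lemma insertion_catr x y z : insertion x y -> insertion (x ++ z) (y ++ z).
Proof. by move=> [u [c [v [-> ->]]]]; exists u, c, (v ++ z); rewrite -!catA. Qed.

Lemma insertion_cons x c : insertion x (c :: x).
Proof. by exists [::], c, x. Qed.

Lemma insertion_cat x y z : insertion x (y ++ z) ->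
  (exists2 y', insertion y' y & x = y' ++ z) \/ (exists2 z', insertion z' z & x = y ++ z').
Proof.
elim: y x => [|b y IH] x; first by right; exists x.
case=> -[|a u] [c [v [-> /= [-> yzE]]]].
  by left; exists y; [exists [::], c, y|rewrite yzE].
have /IH[[y' iy' uvE]|[z' iz' uvE]] : insertion (u ++ v) (y ++ z) by exists u, c, v.
  left; exists (a :: y'); last by rewrite /= uvE.
  exact: (@insertion_catl _ _ [:: a]).
by right; exists z' => //; rewrite /= uvE.
Qed.

Lemma insertion_nseq x k (s : bool) : insertion x (nseq k s) ->
    exists2 k', k = k'.+1 & x = nseq k' s.
Proof.
move=> ix; have sx := insertion_size ix; rewrite size_nseq in sx; exists (size x) => //.
apply/all_pred1P/allP => c /(mem_subseq (insertion_subseq ix)).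
by rewrite mem_nseq => /andP[_ /eqP ->] /=.
Qed.

(** The first step of a path from [x] up to [y] that stays below [y]. *)
Lemma subseq_insertion x y : subseq x y -> size x < size y ->
  exists2 z, insertion x z & subseq z y.
Proof.
elim: y x => [|b y IH] [|a x]//=.
  by move=> _ _; exists [:: b]; [exact: insertion_cons|rewrite /= eqxx sub0seq].
case: eqP => [<-|_] xy; rewrite ?ltnS => sxy.
  have [z iz zy] := IH x xy sxy; exists (a :: z); last by rewrite /= eqxx.
  exact: (@insertion_catl _ _ [:: a]).
by exists (b :: a :: x); [exact: insertion_cons|rewrite /= eqxx].
Qed.

(** Inserting a symbol before an equal one has the same effect as inserting it after, so only the
    opposite symbol is placed in front of each letter. Every upper neighbour then occurs once,
    [size x + 2] in all. *)
Fixpoint word_uppers x : seq word :=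
  if x is c :: x' then (~~ c :: c :: x') :: map (cons c) (word_uppers x')
  else [:: [:: true]; [:: false]].

Lemma mem_word_uppers x y : y \in word_uppers x <-> insertion x y.
Proof.
split.
  elim: x y => [|c x IH] y /=.
    by rewrite !inE => /orP[] /eqP ->; exact: insertion_cons.
  rewrite inE => /predU1P[->|/mapP[z /IH iz ->]]; first exact: insertion_cons.
  exact: (@insertion_catl _ _ [:: c]).
move=> [u [c [v [-> ->]]]]; elim: u => [|a u IH] /=; last first.
  by rewrite inE map_f ?orbT.
elim: v c => [|d v IH] c /=; first by case: c.
rewrite inE; case: (altP (c =P ~~ d)) => [->|]; first by rewrite eqxx.
by case: c d => -[]//= _; rewrite map_f ?orbT//.
Qed.

Lemma uniq_word_uppers x : uniq (word_uppers x).
Proof.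
elim: x => //= c x IH; rewrite map_inj_uniq => [|y z []//]; rewrite IH andbT.
by apply/mapP => -[y _ []]; case: c.
Qed.

Lemma subseq_catP x y z : subseq x (y ++ z) ->
  exists x1 x2, [/\ x = x1 ++ x2, subseq x1 y & subseq x2 z].
Proof.
move=> /subseqP[m sm ->].
exists (mask (take (size y) m) y), (mask (drop (size y) m) z).
split; rewrite ?mask_subseq// -mask_cat ?cat_take_drop//.
by rewrite size_takel// sm size_cat leq_addr.
Qed.

Lemma subseq_nseqP x k (s : bool) : subseq x (nseq k s) -> exists2 i, i <= k & x = nseq i s.
Proof.
move=> sx; exists (size x); first by rewrite -(size_nseq k s) size_subseq.
apply/all_pred1P/allP => c /(mem_subseq sx).
by rewrite mem_nseq => /andP[_ /eqP ->] /=.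
Qed.

End Words.

(** * Words of Z(r), their runs, and the lattice of full words *)

Section Languages.
Implicit Types (x y z : word) (r t : seq signed_cluster) (l n : seq nat).

(** The binary words of Z(r), read cluster by cluster to allow induction on [r]; see
    [zigzags_ofE]. *)
Fixpoint lang r x : Prop :=
  if r is c :: r' then
    exists i y, [/\ fits_multiplicity i c, lang r' y & x = nseq i c.1 ++ y]
  else x = [::].

Definition cluster_powers r l : word := flatten [seq nseq p.1 p.2.1 | p <- zip l r].

Fixpoint fits_all l r : bool :=
  match l, r with
  | i :: l', c :: r' => fits_multiplicity i c && fits_all l' r'
  | [::], [::] => true
  | _, _ => false
  end.

Lemma fits_all_size l r : fits_all l r -> size l = size r.
Proof. by elim: l r => [|i l IH] [|c r]//= /andP[_ /IH ->]. Qed.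

Lemma langP r x : lang r x <-> exists2 l, fits_all l r & x = cluster_powers r l.
Proof.
elim: r x => [|c r IH] x /=.
  by split=> [->|[[]//]]; exists [::].
split=> [[i [y [fi /IH[l fl ->] ->]]]|[[//|i l] /= /andP[fi fl] ->]].
  by exists (i :: l) => //=; rewrite fi.
by exists i, (cluster_powers r l); split=> //; apply/IH; exists l.
Qed.

Lemma zigzags_ofE r x : zigzags_of r (Some x) <-> lang r x.
Proof.
rewrite langP; split=> [[l [sl fl ->]]|[l fl ->]]; exists l => //; last first.
  split=> //; first exact: fits_all_size.
  elim: l r fl => [|i l IH] [|c r]//= /andP[fi fl] [|j] //= jr; exact: IH.
elim: l r sl fl => [|i l IH] [|c r]//= [sl] fl; rewrite (fl 0)//=.
by apply: IH => // j jr; exact: (fl j.+1).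
Qed.

Lemma lang_cat r1 r2 x : lang (r1 ++ r2) x <->
  exists y z, [/\ lang r1 y, lang r2 z & x = y ++ z].
Proof.
elim: r1 x => [|c r1 IH] x /=.
  by split=> [xr|[y [z [-> ? ->]]]//]; exists [::], x.
split=> [[i [_ [fi /IH[y [z [yr zr ->]]] ->]]]|[_ [z [[i [y [fi yr ->]]] zr ->]]]].
  by exists (nseq i c.1 ++ y), z; split=> //; [exists i, y|rewrite catA].
exists i, (y ++ z); split=> //; last by rewrite catA.
by apply/IH; exists y, z.
Qed.

Lemma lang_subseq r x y : subseq y x -> lang r x -> lang r y.
Proof.
elim: r x y => [|c r IH] x y /=; first by move=> + xE; rewrite xE subseq0 => /eqP.
move=> + [i [z [fi zr xE]]]; rewrite xE => /subseq_catP[y1 [y2 [-> /subseq_nseqP[j ji ->] yz]]].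
exists j, y2; split=> //; last exact: IH yz zr.
by move: fi; rewrite /fits_multiplicity; case: c.2 => // k; exact: leq_trans.
Qed.

Lemma lang_nil r : lang r [::].
Proof. by elim: r => //= c r IH; exists 0, [::]; split=> //; case: c => ? []. Qed.

Lemma lang_cons c r x : lang r x -> lang (c :: r) x.
Proof. by exists 0, x; split=> //; case: c => ? []. Qed.

Definition alternating t : bool := sorted (fun c d : signed_cluster => c.1 != d.1) t.

(** The right-hand word has exactly [size t] runs, of lengths [l]. A factorization into at most that
    many powers must spend one factor on each run: no factor is empty and no run is split. *)
Lemma run_unique r t l l' : alternating t -> size l = size t -> all (leq 1) l ->
  size l' = size r -> cluster_powers r l' = cluster_powers t l -> size r <= size t ->
  [/\ size r = size t, map fst r = map fst t & l' = l].
Proof.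
elim: r t l l' => [|c r IH] t l l' at_ sl l0.
  case: l' => // _ e _; case: t at_ sl e => [|d t] _; first by case: l l0.
  by case: l l0 => [|[|i] l].
case: l' => // i l' [sl'].
case: t at_ sl => [|d t] at_ sl; first by case: l l0 sl.
case: l l0 sl => // j l /= /andP[j0 l0] [sl].
rewrite /cluster_powers /= -/(cluster_powers r l') -/(cluster_powers t l) => e srt.
have at' : alternating t by move: at_; rewrite /alternating /=; exact: path_sorted.
case: i e => [|i] /= e.
  have sl2 : size (j :: l) = size (d :: t) by rewrite /= sl.
  have l02 : all (leq 1) (j :: l) by apply/andP.
  have [h _ _] := IH (d :: t) (j :: l) l' at_ sl2 l02 sl' e (ltnW srt).
  by move: srt; rewrite h /= ltnn.
case: j j0 e => // j _ [cd e].
(* A factor shorter than the first run leaves as many runs to fewer factors, against the induction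
   hypothesis; a longer one forces the next run to have the same sign. *)
have [ij|ij|ij] := ltngtP i j.
- have e2 : cluster_powers r l' = cluster_powers (d :: t) (j - i :: l).
    rewrite /cluster_powers /= -/(cluster_powers r l') -/(cluster_powers t l).
    move: e; rewrite cd -{1}(subnKC (ltnW ij)) nseqD -catA => /eqP.
    by rewrite eqseq_cat// eqxx /= => /eqP.
  have sl2 : size (j - i :: l) = size (d :: t) by rewrite /= sl.
  have l02 : all (leq 1) (j - i :: l) by apply/andP; rewrite subn_gt0.
  have [h _ _] := IH (d :: t) (j - i :: l) l' at_ sl2 l02 sl' e2 (ltnW srt).
  by move: srt; rewrite h /= ltnn.
- exfalso; move: e; rewrite cd -{1}(subnKC (ltnW ij)) nseqD -catA => /eqP.
  rewrite eqseq_cat// eqxx /= -(subnSK ij) /=.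
  case: t at_ at' sl srt => [|d' t] at_ at' sl srt; first by case: l l0 sl.
  case: l l0 sl => // -[|k] l //= _ _; rewrite /cluster_powers /= => /eqP [dd' _].
  by move: at_; rewrite /alternating /= -dd' eqxx.
- move: e; rewrite cd ij => /eqP; rewrite eqseq_cat// eqxx /= => /eqP e.
  by have [-> -> ->] := IH t l l' at' sl l0 sl' e srt.
Qed.

Lemma insertion_powers x r l : size l = size r -> insertion x (cluster_powers r l) ->
  exists l1 a l2, l = l1 ++ a.+1 :: l2 /\ x = cluster_powers r (l1 ++ a :: l2).
Proof.
elim: r l x => [|c r IH] [|i l]//= x; first by move=> _ /insertion_size.
move=> [sl]; rewrite /cluster_powers /= -/(cluster_powers r l).
move=> /insertion_cat[[_ /insertion_nseq[k -> ->] ->]|[z /(IH _ _ sl)[l1 [a [l2 [-> ->]]]] ->]].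
  by exists [::], k, l.
by exists (i :: l1), a, l2.
Qed.

(** The exponents at the lattice point [n]. The [+1] at infinite clusters keeps them nonempty, as
    [run_unique] requires; the entries of [n] are consumed by infinite clusters only. *)
Fixpoint full_mults t n : seq nat :=
  match t with
  | [::] => [::]
  | (_, None) :: t' => (head 0 n).+1 :: full_mults t' (behead n)
  | (_, Some k) :: t' => k :: full_mults t' n
  end.

Definition full_word t n : word := cluster_powers t (full_mults t n).

Lemma full_word_infinite s t a n : full_word ((s, None) :: t) (a :: n) =
    nseq a.+1 s ++ full_word t n.
Proof. by []. Qed.

Lemma full_word_finite s k t n : full_word ((s, Some k) :: t) n = nseq k s ++ full_word t n.
Proof. by []. Qed.

Definition num_inf t := count infinite_cluster t.

Lemma size_full_mults t n : size (full_mults t n) = size t.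
Proof. by elim: t n => [|[s [k|]] t IH] n //=; rewrite IH. Qed.

Lemma fits_full_mults t n : fits_all (full_mults t n) t.
Proof. by elim: t n => [|[s [k|]] t IH] n //=; rewrite IH /fits_multiplicity /= ?leqnn. Qed.

Lemma lang_full_word t n : lang t (full_word t n).
Proof. by apply/langP; exists (full_mults t n) => //; exact: fits_full_mults. Qed.

Lemma full_mults_gt0 t n : all cluster_wf t -> all (leq 1) (full_mults t n).
Proof.
elim: t n => [|[s k] t IH] n //=; rewrite /= => /andP[wf wft].
by case: k wf => [[|k]|] //= _; rewrite IH.
Qed.

Lemma full_mults_inj t n n' : size n = num_inf t -> size n' = num_inf t ->
  full_mults t n = full_mults t n' -> n = n'.
Proof.
elim: t n n' => [|[s [k|]] t IH] n n' /=; first by case: n n' => // -[].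
  by rewrite /num_inf /= !add0n => sn sn' [/IH]; exact.
by case: n n' => // a n [|b n'] //; rewrite /num_inf /= !add1n => -[sn] [sn'] /= [-> /IH ->].
Qed.

Lemma full_word_inj t n n' : alternating t -> all cluster_wf t ->
  size n = num_inf t -> size n' = num_inf t -> full_word t n = full_word t n' -> n = n'.
Proof.
move=> at_ wf sn sn' /run_unique[]; rewrite ?size_full_mults ?full_mults_gt0//.
by move=> _ _; exact: full_mults_inj.
Qed.

Lemma fits_full_mults_incr t n l1 a l2 : size n = num_inf t -> full_mults t n = l1 ++ a :: l2 ->
  fits_all (l1 ++ a.+1 :: l2) t ->
  exists2 j, j < num_inf t & l1 ++ a.+1 :: l2 = full_mults t (incr_nth n j).
Proof.
elim: t n l1 => [|[s [k|]] t IH] n l1 //=.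
- by case: l1.
- rewrite /num_inf /= add0n => sn; case: l1 => [[-> _]|b l1 [-> e] /= /andP[_]].
    by rewrite /= /fits_multiplicity /= ltnn.
  by move=> /(IH _ _ sn e)[j jt ->]; exists j.
- rewrite /num_inf /= add1n; case: n => // b n [sn].
  case: l1 => [[<- <-]|d l1 [<- e] /= /(IH _ _ sn e)[j jt ->]]; first by exists 0.
  by exists j.+1.
Qed.

(** Lowering one exponent of [y] gives the full word, whose exponents are unique. The raised
    exponent cannot belong to a finite cluster, since those are already full. *)
Lemma full_word_upper t n y : alternating t -> all cluster_wf t -> size n = num_inf t ->
  lang t y -> insertion (full_word t n) y ->
      exists2 j, j < num_inf t & y = full_word t (incr_nth n j).
Proof.
move=> at_ wf sn /langP[l fl ->] /(insertion_powers (fits_all_size fl))[l1 [a [l2 [lE e]]]].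
have sl := fits_all_size fl.
have sl2 : size (l1 ++ a :: l2) = size t by rewrite -sl lE !size_cat.
have [_ _ e2] := run_unique at_ (size_full_mults t n) (full_mults_gt0 n wf) sl2 (esym e) (leqnn _).
rewrite lE in fl *; have [j jt ->] := fits_full_mults_incr sn (esym e2) fl.
by exists j.
Qed.

Lemma full_word_insertion t n j : j < num_inf t -> size n = num_inf t ->
  insertion (full_word t n) (full_word t (incr_nth n j)).
Proof.
elim: t n j => [|[s [k|]] t IH] n j //; rewrite /num_inf /=.
  by rewrite add0n => jt sn; apply: insertion_catl; exact: IH.
rewrite add1n; case: n => // a n; case: j => [|j] jt [sn].
  by apply: (@insertion_catr _ _ (cluster_powers t _)); exact: insertion_cons.
by apply: (@insertion_catl _ _ (nseq a.+1 s)); exact: IH.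
Qed.

(** Cofinality of the lattice: fill the finite clusters and lengthen the infinite ones. *)
Lemma lang_full_word_dom t x : lang t x -> exists2 n, size n = num_inf t & subseq x (full_word t n).
Proof.
elim: t x => [|[s k] t IH] x /=; first by move=> ->; exists [::].
move=> [i [y [fi /IH[n sn yn] ->]]]; case: k fi => [k|] fi.
  exists n => //; rewrite /full_word /cluster_powers /=; apply: cat_subseq => //.
  by rewrite -(subnKC fi) nseqD prefix_subseq.
exists (i :: n); first by rewrite /= sn.
apply: (@cat_subseq _ (nseq i s) y (nseq i.+1 s) (full_word t n)) => //.
exact: subseq_cons.
Qed.

Lemma full_word_cat t1 t2 n1 n2 : size n1 = num_inf t1 ->
  full_word (t1 ++ t2) (n1 ++ n2) = full_word t1 n1 ++ full_word t2 n2.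
Proof.
elim: t1 n1 => [|[s [k|]] t1 IH] n1; rewrite /num_inf /=; first by case: n1.
  by rewrite add0n => /IH e; rewrite !full_word_finite e catA.
case: n1 => // a n1; rewrite add1n => -[/IH e].
by rewrite /= !full_word_infinite e catA.
Qed.

Lemma size_full_word t n : size n = num_inf t ->
  size (full_word t n) = sumn n + sumn [seq (if c.2 is Some k then k else 1) | c <- t].
Proof.
elim: t n => [|[s [k|]] t IH] n; first by case: n.
  by move=> /IH e; rewrite full_word_finite size_cat size_nseq e /=; lia.
by case: n => // a n [/IH e]; rewrite full_word_infinite size_cat size_nseq e /=; lia.
Qed.

End Languages.

(** * Enumeration of the splittings of a zigzag into pieces *)

Section Splittings.
Implicit Types (x : word) (ss : seq bool) (n z : seq nat).

Fixpoint pieces_ok ss x n : bool :=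
  match ss, n with
  | s :: ss', k :: n' => all (pred1 s) (take k.-1 x) && pieces_ok ss' (drop k x) n'
  | _, _ => true
  end.

Lemma is_splittingE (R : realType) x (u : seq (R * bool)) n : size n = size u ->
  is_splitting x u n = (sumn n == (size x).+1) && pieces_ok (map snd u) x n.
Proof.
move=> sn; rewrite /is_splitting; congr (_ && _); rewrite -(size_map snd u) in sn *.
rewrite (@eq_in_all _ _ (fun i => all (pred1 (nth true (map snd u) i))
    (piece x (sumn (take i n)) (nth 0 n i)))); last first.
  by move=> i; rewrite mem_iota size_map => iu; rewrite (nth_map (0, true)%R).
elim: (map snd u) x n sn => [|s ss IH] x [|k n]//= [sn].
rewrite /piece drop0 -IH// (iotaDl 1 0) all_map; congr (_ && _).
apply: eq_all => i /=; rewrite /piece drop_drop; congr (all _ (take _ (drop _ x))).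
by rewrite addnC.
Qed.

(* The splittings whose first box lies in the first piece. *)
Fixpoint first_splits (s : bool) (g : word -> seq (seq nat)) z x : seq (seq nat) :=
  if x is c :: x' then
    (if c == s then [seq (head 0 n).+1 :: behead n | n <- first_splits s g z x'] else [::])
    ++ [seq 1 :: n | n <- g x']
  else [:: 1 :: z].

(** Either the first piece is nonempty or the other pieces split the whole zigzag. With no pieces
    there is no splitting, since the word [x] stands for [size x + 1] boxes. *)
Fixpoint splits ss x : seq (seq nat) :=
  if ss is s :: ss' then
    first_splits s (splits ss') (nseq (size ss') 0) x ++ [seq 0 :: n | n <- splits ss' x]
  else [::].

Lemma first_splits_head s g z x n : n \in first_splits s g z x ->
  exists k n', n = k.+1 :: n'.
Proof.
elim: x n => [|c x IH] n /=; first by rewrite inE => /eqP ->; exists 0, z.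
rewrite mem_cat => /orP[|/mapP[n' _ ->]]; last by exists 0, n'.
by case: ifP => // _ /mapP[n' _ ->]; exists (head 0 n'), (behead n').
Qed.

Lemma size_first_splits s g z x n k : size z = k ->
  (forall y n', n' \in g y -> size n' = k) -> n \in first_splits s g z x -> size n = k.+1.
Proof.
move=> sz gk; elim: x n => [|c x IH] n /=; first by rewrite inE => /eqP -> /=; rewrite sz.
rewrite mem_cat => /orP[|/mapP[n' /gk <- ->]]//.
by case: ifP => // _ /mapP[n' /IH sn ->] /=; rewrite size_behead sn.
Qed.

Lemma size_splits ss x n : n \in splits ss x -> size n = size ss.
Proof.
elim: ss x n => [|s ss IH] x n //=.
rewrite mem_cat => /orP[|/mapP[n' /IH <- ->]]//.
by apply: size_first_splits; [rewrite size_nseq|exact: IH].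
Qed.

Lemma mem_splits ss x n : size n = size ss ->
  (n \in splits ss x) = (sumn n == (size x).+1) && pieces_ok ss x n.
Proof.
elim: ss x n => [|s ss IH] x [|k n]//= [sn].
rewrite mem_cat.
have -> : (k :: n \in [seq 0 :: n | n <- splits ss x]) = (k == 0) && (n \in splits ss x).
  apply/mapP/andP => [[n' n's [-> ->]]|[/eqP -> ns]]; first by rewrite eqxx.
  by exists n.
suff -> : (k :: n \in first_splits s (splits ss) (nseq (size ss) 0) x) =
    [&& 0 < k, k + sumn n == (size x).+1, all (pred1 s) (take k.-1 x)
      & pieces_ok ss (drop k x) n].
  by case: k => [|k] /=; rewrite ?orbF// take0 drop0 IH.
elim: x k => [|c x IHx] k /=.
  rewrite inE; apply/eqP/and3P => [[-> ->]|[k0 /eqP s1 _]].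
    by rewrite sumn_nseq; split=> //; elim: (ss) => //= a l ->.
  case: k k0 s1 => // -[|k]// _; rewrite add1n => -[] sn0; congr (_ :: _).
  rewrite -sn; apply/all_pred1P/allP => i i_n; apply/eqP.
  by move/perm_sumn: (perm_to_rem i_n); rewrite sn0 /=; case: i {i_n}.
rewrite mem_cat.
have -> : (k :: n \in [seq 1 :: n | n <- splits ss x]) = (k == 1) && (n \in splits ss x).
  apply/mapP/andP => [[n' n's [-> ->]]|[/eqP -> ns]]; first by rewrite eqxx.
  by exists n.
have -> : (k :: n \in (if c == s then
    [seq (head 0 n).+1 ::
        behead n | n <- first_splits s (splits ss) (nseq (size ss) 0) x] else [::])) =
    [&& c == s, 1 < k & k.-1 :: n \in first_splits s (splits ss) (nseq (size ss) 0) x].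
  case: eqP => //= _; apply/mapP/andP => [[n' n's [-> ->]]|[k1 kn]].
    by have [i [l lE]] := first_splits_head n's; rewrite lE in n's *.
  by exists (k.-1 :: n) => //=; rewrite prednK// ltnW.
rewrite IHx; case: k => [|[|k]] //=; rewrite ?andbF ?orbF//=.
  by rewrite drop0 IH.
by rewrite addSn eqSS andbCA; case: (c == s); rewrite /= ?andbF.
Qed.

Lemma uniq_splits ss x : uniq (splits ss x).
Proof.
elim: ss x => [|s ss IH] x //=; rewrite cat_uniq (map_inj_uniq (fun _ _ => _));
    last by move=> ? ? [].
rewrite IH andbT; apply/andP; split; last first.
  by apply/hasPn => _ /mapP[n _ ->]; apply/negP => /first_splits_head[k [n' ]].
elim: x => //= c x IHx; rewrite cat_uniq (map_inj_uniq (fun _ _ => _)); last by move=> ? ? [].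
rewrite IH andbT; apply/andP; split.
  case: eqP => // _; rewrite map_inj_in_uniq// => n n' /first_splits_head[k [l ->]].
  by move=> /first_splits_head[k' [l' ->]] /= [-> ->].
apply/hasPn => _ /mapP[n _ ->]; apply/negP; case: eqP => // _ /mapP[n'].
by move=> /first_splits_head[k [l ->]].
Qed.

End Splittings.

(** * F by recursion, and its Pieri rule *)

Section ZigzagFunction.
Context (R : realType).
Local Open Scope ring_scope.
Implicit Types (x y : word) (us : seq (R * bool)) (w : seq R) (n : seq nat).

Fixpoint monomial_value w n : R :=
  match w, n with
  | a :: w', k :: n' => a ^+ k * monomial_value w' n'
  | _, _ => 1
  end.

(** The monomials summed over [first_splits]: a symbol prolongs the first piece, if its sign is [s],
    or joins that piece to the remaining ones, which [g] accounts for. *)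
Fixpoint first_sum (a : R) (s : bool) (g : word -> R) x : R :=
  if x is c :: x' then a * ((c == s)%:R * first_sum a s g x' + g x') else a.

Fixpoint zigzag_sum us x : R :=
  if us is (a, s) :: us' then first_sum a s (zigzag_sum us') x + zigzag_sum us' x else 0.

Lemma sum_splits us x :
  \sum_(n <- splits (map snd us) x) monomial_value (map fst us) n = zigzag_sum us x.
Proof.
elim: us x => [|[a s] us IH] x /=; first by rewrite big_nil.
rewrite big_cat big_map/=; congr (_ + _); last first.
  by rewrite -IH; apply: eq_bigr => n _; rewrite mul1r.
elim: x => [|c x IHx] /=.
  rewrite big_seq1 /= expr1 -[RHS]mulr1; congr (_ * _).
  by elim: us {IH} => //= -[b r] us -> ; rewrite mulr1.
rewrite big_cat big_map mulrDr /=; congr (_ + _); last first.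
  by rewrite -IH mulr_sumr; apply: eq_bigr => n _; rewrite expr1.
case: eqP => _ /=; last by rewrite mul0r mulr0 big_nil.
rewrite mul1r -IHx mulr_sumr big_map big_seq [RHS]big_seq; apply: eq_bigr => n.
by move=> /first_splits_head[k [n' ->]] /=; rewrite exprS mulrA.
Qed.

Lemma Fsum_zigzag_sum x us : Fsum x us = zigzag_sum us x.
Proof.
rewrite -sum_splits /Fsum.
pose T := ((size us).-tuple 'I_(size x).+2)%type.
pose L : seq (seq nat) := 
    [seq map val (tval v) | v : T <- [seq v : T <- enum {:
        T} | is_splitting x us (map val (tval v))]].
have mE (v : T) : \prod_(i < size us) (nth (0, true) us i).1 ^+ tnth v i =
    monomial_value (map fst us) (map val (tval v)).
  have [n' sn'] : exists n' : seq nat, n' = map val (tval v) by exists (map val (tval v)).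
  have sz : size n' = size us by rewrite sn' size_map size_tuple.
  rewrite -sn' (eq_bigr (fun i : 'I_(size us) => (nth (0, true) us i).1 ^+ nth 0%N n' i));
      last first.
    move=> i _; rewrite sn' (nth_map ord0) ?size_tuple//.
    by rewrite (tnth_nth ord0).
  elim: us n' sz {T L v sn'} => [|[a s] us IH] [|k n]//; first by rewrite big_ord0.
  by move=> [sn]; rewrite big_ord_recl /= IH.
transitivity (\sum_(n <- L) monomial_value (map fst us) n).
  rewrite /L big_map big_filter big_enum_cond /=.
  by apply: eq_big => // v _; exact: mE.
apply: perm_big; apply: uniq_perm; last 2 first.
- exact: uniq_splits.
- move=> n; apply/mapP/idP => [[v]|nS].
    rewrite mem_filter => /andP[vs _] ->; rewrite mem_splits.
      by rewrite -is_splittingE ?size_map ?size_tuple.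
    by rewrite !size_map size_tuple.
  have sn := size_splits nS; rewrite size_map in sn.
  have nle i : i \in n -> (i < (size x).+2)%N.
    move=> i_n; move: nS; rewrite mem_splits ?size_map// => /andP[/eqP + _].
    by move/perm_sumn: (perm_to_rem i_n) => /= ->; lia.
  pose v : T := tcast sn (map_tuple (fun i => inord i : 'I_(size x).+2) (in_tuple n)).
  have vE : map val (tval v) = n.
    rewrite val_tcast /= -map_comp -[RHS]map_id; apply/eq_in_map => i /nle i_lt /=.
    by rewrite inordK.
  exists v; last by rewrite vE.
  rewrite mem_filter mem_enum andbT vE is_splittingE//.
  by rewrite -mem_splits ?size_map.
- rewrite map_inj_uniq; first by apply: filter_uniq; exact: enum_uniq.
  by move=> v v' /= vv'; apply: val_inj; apply: inj_map vv'; exact: val_inj.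
Qed.

Definition total us : R := \sum_(p <- us) p.1.

Lemma zigzag_sum_nil us : zigzag_sum us [::] = total us.
Proof. by elim: us => [|[a s] us IH]; rewrite /total ?big_nil// big_cons /= IH. Qed.

(** The rule p_1 F_lambda = sum of F_mu. The part [first_sum] is not an eigenvector on its own: a
    new box may open an empty first piece, which gives the extra term [a * zigzag_sum us x] and
    completes the product. *)
Lemma zigzag_sum_harmonic us x : \sum_(y <- word_uppers x) zigzag_sum us y =
    total us * zigzag_sum us x.
Proof.
elim: us x => [|[a s] us IH] x; first by rewrite /= big1 ?mulr0.
rewrite /total big_cons -/(total us) /= big_split /= IH.
suff -> : \sum_(y <- word_uppers x) first_sum a s (zigzag_sum us) y =
    (a + total us) * first_sum a s (zigzag_sum us) x + a * zigzag_sum us x by ring.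
elim: x => [|c x IHx] /=.
  by rewrite !big_cons big_nil /= !zigzag_sum_nil; case: (s) => /=; ring.
rewrite big_cons big_map /=.
have -> : \sum_(y <- word_uppers x) a * ((c == s)%:R * first_sum a s (zigzag_sum us) y +
    zigzag_sum us y) =
    a * ((c == s)%:R * ((a + total us) * first_sum a s (zigzag_sum us) x + a * zigzag_sum us x) +
        total us * zigzag_sum us x).
  by rewrite -mulr_sumr big_split /= -mulr_sumr IHx IH.
by case: c; case: (s) => /=; ring.
Qed.

End ZigzagFunction.

(** * Finite templates and the full word above a splitting *)

Section FiniteTemplates.
Implicit Types (x y : word) (t : seq signed_cluster) (n : seq nat).

(** A grammar for finite templates, from which induction removes one infinite cluster at a time: the
    next one has the opposite sign, or the same sign after a separating cluster. *)
Inductive section_template : seq signed_cluster -> Prop :=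
| section_template1 s : section_template [:: (s, None)]
| section_template2 s t : section_template ((~~ s, None) :: t) ->
    section_template ((s, None) :: (~~ s, None) :: t)
| section_template3 s t : section_template ((s, None) :: t) ->
    section_template [:: (s, None), (~~ s, Some 1), (s, None) & t].

Lemma section_template_wf t : section_template t -> alternating t /\ all cluster_wf t.
Proof.
by elim=> [s|s t' _ [at' wf]|s t' _ [at' wf]] //; split; rewrite //= -/(path _ _ _) /alternating /=;
  case: s at' wf.
Qed.

Lemma finite_template_section_template t : finite_template t -> section_template t.
Proof.
have [k] := ubnP (size t); elim: k t => // k IH t tk /andP[/and3P[wf at_ hasi] /allP ns].
case: t tk wf at_ hasi ns => // -[s [e|]] t tk /= wf at_ hasi ns.
  by have := ns 0; rewrite inE eqxx => /(_ erefl).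
case: t tk wf at_ hasi ns => [|[s2 k2] t] tk /= wf at_ _ ns; first exact: section_template1.
have s2E : s2 = ~~ s by case/andP: at_ => + _; case: (s); case: (s2).
case: k2 tk wf at_ ns => [k2|] tk wf at_ ns.
  have := ns 1; rewrite !inE orbT => /(_ erefl).
  rewrite /nonseparating_finite /separating /= negbK => /and3P[]; rewrite ltnS.
  case: t tk wf at_ ns => // -[s3 [?|]] t // tk wf at_ ns _ /eqP[k2E] _;
      rewrite {}k2E in tk wf at_ ns *.
  have s3E : s3 = s by case/and3P: at_ => _ + _; rewrite s2E; case: (s); case: (s3).
  rewrite s2E s3E; apply: section_template3; apply: IH; first by move: tk => /=; lia.
  rewrite s3E in at_ ns; case/and3P: at_ => _ _ pt.
  apply/andP; split; first by apply/and3P; split.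
  apply/allP => -[|i]; rewrite mem_iota => /andP[_ it] //.
  have := ns i.+3; rewrite !inE /= mem_iota.
  rewrite (_ : (2 < i.+3 < 3 + size t)); last by move: it => /=; lia.
  by rewrite /= => /(_ isT); rewrite /nonseparating_finite /separating /= !ltnS.
rewrite s2E; apply: section_template2; apply: IH; first by move: tk => /=; lia.
rewrite s2E in at_ ns; case/andP: at_ => _ pt.
apply/andP; split; first by apply/and3P; split.
apply/allP => -[|i]; rewrite mem_iota => /andP[_ it] //.
have := ns i.+2; rewrite !inE /= mem_iota.
rewrite (_ : (1 < i.+2 < 2 + size t)); last by move: it => /=; lia.
by rewrite /= => /(_ isT); rewrite /nonseparating_finite /separating /= !ltnS.
Qed.

Definition signs t : seq bool := [seq c.1 | c <- t & infinite_cluster c].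

Lemma size_signs t : size (signs t) = num_inf t.
Proof. by rewrite size_map size_filter. Qed.

Lemma first_splits_subseq s g z (W : seq nat -> word) x n :
  (forall x' n' c, n' \in g x' -> subseq (c :: x') (s :: W n')) ->
  n \in first_splits s g z x -> subseq x (nseq (head 0 n) s ++ W (behead n)).
Proof.
move=> H; elim: x n => [|c x IH] n /=; first by rewrite sub0seq.
rewrite mem_cat => /orP[|/mapP[n' n'g ->]]; last exact: H.
by case: eqP => // -> /mapP[n' /IH sx ->] /=; rewrite eqxx.
Qed.

Lemma splits_cons_subseq s ss (W : seq nat -> word) x n :
  (forall x' n' c, n' \in splits ss x' -> subseq (c :: x') (s :: W n')) ->
  n \in splits (s :: ss) x -> subseq x (nseq (head 0 n) s ++ W (behead n)).
Proof.
move=> H; rewrite mem_cat => /orP[|/mapP[n' n's ->]]; first exact: first_splits_subseq.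
by have := H _ _ (~~ s) n's; rewrite /=; case: eqP => [|_]; [case: (s)|exact: cons_subseq].
Qed.

(** A first piece of [k] boxes accounts for [k - 1] symbols of its sign and for the arbitrary symbol
    joining it to the next piece. That symbol goes into the first cluster if the sign fits,
    otherwise into the next one, separating or infinite. An infinite one has room, because the
    induction hypothesis uses one leading symbol fewer than [full_word]. *)
Lemma section_template_splits_head t x n : section_template t -> n \in splits (signs t) x ->
  subseq x (nseq (head 0 n) (head cluster0 t).1 ++ full_word (behead t) (behead n)).
Proof.
have cons2 (c : bool) y z : subseq y z -> subseq (c :: y) (c :: z) by rewrite /= eqxx.
move=> ft; elim: ft x n => [s|s t' ft' IH|s t' ft' IH] x n; apply: splits_cons_subseq => //.
all: move=> {}x {}n c /[dup] /size_splits; case: n => // k n _ /IH sx.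
all: have [->|/eqP cs] := altP (c =P s); last (have {cs}-> : c = ~~ s by move: cs; case: (c);
    case: (s)).
- by apply: (cons2 s); apply: (subseq_trans sx); exact: subseq_cons.
- by rewrite full_word_infinite; apply: (subseq_trans _ (subseq_cons _ _)); exact: (cons2 (~~ s)).
- apply: (cons2 s); rewrite full_word_finite; apply: (subseq_trans _ (subseq_cons _ _)).
  by rewrite full_word_infinite; apply: (subseq_trans sx); exact: subseq_cons.
- apply: (subseq_trans _ (subseq_cons _ _)); rewrite full_word_finite; apply: (cons2 (~~ s)).
  by rewrite full_word_infinite; apply: (subseq_trans sx); exact: subseq_cons.
Qed.

Lemma section_template_splits t x n : section_template t -> n \in splits (signs t) x ->
    subseq x (full_word t n).
Proof.
move=> ft ns; apply: subseq_trans (section_template_splits_head ft ns) _.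
case: ft ns => [s|s t'|s t'] => [|_|_] /size_splits; case: n => //= k n _; exact: subseq_cons.
Qed.

Lemma section_template_splits_lang t x n : section_template t -> n \in splits (signs t) x ->
    lang t x.
Proof. by move=> ft /(section_template_splits ft)/lang_subseq; apply; exact: lang_full_word. Qed.

(* The sign change makes one more run than [t] has clusters. *)
Lemma cons_full_word_notin s k t n : alternating ((s, k) :: t) -> all cluster_wf t ->
  ~ lang t (s :: full_word t n).
Proof.
move=> at_ wf /langP[l fl e].
have sz : size (1 :: full_mults t n) = size ((s, k) :: t) by rewrite /= size_full_mults.
have pos : all (leq 1) (1 :: full_mults t n) by rewrite /= full_mults_gt0.
have [h _ _] := run_unique at_ sz pos (fits_all_size fl) (esym e) (leqnSn _).
by move: h => /eqP /=; rewrite -addn1 -[X in X == _]addn0 eqn_add2l.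
Qed.

End FiniteTemplates.

(** * F on the words of a finite template *)

Section SectionValues.
Context (R : realType).
Local Open Scope ring_scope.
Implicit Types (x y : word) (t : seq signed_cluster) (w : seq R) (n : seq nat).

Lemma zip_fst w t : size w = num_inf t -> map fst (zip w (signs t)) = w.
Proof. by move=> sw; rewrite -/(unzip1 _) unzip1_zip// size_signs sw. Qed.

Lemma zip_snd w t : size w = num_inf t -> map snd (zip w (signs t)) = signs t.
Proof. by move=> sw; rewrite -/(unzip2 _) unzip2_zip// size_signs sw. Qed.

Lemma zigzag_sum_splits w t x : size w = num_inf t ->
  zigzag_sum (zip w (signs t)) x = \sum_(n <- splits (signs t) x) monomial_value w n.
Proof. by move=> sw; rewrite -sum_splits zip_fst// zip_snd. Qed.

(** Every splitting places [x] under a full word of [t], so outside the language there is none. This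
    is how the Pieri rule on all zigzags restricts to Z(t). *)
Lemma zigzag_sum_out w t x : size w = num_inf t -> section_template t -> ~ lang t x ->
  zigzag_sum (zip w (signs t)) x = 0.
Proof.
move=> sw ft xt; rewrite zigzag_sum_splits// big_seq big1// => n ns.
by case: xt; exact: section_template_splits_lang ns.
Qed.

Lemma monomial_value_ge0 w n : all (fun a => 0 <= a) w -> 0 <= monomial_value w n.
Proof.
elim: w n => [|a w IH] [|k n] //= /andP[a0 w0].
by rewrite mulr_ge0 ?exprn_ge0 ?IH.
Qed.

Lemma monomial_value_gt0 w n : all (fun a => 0 < a) w -> 0 < monomial_value w n.
Proof.
elim: w n => [|a w IH] [|k n] //= /andP[a0 w0].
by rewrite mulr_gt0 ?exprn_gt0 ?IH.
Qed.

Lemma zigzag_sum_ge0 (us : seq (R * bool)) x : all (fun p => 0 <= p.1) us -> 0 <= zigzag_sum us x.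
Proof.
move=> us0; rewrite -sum_splits sumr_ge0// => n _; apply: monomial_value_ge0.
by rewrite all_map.
Qed.

(** A contributing splitting ends the first piece together with its run. The next symbol joins two
    pieces and is constrained by neither, which is how a separating symbol is passed. *)
Lemma zigzag_sum_gt0 w t x : size w = num_inf t -> all (fun a => 0 < a) w ->
    section_template t -> lang t x ->
  0 < zigzag_sum (zip w (signs t)) x.
Proof.
have head a s (us : seq (R * bool)) t' z :
    0 < a -> all (fun p => 0 <= p.1) us ->
    (forall c y, lang t' (c :: y) -> 0 < zigzag_sum us y) -> lang ((s, None) :: t') z ->
    0 < first_sum a s (zigzag_sum us) z + zigzag_sum us z.
  move=> a0 us0 H [l [y [_ yt ->]]]; rewrite ltr_pwDl ?zigzag_sum_ge0//.
  elim: l => [|l IH] /=; last by rewrite eqxx mul1r mulr_gt0// ltr_pwDl ?zigzag_sum_ge0.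
  case: y yt => //= c y /H y0; rewrite mulr_gt0// ltr_wpDl//.
  rewrite mulr_ge0// ?ler0n//; elim: y {y0} => [|d y IH] /=; first exact: ltW.
  by rewrite mulr_ge0 ?(ltW a0)// addr_ge0 ?zigzag_sum_ge0// mulr_ge0// ler0n.
have zge0 w' t' : all (fun a : R => 0 < a) w' -> all (fun p => 0 <= p.1) (zip w' (signs t')).
  elim: w' (signs t') => [|b w' IH] [|s ss] //= /andP[b0 w0].
  by rewrite ltW//= IH.
move=> + + ft; elim: ft w x => [s|s t' ft' IH|s t' ft' IH] [|a w] x //=.
- case: w => // _ /andP[a0 _] xt; exact: (head _ _ [::] [::]).
- move=> [sw] /andP[a0 w0] xt.
  apply: (head _ _ (zip w (signs ((~~ s, None) :: t'))) ((~~ s, None) :: t')) => //.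
    exact: zge0.
  move=> c y yt; apply: IH => //; apply: lang_subseq yt; exact: subseq_cons.
- move=> [sw] /andP[a0 w0] xt.
  apply: (head _ _ (zip w (signs ((s, None) :: t'))) [:: (~~ s, Some 1%N), (s, None) & t']) => //.
    exact: zge0.
  move=> c y [i [z [fi zt e]]]; case: i fi e => [|[|//]] _ e; apply: IH => //.
    by apply: (@lang_subseq _ z) => //; rewrite -[z]e; exact: subseq_cons.
  by case: e => _ ->.
Qed.

Lemma zigzag_sum_cons a s (us : seq (R * bool)) x :
  zigzag_sum ((a, s) :: us) x = first_sum a s (zigzag_sum us) x + zigzag_sum us x.
Proof. by []. Qed.

Lemma first_sum_cons a s (g : word -> R) c x :
  first_sum a s g (c :: x) = a * ((c == s)%:R * first_sum a s g x + g x).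
Proof. by []. Qed.

(** If the first piece stopped earlier, the rest would begin with an [s] too many, where [g]
    vanishes; so each box before [y] contributes a factor [a]. *)
Lemma first_sum_run a s (g : word -> R) l y :
  (forall k, g (nseq k.+1 s ++ y) = 0) ->
  first_sum a s g (nseq l s ++ y) + g (nseq l s ++ y) = a ^+ l * (first_sum a s g y + g y).
Proof.
move=> g0; elim: l => [|l IH]; first by rewrite mul1r.
by rewrite g0 addr0 /= eqxx mul1r IH exprS mulrA.
Qed.

(** [C] is the last weight times one factor per pair of consecutive infinite clusters with weights
    [a] and [b]: [a + b] if they touch, as the corner box may join either piece, and [a * b] across
    a separating symbol, whose two boxes lie in different pieces. The leading exponent is a free [l]
    because the induction needs both [k] and [k + 1]. *)
Lemma zigzag_sum_full_word0 w t : size w = num_inf t -> section_template t ->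
  exists C : R, forall l n, size (l :: n) = num_inf t ->
    zigzag_sum (zip w (signs t)) (nseq l (head cluster0 t).1 ++ full_word (behead t) n) =
        C * monomial_value w (l :: n).
Proof.
move=> + ft; elim: ft w => [s|s t' ft' IH|s t' ft' IH] [|a w] //.
- case: w => // _; exists a => l [|//] _.
  change (first_sum a s (zigzag_sum [::]) (nseq l s ++ [::]) + zigzag_sum [::] (nseq l s ++ [::])
      = a * (a ^+ l * 1)).
  by rewrite first_sum_run// addr0 mulr1 mulrC.
- move=> [sw]; have [C CE] := IH w sw.
  have [at_ wf] := section_template_wf (section_template2 ft').
  exists ((a + head 0 w) * C) => l [|k n] // [sn].
  change (zigzag_sum ((a, s) :: zip w (signs ((~~ s, None) :: t')))
    (nseq l s ++ full_word ((~~ s, None) :: t') (k :: n)) =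
        (a + head 0 w) * C * monomial_value (a :: w) [:: l, k & n]).
  rewrite zigzag_sum_cons first_sum_run => [|i]; last first.
    apply: zigzag_sum_out => // /(@lang_subseq _ _ (s :: full_word ((~~ s, None) :: t') (k ::
        n))) h.
    apply: (cons_full_word_notin at_ _ (h _)); first by case/andP: wf.
    by rewrite /= eqxx suffix_subseq.
  rewrite full_word_infinite; case: w sw CE => // b w sw CE.
  have sn' j : size (j :: n) = num_inf ((~~ s, None) :: t') by rewrite /= sn.
  have e1 := CE k.+1 n (sn' _); have e2 := CE k n (sn' _).
  rewrite e1 [nseq _ _ ++ _]/= first_sum_cons e2 /= (_ : (~~ s == s) = false); last by case: (s).
  by rewrite mul0r add0r !exprS; ring.
- move=> [sw]; have [C CE] := IH w sw.
  have [at_ wf] := section_template_wf (section_template3 ft').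
  exists (a * head 0 w * C) => l [|k n] // [sn].
  change (zigzag_sum ((a, s) :: zip w (signs ((s, None) :: t')))
    (nseq l s ++ full_word [:: (~~ s, Some 1%N), (s, None) & t'] (k :: n)) =
    a * head 0 w * C * monomial_value (a :: w) [:: l, k & n]).
  rewrite zigzag_sum_cons first_sum_run => [|i]; last first.
    apply: zigzag_sum_out => // /(lang_cons (~~ s, Some 1%N)).
    move=> /(@lang_subseq _ _ (s :: full_word [:: (~~ s, Some 1%N), (s, None) & t'] (k :: n))) h.
    apply: (cons_full_word_notin at_ _ (h _)); first by case/andP: wf.
    by rewrite /= eqxx suffix_subseq.
  rewrite full_word_finite; case: w sw CE => // b w sw CE.
  have sn' j : size (j :: n) = num_inf ((s, None) :: t') by rewrite /= sn.
  have e1 := CE k.+1 n (sn' _).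
  rewrite [nseq 1 _ ++ _]/= first_sum_cons full_word_infinite e1 (_ : (~~ s == s) = false);
      last by case: (s).
  have -> : zigzag_sum (zip (b :: w) (signs ((s, None) :: t'))) (~~ s ::
      nseq k.+1 s ++ full_word t' n) = 0.
    apply: zigzag_sum_out => //; rewrite -full_word_infinite;
        apply: (@cons_full_word_notin _ (Some 1%N)); last by case/and3P: wf.
    by case/andP: at_.
  by rewrite mul0r add0r /= !exprS; ring.
Qed.

Lemma zigzag_sum_full_word w t : size w = num_inf t -> section_template t ->
  exists C : R, forall n, size n = num_inf t ->
      zigzag_sum (zip w (signs t)) (full_word t n) = C * monomial_value w n.
Proof.
move=> sw ft; have [C CE] := zigzag_sum_full_word0 sw ft; case: ft sw CE => [s|s t' _|s t' _].
all: case: w => // a w sw CE.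
all: exists (a * C) => -[|k n] // sn; have e := CE k.+1 n sn.
all: rewrite full_word_infinite [LHS]e /= exprS; ring.
Qed.

End SectionValues.

(** * Maximal runs in a list of flags *)

Section Runs.
Implicit Types (f : seq bool) (p q : nat * nat).

Definition shift k p := (k + p.1, k + p.2).

(** Half-open maximal intervals of [false]. A leading [false] extends a run that starts the tail;
    the filter discards the old copy of that run. *)
Fixpoint runs f : seq (nat * nat) :=
  match f with
  | [::] => [::]
  | true :: f' => map (shift 1) (runs f')
  | false :: f' => (0, (index true f').+1) :: map (shift 1) [seq p <- runs f' | 0 < p.1]
  end.

Definition maximal_run f p : Prop :=
  [/\ p.1 < p.2, forall k, p.1 <= k < p.2 -> nth true f k = false,
      nth true (true :: f) p.1 & nth true f p.2].

Lemma mem_runs f p : p \in runs f <-> maximal_run f p.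
Proof.
have shift1 i j s : ((i, j) \in map (shift 1) s) = [&& 0 < i, 0 < j & (i.-1, j.-1) \in s].
  apply/mapP/and3P => [[[a b] ab [-> ->]]|[]] //.
  by case: i j => // i [|j] // _ _ ij; exists (i, j).
have idx_lt g k : k < index true g -> nth true g k = false.
  by move=> /(before_find true) /=; case: nth.
have idx_nth g : nth true g (index true g) = true.
  have [tf|tf] := boolP (true \in g); first by rewrite nth_index.
  by rewrite nth_default// leqNgt index_mem.
elim: f p => [|b f IH] [i j].
  split=> // -[/= ij h _ _]; have := h i; rewrite leqnn ij nth_nil => /(_ isT).
  by [].
case: b => /=.
  rewrite shift1; split=> [/and3P[]|[/= ij h i1 j1]].
    case: i j => // i [|j] //= _ _ /IH[/= ij h i1 j1]; split=> //= -[|k] //=.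
    by rewrite !ltnS; exact: h.
  case: i ij h i1 => [|i] ij h i1; first by have := h 0; rewrite ij => /(_ isT).
  case: j ij h j1 => [|j] // ij h j1; apply/IH; split=> //= k kij.
  by apply: (h k.+1).
rewrite inE shift1; split=> [/orP[/eqP[-> ->]|/and3P[]]|[/= ij h i1 j1]].
- by split=> //= -[|k] //=; rewrite ltnS; exact: idx_lt.
- case: i j => // i [|j] //= _ _; rewrite mem_filter /= => /andP[i0 /IH[/= ij h i1 j1]].
  split=> //=; last by case: i i0 i1 {ij h}.
  by move=> [|k] //=; rewrite !ltnS; exact: h.
- case: i ij h i1 => [|i] ij h i1.
    case: j ij h j1 => // j _ h j1; rewrite xpair_eqE eqxx /= eqSS orbF; apply/eqP.
    have h' k : k < j -> nth true f k = false by move=> kj; apply: (h k.+1).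
    have [jx|xj|//] := ltngtP j (index true f).
      by move: j1; rewrite /= idx_lt.
    by have := idx_nth f; rewrite h'.
  case: j ij h j1 => [|j] // ij h j1; rewrite mem_filter /=.
  have h' k : i <= k < j -> nth true f k = false by move=> kj; apply: (h k.+1).
  case: i ij h i1 h' => // i ij h i1 h'; apply/IH; split=> //.
Qed.

Definition lex_lt p q := (p.1 < q.1) || (p.1 == q.1) && (p.2 < q.2).

Lemma lex_lt_trans : transitive lex_lt.
Proof. by move=> q p r; rewrite /lex_lt; lia. Qed.

Lemma lex_lt_irr : irreflexive lex_lt.
Proof. by move=> p; rewrite /lex_lt; lia. Qed.

Lemma sorted_runs f : sorted lex_lt (runs f).
Proof.
have sh s : sorted lex_lt s -> sorted lex_lt (map (shift 1) s).
  rewrite sorted_map; apply: sub_sorted => p q; rewrite /lex_lt /=; lia.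
elim: f => [|[] f IH] //=; first exact: sh.
rewrite path_sortedE; last exact: lex_lt_trans.
rewrite sh ?sorted_filter// ?andbT; last exact: lex_lt_trans.
by apply/allP => q /mapP[p _ ->]; rewrite /lex_lt.
Qed.

Lemma sorted_intervals (t : seq signed_cluster) : sorted lex_lt (intervals t).
Proof.
have gen (s r : seq nat) : pairwise ltn s -> pairwise ltn r ->
    pairwise lex_lt [seq (i, j) | i <- s, j <- r].
  move=> + pr; elim: s => // a s IH; rewrite pairwise_cons => /andP[/allP as_ /IH{}IH].
  rewrite allpairs_cons pairwise_cat IH andbT; apply/andP; split.
    apply/allrelP => p q /mapP[j _ ->] /allpairsP[[i j'] [/= i_s _ ->]].
    by rewrite /lex_lt /= (as_ _ i_s : a < i).
  rewrite pairwise_map; apply: sub_pairwise pr => i j ij.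
  by rewrite /lex_lt /= eqxx (ij : i < j) orbT.
rewrite sorted_pairwise; last exact: lex_lt_trans.
by apply: gen; rewrite -sorted_pairwise ?iota_ltn_sorted//; exact: ltn_trans.
Qed.

End Runs.

(** * Sections as maximal runs of unflagged clusters *)

Section Sections.
Implicit Types (t : seq signed_cluster) (p : nat * nat).

Definition flags t : seq bool := [seq nonseparating_finite t i | i <- iota 0 (size t)].

Lemma size_flags t : size (flags t) = size t.
Proof. by rewrite size_map size_iota. Qed.

Lemma nth_flags t i : nth true (flags t) i = (size t <= i) || nonseparating_finite t i.
Proof.
have [ti|it] := leqP (size t) i; first by rewrite nth_default ?size_flags.
by rewrite (nth_map 0) ?size_iota// nth_iota.
Qed.

Lemma nth_flags_false t i : (nth true (flags t) i = false) <->
  i < size t /\ (infinite_cluster (nth cluster0 t i) \/ separating t i).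
Proof.
rewrite nth_flags /nonseparating_finite /finite_cluster leqNgt; case: (i < size t) => /=.
  split=> [|[_ [->|->]]//]; last by rewrite andbF.
  case: infinite_cluster => /=; first by split=> //; left.
  by case: separating => //= _; split=> //; right.
by split=> // -[].
Qed.

Lemma nth_slice t i j k : nth cluster0 (slice t (i, j)) k =
  if i + k < j then nth cluster0 t (i + k) else cluster0.
Proof.
rewrite /slice nth_drop /=; case: ltnP => ikj; first by rewrite nth_take.
by rewrite nth_default// size_take; case: ifP => //; lia.
Qed.

Lemma size_slice t i j : j <= size t -> size (slice t (i, j)) = j - i.
Proof. by move=> jt; rewrite /slice size_drop size_takel. Qed.

(** Inside a slice, separating means the same as in [t], as both neighbours are kept. An end of the
    slice has lost a neighbour, so it must be infinite. *)
Lemma finite_slice t i j : is_template t -> j <= size t ->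
  finite_template (slice t (i, j)) <->
  [/\ i < j, forall k, i <= k < j -> nth true (flags t) k = false,
     infinite_cluster (nth cluster0 t i) & infinite_cluster (nth cluster0 t j.-1)].
Proof.
move=> /and3P[wf at_ _] jt; have sz := size_slice i jt.
have nsep k : i < k -> k.+1 < j -> separating (slice t (i, j)) (k - i) = separating t k.
  move=> ik kj; rewrite /separating sz !nth_slice.
  have -> : i + (k - i) = k by lia.
  have -> : i + (k - i).-1 = k.-1 by lia.
  have -> : i + (k - i).+1 = k.+1 by lia.
  rewrite kj !ifT; [|lia|lia].
  have -> : 0 < k - i by lia.
  have -> : (k - i).+1 < j - i by lia.
  have -> : 0 < k by lia.
  by have -> : k.+1 < size t by lia.
split=> [/andP[/and3P[_ _ hasi] /allP ns]|[ij fl infi infj]].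
  have ij : i < j.
    rewrite ltnNge; apply/negP => ji; move: hasi; rewrite -(negbK (has _ _)) -all_predC.
    have : size (slice t (i, j)) = 0 by rewrite sz; lia.
    by move/size0nil => ->.
  have ns' k : i <= k < j ->
      infinite_cluster (nth cluster0 t k) \/ separating (slice t (i, j)) (k - i).
    move=> /andP[ik kj]; have /ns : k - i \in iota 0 (size (slice t (i, j))).
      by rewrite mem_iota sz; lia.
    rewrite /nonseparating_finite sz nth_slice (_ : i + (k - i) = k); last by lia.
    rewrite kj (_ : k - i < j - i); last by lia.
    by rewrite /finite_cluster /= negb_and !negbK => /orP.
  have infi : infinite_cluster (nth cluster0 t i).
    by case: (ns' i); rewrite ?leqnn ?ij// subnn /separating.
  have infj : infinite_cluster (nth cluster0 t j.-1).
    case: (ns' j.-1); [lia|by []|]; rewrite /separating sz => /and5P[_ + _ _ _].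
    by rewrite ltnNge (_ : j - i <= (j.-1 - i).+1)//; lia.
  split=> // k /andP[ik kj]; apply/nth_flags_false; split; first by lia.
  move: ik; rewrite leq_eqVlt => /predU1P[<-|ik]; first by left.
  have [kj1|kj1] := ltnP k.+1 j.
    by case: (ns' k); rewrite ?(ltnW ik) ?kj//; [left|rewrite nsep//; right].
  by left; rewrite (_ : k = j.-1); last by lia.
apply/andP; split.
  apply/and3P; split.
  - by apply/allP => c /mem_drop/mem_take; exact/allP.
  - by apply: drop_sorted; exact: take_sorted.
  - apply/(has_nthP cluster0); exists 0; first by rewrite sz; lia.
    by rewrite nth_slice addn0 ij.
apply/allP => k; rewrite mem_iota sz add0n /= => kji.
rewrite /nonseparating_finite /finite_cluster negb_and negb_and !negbK nth_slice.
rewrite ifT; last by lia.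
have [k0|k0] := posnP k; first by rewrite k0 addn0 infi orbT.
have [kj|kj] := ltnP (i + k).+1 j; last first.
  by rewrite (_ : i + k = j.-1) ?infj ?orbT//; lia.
have /nth_flags_false[_ []] : nth true (flags t) (i + k) = false by apply: fl; lia.
  by move=> ->; rewrite orbT.
by rewrite -nsep ?addKn// => [->|]; [rewrite !orbT|lia].
Qed.

(** A separating cluster at the end of a run would have an infinite, hence unflagged, neighbour
    outside, against maximality. *)
Lemma flags_endpoints t p : is_template t -> maximal_run (flags t) p ->
  [/\ p.2 <= size t, infinite_cluster (nth cluster0 t p.1)
    & infinite_cluster (nth cluster0 t p.2.-1)].
Proof.
case: p => i j tt [/= ij fl fi fj].
have jt : j <= size t.
  by have /nth_flags_false[] : nth true (flags t) j.-1 = false; [apply: fl; lia|lia].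
split=> //.
  have /nth_flags_false[_ []//] : nth true (flags t) i = false by apply: fl; rewrite leqnn.
  move=> /and5P[i0 _ _ inf _]; case: i i0 ij fl fi inf => // i _ ij fl /= fi inf.
  suff : nth true (flags t) i = false by rewrite fi.
  by apply/nth_flags_false; split; [lia|left].
have /nth_flags_false[_ []//] : nth true (flags t) j.-1 = false by apply: fl; lia.
move=> /and5P[_ js _ _ inf]; suff : nth true (flags t) j = false by rewrite fj.
have jE : j.-1.+1 = j by lia.
by apply/nth_flags_false; rewrite jE in js inf; split=> //; left.
Qed.

Lemma mem_intervals t p : (p \in intervals t) = (p.1 <= size t) && (p.2 <= size t).
Proof.
apply/allpairsP/andP => [[[i j] [is_ js ->]]|[i_t jt]].
  by move: is_ js; rewrite !mem_iota /= !add0n !ltnS.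
exists p; split; last by case: (p).
  by rewrite mem_iota /= add0n ltnS.
by rewrite mem_iota /= add0n ltnS.
Qed.

(** If a cluster next to a section were unflagged, the section could be enlarged: by that cluster if
    it is infinite, and by it together with the infinite cluster beyond if it is separating. *)
Lemma section_run t p : is_template t ->
  (p \in section_intervals t) = (p \in runs (flags t)).
Proof.
move=> tt; rewrite mem_filter mem_intervals; apply/idP/idP.
  case: p => i j /= /and3P[/andP[fs /allP mx] i_t jt]; apply/mem_runs.
  have [ij fl infi infj] := (finite_slice i tt jt).1 fs.
  have big i' j' : i' <= i -> j <= j' -> j' <= size t ->
      (forall k, i' <= k < i -> nth true (flags t) k = false) ->
      (forall k, j <= k < j' -> nth true (flags t) k = false) ->
      infinite_cluster (nth cluster0 t i') -> infinite_cluster (nth cluster0 t j'.-1) ->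
      (i', j') = (i, j).
    move=> ii jj j't h1 h2 inf1 inf2; apply/eqP.
    have : (i', j') \in intervals t by rewrite mem_intervals /=; lia.
    move=> /mx /=; rewrite ii jj /= => /implyP; apply.
    apply/finite_slice => //; split=> //; first by lia.
    move=> k kij; have [ki|ik] := ltnP k i; first by apply: h1; lia.
    by have [kj|jk] := ltnP k j; [apply: fl; lia|apply: h2; lia].
  split=> //.
  - case: i {i_t} ij infi {fl fs mx} big => //= i ij infi big.
    apply/negbNE/negP => /negbTE/nth_flags_false[it [inf|/[dup] si /and5P[i0 _ _ inf _]]].
      suff : (i, j) = (i.+1, j) by case; lia.
      apply: (big i j (leqnSn i) (leqnn j) jt) => // k ki; last by exfalso; lia.
      by apply/nth_flags_false; have -> : k = i by [lia]; split=> //; left.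
    suff : (i.-1, j) = (i.+1, j) by case; lia.
    apply: (big i.-1 j _ (leqnn j) jt) => //; [lia|move=> k ki|by move=> k ki; exfalso; lia].
     apply/nth_flags_false; have [->|->] : k = i \/ k = i.-1 by lia.
      by split=> //; right.
    by split; [lia|left].
  - apply/negbNE/negP => /negbTE/nth_flags_false[jt' [inf|/[dup] sj /and5P[_ js _ _ inf]]].
      suff : (i, j.+1) = (i, j) by case; lia.
      apply: (big i j.+1 (leqnn i) (leqnSn j) jt') => // k kj; first by exfalso; lia.
      by apply/nth_flags_false; have -> : k = j by [lia]; split=> //; left.
    suff : (i, j.+2) = (i, j) by case; lia.
    apply: (big i j.+2 (leqnn i) _ js) => // [|k kj|k kj]; [lia|by exfalso;
        lia|apply/nth_flags_false].
    have [->|->] : k = j \/ k = j.+1 by lia.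
      by split=> //; right.
    by split; [exact: js|left].
case: p => i j /mem_runs mr; have [/= jt infi infj] := flags_endpoints tt mr.
have [/= ij fl fi fj] := mr.
rewrite jt (leq_trans (ltnW ij) jt) !andbT; apply/andP; split.
  by apply/finite_slice.
apply/allP => -[i' j']; rewrite mem_intervals /= => /andP[i't j't].
apply/implyP => /and3P[i'i jj' /finite_slice-/(_ tt j't)[i'j' fl' _ _]].
rewrite xpair_eqE !eqn_leq i'i jj' andbT /=; apply/andP; split.
  rewrite leqNgt; apply/negP => i'i2; case: i fi i'i2 i'i ij {fl infi mr} => // i /= fi ii _ ij.
  by suff : nth true (flags t) i = false; [rewrite fi|apply: fl'; lia].
rewrite leqNgt; apply/negP => jj2.
by suff : nth true (flags t) j = false; [rewrite fj|apply: fl'; lia].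
Qed.

Lemma section_intervals_runs t : is_template t -> section_intervals t = runs (flags t).
Proof.
move=> tt; apply: (irr_sorted_eq lex_lt_trans lex_lt_irr).
- by apply: sorted_filter; [exact: lex_lt_trans|exact: sorted_intervals].
- exact: sorted_runs.
- by move=> p; exact: section_run.
Qed.

End Sections.

(** * Cutting a template into sections and flange words *)

Section Blocks.
Implicit Types (t u b : seq signed_cluster) (f : seq bool).

(* A block is a section followed by the flange clusters up to the next section. *)
Notation block := (seq signed_cluster * seq signed_cluster)%type.
Implicit Types (bl : seq block).

Definition join bl : seq signed_cluster := flatten [seq p.1 ++ p.2 | p <- bl].

Definition jflags bl : seq bool :=
  flatten [seq nseq (size p.1) false ++ nseq (size p.2) true | p <- bl].

(** Only the last block may lack flange clusters; otherwise two sections would touch and form a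
    single run. *)
Fixpoint wf_blocks bl : bool :=
  if bl is p :: bl' then [&& p.1 != [::], (bl' == [::]) || (p.2 != [::]) & wf_blocks bl']
  else true.

Lemma join_cons p bl : join (p :: bl) = p.1 ++ p.2 ++ join bl.
Proof. by rewrite /join /= catA. Qed.

Lemma jflags_cons p bl :
  jflags (p :: bl) = nseq (size p.1) false ++ nseq (size p.2) true ++ jflags bl.
Proof. by rewrite /jflags /= catA. Qed.

Lemma blocks_exist t f : size f = size t -> exists b bl,
  [/\ t = b ++ join bl, f = nseq (size b) true ++ jflags bl & wf_blocks bl].
Proof.
elim: t f => [|c t IH] [|a f] //; first by exists [::], [::].
move=> [/IH[b [bl [-> -> wf]]]]; case: a; first by exists (c :: b), bl.
case: b => [|d b]; last by exists [::], (([:: c], d :: b) :: bl); split=> //=; rewrite wf orbT.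
case: bl wf => [|[t1 b1] bl] wf; first by exists [::], [:: ([:: c], [::])].
exists [::], ((c :: t1, b1) :: bl); split; rewrite ?join_cons ?jflags_cons//.
by move: wf => /= /and3P[_ -> ->].
Qed.

Fixpoint block_intervals (o : nat) bl : seq (nat * nat) :=
  if bl is p :: bl' then
    (o, o + size p.1) :: block_intervals (o + size p.1 + size p.2) bl'
  else [::].

Lemma shift_shift i j s : map (shift i) (map (shift j) s) = map (shift (i + j)) s.
Proof. by rewrite -map_comp; apply: eq_map => p; rewrite /shift /= !addnA. Qed.

Lemma runs_true q f : runs (nseq q true ++ f) = map (shift q) (runs f).
Proof.
elim: q => [|q IH] /=; last by rewrite IH shift_shift.
by rewrite -[LHS]map_id; apply: eq_map => -[].
Qed.

Lemma runs_false k f : head true f ->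
  runs (nseq k.+1 false ++ f) = (0, k.+1) :: map (shift k.+1) (runs f).
Proof.
move=> hf; elim: k => [|k IH].
  case: f hf => [|[] f] //= _; congr (_ :: _); congr map.
  by rewrite filter_map; congr map; apply/all_filterP/allP.
have -> : runs (nseq k.+2 false ++ f) = (0, (index true (nseq k.+1 false ++ f)).+1)
    :: map (shift 1) [seq p <- runs (nseq k.+1 false ++ f) | 0 < p.1] by [].
rewrite IH.
have -> : index true (nseq k.+1 false ++ f) = k.+1.
  by rewrite index_cat mem_nseq /= size_nseq; move: hf; case: (f) => [|[] g] //=; rewrite ?addn0.
congr (_ :: _); rewrite /= filter_map (eq_filter (a2 := predT)) ?filter_predT ?shift_shift//.
Qed.

Lemma runs_blocks o bl : wf_blocks bl -> map (shift o) (runs (jflags bl)) = block_intervals o bl.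
Proof.
elim: bl o => [|[t1 b1] bl IH] o //= /and3P[t1n b1n wf].
rewrite jflags_cons /=; case: t1 t1n => // c t1 _; rewrite [size (c :: t1)]/=.
rewrite runs_false; last by case: b1 b1n => //; rewrite orbF => /eqP ->.
by rewrite runs_true /= shift_shift shift_shift IH// /shift /= addn0.
Qed.

Lemma block_intervals_slices u bl :
    [seq slice (u ++ join bl) p | p <- block_intervals (size u) bl] = map fst bl.
Proof.
elim: bl u => [|[t1 b1] bl IH] u //=; congr (_ :: _).
  by rewrite /slice /= join_cons /= catA takel_cat ?size_cat// take_oversize ?size_cat//
      drop_size_cat.
by have := IH (u ++ t1 ++ b1); rewrite !size_cat addnA join_cons -!catA.
Qed.

Lemma block_intervals_gaps u b bl (S := block_intervals (size u + size b) bl) :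
  [seq slice (u ++ b ++ join bl) p
    | p <- zip (size u :: unzip2 S) (rcons (unzip1 S) (size (u ++ b ++ join bl)))]
  = b :: map snd bl.
Proof.
rewrite /S; elim: bl u b {S} => [|[t1 b1] bl IH] u b /=.
  by rewrite /slice /= take_size drop_size_cat// cats0.
congr (_ :: _).
  rewrite /slice /= catA takel_cat ?size_cat// take_oversize ?size_cat//.
  by rewrite drop_size_cat.
have := IH (u ++ b ++ t1) b1; rewrite !size_cat !addnA join_cons -!catA /=; exact.
Qed.

Definition flange_word b : word := flatten (map cluster_word b).

Lemma parse_template t : is_template t -> exists b bl,
  [/\ t = b ++ join bl, flags t = nseq (size b) true ++ jflags bl, wf_blocks bl,
      section_intervals t = block_intervals (size b) bl &
      sections t = map fst bl /\ flange t = map flange_word (b :: map snd bl)].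
Proof.
move=> tt; have [b [bl [tE fE wf]]] := blocks_exist (size_flags t).
have sE : section_intervals t = block_intervals (size b) bl.
  by rewrite section_intervals_runs// fE runs_true runs_blocks.
exists b, bl; split=> //; split.
  by rewrite /sections sE {1}tE block_intervals_slices.
have := @block_intervals_gaps [::] b bl; rewrite [[::] ++ _]/= add0n -tE => <-.
by rewrite /flange sE -map_comp.
Qed.

Lemma sections_are_section_templates t : is_template t -> forall s, s \in sections t ->
    section_template s.
Proof.
move=> tt s /mapP[p + ->]; rewrite mem_filter => /andP[/andP[fs _] _].
exact: finite_template_section_template.
Qed.

End Blocks.

(** * Decomposition of words outside J(t) *)

Section BlockWords.
Implicit Types (t u v b : seq signed_cluster) (f : seq bool) (x y z : word).
Notation block := (seq signed_cluster * seq signed_cluster)%type.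
Implicit Types (bl : seq block) (ls : seq word).

Fixpoint block_word bl ls : word :=
  match bl, ls with
  | p :: bl', x :: ls' => x ++ flange_word p.2 ++ block_word bl' ls'
  | _, _ => [::]
  end.

Fixpoint block_lang bl ls : Prop :=
  match bl, ls with
  | p :: bl', x :: ls' => lang p.1 x /\ block_lang bl' ls'
  | [::], [::] => True
  | _, _ => False
  end.

(* When [f] flags the finite nonseparating clusters, this is membership in J(t). *)
Definition deficient f t x : Prop := exists u c v k,
  [/\ t = u ++ c :: v, nth false f (size u), c.2 = Some k & lang (u ++ (c.1, Some k.-1) :: v) x].

Definition flange_clusters b : bool := all (fun c => finite_cluster c && cluster_wf c) b.

Lemma deficient_subseq f t x y : subseq y x -> deficient f t x -> deficient f t y.
Proof.
by move=> yx [u [c [v [k [tE fu ck ux]]]]]; exists u, c, v, k; split=> //; exact: lang_subseq ux.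
Qed.

Lemma deficient_cat f1 f2 t1 t2 y z : size f1 = size t1 -> lang t1 y ->
  deficient f2 t2 z -> deficient (f1 ++ f2) (t1 ++ t2) (y ++ z).
Proof.
move=> s1 ty [u [c [v [k [-> fu ck uz]]]]]; exists (t1 ++ u), c, v, k.
rewrite -!catA size_cat nth_cat s1 ltnNge leq_addr /= addKn; split=> //.
by apply/lang_cat; exists y, z.
Qed.

Lemma deficient_flange t1 b f3 t3 u c v k x z : b = u ++ c :: v -> c.2 = Some k ->
  lang t1 x -> lang (u ++ (c.1, Some k.-1) :: v ++ t3) z ->
  deficient (nseq (size t1) false ++ nseq (size b) true ++ f3) (t1 ++ b ++ t3) (x ++ z).
Proof.
move=> bE ck t1x uz; apply: deficient_cat => //; first by rewrite size_nseq.
exists u, c, (v ++ t3), k; split=> //; first by rewrite bE -catA.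
have ub : size u < size b by rewrite bE size_cat /= -addSnnS leq_addr.
by rewrite nth_cat size_nseq ub nth_nseq ub.
Qed.

Fixpoint flang f t x : Prop :=
  match f, t with
  | a :: f', c :: t' => exists i y,
      [/\ fits_multiplicity i c, a -> c.2 = Some i, flang f' t' y & x = nseq i c.1 ++ y]
  | _, _ => x = [::]
  end.

(** A flagged cluster is either used up or one symbol short, and in the second case the word is
    deficient. *)
Lemma lang_flang f t x : size f = size t ->
  all (fun p => p.1 ==> finite_cluster p.2) (zip f t) -> lang t x ->
  flang f t x \/ deficient f t x.
Proof.
elim: t f x => [|c t IH] [|a f] x //; first by left.
move=> [sf] /= /andP[ac fin] [i [y [fi ty ->]]].
have [fy|[u [c' [v [k [-> fu ck uz]]]]]] := IH f y sf fin ty; last first.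
  by right; exists (c :: u), c', v, k; split=> //; exists i, y.
case: a ac => /= [fc|_]; last by left; exists i, y; split.
case: c fc fi => s [k|] //= _ ik.
rewrite /fits_multiplicity /= in ik.
have [ki|ik'] := leqP k i.
  by left; exists i, y; split=> // _; congr Some; apply/eqP; rewrite eqn_leq ki.
right; exists [::], (s, Some k), t, k; split=> //; exists i, y; split=> //=.
by rewrite /fits_multiplicity /= -ltnS prednK// (leq_ltn_trans _ ik').
Qed.

Lemma flang_false t f t2 x : flang (nseq (size t) false ++ f) (t ++ t2) x ->
  exists y z, [/\ lang t y, flang f t2 z & x = y ++ z].
Proof.
elim: t x => [|c t IH] x /=; first by exists [::], x.
move=> [i [_ [fi _ /IH[y [z [ty fz ->]]] ->]]]; exists (nseq i c.1 ++ y), z.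
by rewrite catA; split=> //; exists i, y.
Qed.

Lemma flang_true b f t2 x : flang (nseq (size b) true ++ f) (b ++ t2) x ->
  exists2 z, flang f t2 z & x = flange_word b ++ z.
Proof.
elim: b x => [|c b IH] x /=; first by exists x.
move=> [i [_ [_ /(_ isT) ci /IH[z fz ->] ->]]]; exists z => //.
by rewrite /flange_word /= catA /cluster_word ci.
Qed.

Lemma flang_blocks bl x : flang (jflags bl) (join bl) x ->
  exists2 ls, block_lang bl ls & x = block_word bl ls.
Proof.
elim: bl x => [|p bl IH] x; first by exists [::].
rewrite jflags_cons join_cons => /flang_false[y [z [py /flang_true[z' /IH[ls bls ->] ->] ->]]].
by exists (y :: ls).
Qed.

Lemma fits_refl s k : fits_multiplicity k (s, Some k).
Proof. exact: leqnn. Qed.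

Lemma lang_flange b : lang b (flange_word b).
Proof.
elim: b => // -[s [k|]] b IH; last by exists 0, (flange_word b).
by exists k, (flange_word b); rewrite fits_refl.
Qed.

Lemma block_lang_lang bl ls : block_lang bl ls -> lang (join bl) (block_word bl ls).
Proof.
elim: bl ls => [|p bl IH] [|x ls] //= [px /IH bls]; rewrite join_cons.
apply/lang_cat; exists x, (flange_word p.2 ++ block_word bl ls); split=> //.
by apply/lang_cat; exists (flange_word p.2), (block_word bl ls); split=> //; exact: lang_flange.
Qed.

Lemma block_lang_size bl ls : block_lang bl ls -> size ls = size bl.
Proof. by elim: bl ls => [|p bl IH] [|x ls] //= [_ /IH ->]. Qed.

Definition blocks_ok bl : bool := wf_blocks bl && all (fun p => flange_clusters p.2) bl.

(** If two readings had first parts [y] and [y'] with [y'] longer, the flange word after [y] would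
    begin inside [y']. What follows [y'] is then a subsequence of the rest after [y] without its
    first flange symbol, so reading [y'] in the section leaves that cluster short: the word is
    deficient. Without flange clusters the block is the last one, and the lengths agree. *)
Lemma block_word_uniq bl ls ls' : blocks_ok bl -> block_lang bl ls -> block_lang bl ls' ->
  block_word bl ls = block_word bl ls' ->
      ~ deficient (jflags bl) (join bl) (block_word bl ls) -> ls = ls'.
Proof.
elim: bl ls ls' => [|[t1 b] bl IH] [|x ls] [|x' ls'] //=.
move=> /andP[/= /and3P[_ bn wf] /andP[fb fbl]] [tx bls] [tx' bls'].
have wlog_lt y y' l l' : lang t1 y -> lang t1 y' -> block_lang bl l -> block_lang bl l' ->
    y ++ flange_word b ++ block_word bl l = y' ++ flange_word b ++ block_word bl l' ->
    ~ deficient (jflags ((t1, b) :: bl)) (join ((t1, b) ::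
        bl)) (y ++ flange_word b ++ block_word bl l) ->
    size y' <= size y.
  move=> ty ty' bl_l bl_l' e nd; rewrite leqNgt; apply/negP => yy'.
  case/orP: bn => [/eqP bl0|].
    rewrite bl0 /= in e bl_l bl_l'; case: l l' bl_l bl_l' e {nd} => // -[] // _ _.
    by move=> /(congr1 size); rewrite !size_cat /=; lia.
  case: b fb e nd => // -[s [[|k]|]] // b fb e nd _; rewrite join_cons jflags_cons in nd.
  apply: nd; rewrite e; apply: (@deficient_flange _ _ _ _ [::] (s, Some k.+1) b k.+1) => //.
  have yE : y' = y ++ drop (size y) y'.
    rewrite -[LHS](cat_take_drop (size y)); congr (_ ++ _).
    transitivity (take (size y) (y' ++ flange_word ((s, Some k.+1) :: b) ++ block_word bl l')).
      by rewrite takel_cat// ltnW.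
    by rewrite -e take_size_cat.
  move: e; rewrite {1}yE -catA => /eqP; rewrite eqseq_cat// eqxx /= => /eqP e.
  have [d [r dE]] : exists d r, drop (size y) y' = d :: r.
    case E : (drop (size y) y') => [|d r]; last by exists d, r.
    by move: (congr1 size E); rewrite size_drop /=; lia.
  rewrite dE in e; case: e => _ e.
  apply: (@lang_subseq ((s, Some k) ::
      b ++ join bl) (nseq k s ++ flange_word b ++ block_word bl l)).
    have -> : nseq k s ++ flange_word b ++ block_word bl l =
        r ++ flange_word ((s, Some k.+1) :: b) ++ block_word bl l' by rewrite catA; exact: e.
    exact: suffix_subseq.
  exists k, (flange_word b ++ block_word bl l); split=> //; first exact: fits_refl.
  apply/lang_cat; exists (flange_word b), (block_word bl l); split=> //; first exact: lang_flange.
  exact: block_lang_lang.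
move=> e nd.
have sxx : size x = size x'.
  apply/eqP; rewrite eqn_leq (wlog_lt x x' ls ls')// andbT.
  by apply: (wlog_lt x' x ls' ls) => //; rewrite -e.
move: (e) => /eqP; rewrite eqseq_cat// => /andP[/eqP xx']; rewrite eqseq_cat// eqxx /= => /eqP e'.
rewrite xx' (IH ls ls')//; first by rewrite /blocks_ok wf fbl.
move=> df; apply: nd; rewrite join_cons jflags_cons; apply: deficient_cat => //.
  by rewrite size_nseq.
by apply: deficient_cat df; rewrite ?size_nseq//; exact: lang_flange.
Qed.

Fixpoint block_insertions ls : seq (seq word) :=
  if ls is x :: ls' then [seq y :: ls' | y <- word_uppers x] ++ [seq x ::
      l | l <- block_insertions ls']
  else [::].

Lemma size_block_insertions ls l : l \in block_insertions ls -> size l = size ls.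
Proof.
elim: ls l => [|x ls IH] l //=.
by rewrite mem_cat => /orP[/mapP[y _ ->]|/mapP[l' /IH <- ->]].
Qed.

Lemma uniq_block_insertions ls : uniq (block_insertions ls).
Proof.
elim: ls => [|x ls IH] //=; rewrite cat_uniq !map_inj_uniq ?IH ?uniq_word_uppers ?andbT /=.
- apply/hasPn => _ /mapP[l _ ->]; apply/mapP => -[y yx [xy _]].
  by move/mem_word_uppers/insertion_size: yx; rewrite xy; lia.
- by move=> ? ? [].
- by move=> ? ? [].
Qed.

Lemma block_word_insertion bl ls l : size ls = size bl -> l \in block_insertions ls ->
    insertion (block_word bl ls) (block_word bl l).
Proof.
elim: bl ls l => [|p bl IH] [|x ls] l //= [sl].
rewrite mem_cat => /orP[/mapP[y /mem_word_uppers xy ->]|/mapP[l' /(IH _ _ sl) i ->]] /=.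
  exact: insertion_catr.
by rewrite !catA; exact: insertion_catl.
Qed.

Lemma insertion_flange b x : flange_clusters b -> insertion x (flange_word b) ->
  exists u c v k, [/\ b = u ++ c :: v, c.2 = Some k & lang (u ++ (c.1, Some k.-1) :: v) x].
Proof.
elim: b x => [|[s [k|]] b IH] x //; first by move=> _ /insertion_size.
rewrite /flange_word /= => fb /insertion_cat[[_ /insertion_nseq[k' -> ->] ->]|[z iz ->]].
  exists [::], (s, Some k'.+1), b, k'.+1; split=> //=.
  by exists k', (flange_word b); rewrite fits_refl; split=> //; exact: lang_flange.
have [u [c [v [k' [bE ck uz]]]]] := IH z (andP fb).2 iz.
exists ((s, Some k) :: u), c, v, k'; rewrite bE; split=> //.
by exists k, z; rewrite fits_refl.
Qed.

(** The deleted symbol belongs to a section part or to a flange word, and the latter loss makes [x]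
    deficient. *)
Lemma insertion_block_word bl l x : blocks_ok bl -> block_lang bl l ->
    insertion x (block_word bl l) ->
  (exists ls, [/\ block_lang bl ls, x = block_word bl ls & l \in block_insertions ls]) \/
  deficient (jflags bl) (join bl) x.
Proof.
elim: bl l x => [|[t1 b] bl IH] [|y l] x //; first by move=> _ _ /insertion_size.
move=> /andP[/= /and3P[_ bn wf] /andP[fb fbl]] [ty bll].
have ok : blocks_ok bl by rewrite /blocks_ok wf fbl.
rewrite join_cons jflags_cons /=.
move=> /insertion_cat[[y' iy ->]|[_ /insertion_cat[[z iz ->]|[z iz ->]] ->]].
- left; exists (y' :: l); split=> //=; first by split=> //; apply: lang_subseq ty;
    exact: insertion_subseq.
  by rewrite mem_cat; apply/orP; left; apply: map_f; apply/mem_word_uppers.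
- right; have [u [c [v [k [bE ck uz]]]]] := insertion_flange fb iz.
  apply: (@deficient_flange t1 b (jflags bl) (join bl) u c v k y (z ++ block_word bl l) bE ck ty).
  by rewrite -cat_cons catA; apply/lang_cat; exists z, (block_word bl l); split=> //;
      exact: block_lang_lang.
- have [[ls [bls -> lb]]|df] := IH l z ok bll iz.
    left; exists (y :: ls); split=> //.
    by rewrite mem_cat map_f ?orbT.
  right; apply: deficient_cat => //; first by rewrite size_nseq.
  by apply: deficient_cat df; rewrite ?size_nseq//; exact: lang_flange.
Qed.

End BlockWords.

(** * Products of F over the sections *)

Section BlockValues.
Context (R : realType).
Local Open Scope ring_scope.
Notation block := (seq signed_cluster * seq signed_cluster)%type.
Implicit Types (t b : seq signed_cluster) (x y z : word) (bl : seq block) (ls : seq word).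
Implicit Types (w : seq R) (n : seq nat).

Fixpoint block_value bl w ls : R :=
  match bl, ls with
  | p :: bl', x :: ls' => zigzag_sum (zip w (signs p.1)) x * block_value bl' (drop (num_inf p.1)
      w) ls'
  | _, _ => 1
  end.

Fixpoint block_splits bl ls : seq (seq nat) :=
  match bl, ls with
  | p :: bl', x :: ls' =>
      [seq n1 ++ n2 | n1 <- splits (signs p.1) x, n2 <- block_splits bl' ls']
  | _, _ => [:: [::]]
  end.

Fixpoint full_parts bl n : seq word :=
  if bl is p :: bl' then full_word p.1 (take (num_inf p.1) n) ::
      full_parts bl' (drop (num_inf p.1) n)
  else [::].

Definition sections_ok bl : Prop :=
  blocks_ok bl /\ forall p, p \in bl -> section_template p.1.

Lemma sections_ok_cons p bl : sections_ok (p :: bl) ->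
  [/\ flange_clusters p.2, section_template p.1 & sections_ok bl].
Proof.
move=> [/andP[/= /and3P[_ _ wf] /andP[f2 fbl]] fs]; split=> //.
  by apply: fs; rewrite inE eqxx.
split; first by rewrite /blocks_ok wf.
by move=> q qbl; apply: fs; rewrite inE qbl orbT.
Qed.

Lemma num_inf_flange b : flange_clusters b -> num_inf b = 0%N.
Proof.
elim: b => // c b IH /= /andP[/andP[fc _] /IH]; rewrite /num_inf /= => ->.
by rewrite (negbTE fc).
Qed.

Lemma full_word_flange b n : flange_clusters b -> full_word b n = flange_word b.
Proof.
by elim: b n => // -[s [k|]] b IH n //= /andP[_ fb]; rewrite full_word_finite IH.
Qed.

Lemma full_word_flange_cat b t n : flange_clusters b ->
  full_word (b ++ t) n = flange_word b ++ full_word t n.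
Proof.
move=> fb; rewrite -[n in LHS]cat0s full_word_cat; last by rewrite num_inf_flange.
by rewrite full_word_flange.
Qed.

Lemma num_inf_cat t1 t2 : num_inf (t1 ++ t2) = (num_inf t1 + num_inf t2)%N.
Proof. exact: count_cat. Qed.

Lemma num_inf_join p bl : flange_clusters p.2 ->
    num_inf (join (p :: bl)) = (num_inf p.1 + num_inf (join bl))%N.
Proof. by move=> f2; rewrite join_cons !num_inf_cat (num_inf_flange f2). Qed.

Lemma monomial_value_cat w1 w2 n1 n2 : size w1 = size n1 ->
  monomial_value (w1 ++ w2) (n1 ++ n2) = monomial_value w1 n1 * monomial_value w2 n2.
Proof.
elim: w1 n1 => [|a w1 IH] [|k n1] //=; first by rewrite mul1r.
by move=> [/IH ->]; rewrite mulrA.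
Qed.

Lemma zip_take w t : zip w (signs t) = zip (take (num_inf t) w) (signs t).
Proof.
rewrite -size_signs; elim: (signs t) w => [|s ss IH] [|a w] //=.
by rewrite IH.
Qed.

Lemma block_value_splits bl w ls : sections_ok bl -> size ls = size bl ->
    size w = num_inf (join bl) ->
  block_value bl w ls = \sum_(n <- block_splits bl ls) monomial_value w n.
Proof.
elim: bl w ls => [|p bl IH] w [|x ls] //=; first by rewrite big_seq1; case: w.
move=> /sections_ok_cons[f2 f1 ok] [sl]; rewrite num_inf_join// => sw.
have sw1 : size (take (num_inf p.1) w) = num_inf p.1 by rewrite size_takel// sw leq_addr.
have sw2 : size (drop (num_inf p.1) w) = num_inf (join bl) by rewrite size_drop sw addKn.
rewrite zip_take (zigzag_sum_splits _ sw1) (IH _ _ ok sl sw2) big_allpairs_dep big_distrlr/=.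
rewrite [LHS]big_seq [RHS]big_seq; apply: eq_bigr => n1 /size_splits sn1.
apply: eq_bigr => n2 _; rewrite -monomial_value_cat ?cat_take_drop//.
by rewrite sw1 sn1 size_signs.
Qed.

Lemma size_block_splits bl ls n : sections_ok bl -> size ls = size bl ->
  n \in block_splits bl ls -> size n = num_inf (join bl).
Proof.
elim: bl ls n => [|p bl IH] [|x ls] n //=; first by rewrite inE => _ _ /eqP ->.
move=> /sections_ok_cons[f2 f1 ok] [sl] /allpairsP[[n1 n2] [/= n1s n2s ->]].
by rewrite num_inf_join// size_cat (size_splits n1s) size_signs (IH ls).
Qed.

Lemma uniq_block_splits bl ls : uniq (block_splits bl ls).
Proof.
elim: bl ls => [|p bl IH] [|x ls] //=.
apply: allpairs_uniq; [exact: uniq_splits|exact: IH|].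
move=> _ _ /allpairsP[[n1 n2] [/= n1s n2s ->]] /allpairsP[[m1 m2] [/= m1s m2s ->]] /= e.
have s12 : size n1 = size m1 by rewrite (size_splits n1s) (size_splits m1s).
by move/eqP: e; rewrite eqseq_cat// => /andP[/eqP -> /eqP ->].
Qed.

Lemma block_splits_subseq bl ls n : sections_ok bl -> size ls = size bl ->
  n \in block_splits bl ls -> subseq (block_word bl ls) (full_word (join bl) n).
Proof.
elim: bl ls n => [|p bl IH] [|x ls] n //=.
move=> /sections_ok_cons[f2 f1 ok] [sl] /allpairsP[[n1 n2] [/= n1s n2s ->]].
rewrite join_cons full_word_cat; last by rewrite (size_splits n1s) size_signs.
apply: cat_subseq; first exact: section_template_splits.
rewrite full_word_flange_cat//; apply: cat_subseq => //.
exact: IH.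
Qed.

(** All splittings have the same total, the number of boxes, so their full words lie on one level,
    as [sum_above] requires. *)
Lemma block_splits_sumn bl ls n : sections_ok bl -> size ls = size bl ->
  n \in block_splits bl ls -> sumn n = sumn [seq (size x).+1 | x <- ls].
Proof.
elim: bl ls n => [|p bl IH] [|x ls] n //=; first by rewrite inE => _ _ /eqP ->.
move=> /sections_ok_cons[f2 f1 ok] [sl] /allpairsP[[n1 n2] [/= n1s n2s ->]].
have /eqP n1x : sumn n1 == (size x).+1.
  by move: (n1s); rewrite mem_splits ?(size_splits n1s)// => /andP[].
by rewrite sumn_cat (IH ls n2)// n1x.
Qed.

Lemma block_value_out bl w ls : sections_ok bl -> size ls = size bl -> size w = num_inf (join bl) ->
  ~ block_lang bl ls -> block_value bl w ls = 0.
Proof.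
elim: bl w ls => [|p bl IH] w [|x ls] //=.
move=> /sections_ok_cons[f2 f1 ok] [sl]; rewrite num_inf_join// => sw.
have sw1 : size (take (num_inf p.1) w) = num_inf p.1 by rewrite size_takel// sw leq_addr.
have sw2 : size (drop (num_inf p.1) w) = num_inf (join bl) by rewrite size_drop sw addKn.
move=> /not_andP[px|bls]; first by rewrite zip_take zigzag_sum_out// mul0r.
by rewrite (IH _ _ ok sl sw2 bls) mulr0.
Qed.

Lemma block_value_gt0 bl w ls : sections_ok bl -> size w = num_inf (join bl) ->
  all (fun a => 0 < a) w -> block_lang bl ls -> 0 < block_value bl w ls.
Proof.
elim: bl w ls => [|p bl IH] w [|x ls] //=.
move=> /sections_ok_cons[f2 f1 ok]; rewrite num_inf_join// => sw w0 [px bls].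
have sw1 : size (take (num_inf p.1) w) = num_inf p.1 by rewrite size_takel// sw leq_addr.
have sw2 : size (drop (num_inf p.1) w) = num_inf (join bl) by rewrite size_drop sw addKn.
rewrite zip_take mulr_gt0 ?zigzag_sum_gt0 ?IH//.
  by apply/allP => a /mem_take; exact/allP.
by apply/allP => a /mem_drop; exact/allP.
Qed.

Lemma total_zip w t : size w = num_inf t -> total (zip w (signs t)) = \sum_(a <- w) a.
Proof. by move=> sw; rewrite /total -(big_map fst predT id) zip_fst. Qed.

(** A Leibniz rule: inserting into one section multiplies the product by the total weight of that
    section, and these totals add up. *)
Lemma block_value_harmonic bl w ls : sections_ok bl -> size ls = size bl ->
    size w = num_inf (join bl) ->
  \sum_(l <- block_insertions ls) block_value bl w l = (\sum_(a <- w) a) * block_value bl w ls.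
Proof.
elim: bl w ls => [|p bl IH] w [|x ls] //=.
  by move=> _ _ /size0nil ->; rewrite !big_nil mul0r.
move=> /sections_ok_cons[f2 f1 ok] [sl]; rewrite num_inf_join// => sw.
have sw1 : size (take (num_inf p.1) w) = num_inf p.1 by rewrite size_takel// sw leq_addr.
have sw2 : size (drop (num_inf p.1) w) = num_inf (join bl) by rewrite size_drop sw addKn.
rewrite big_cat !big_map/= -mulr_suml -mulr_sumr (IH _ _ ok sl sw2) zip_take zigzag_sum_harmonic.
have -> : \sum_(a <- w) a = \sum_(a <- take (num_inf p.1) w) a + \sum_(a <- drop (num_inf p.1) w) a.
  by rewrite -big_cat /= cat_take_drop.
by rewrite total_zip//; ring.
Qed.

Lemma block_lang_full_parts bl n : block_lang bl (full_parts bl n).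
Proof. by elim: bl n => //= p bl IH n; split=> //; exact: lang_full_word. Qed.

Lemma full_word_join bl n : sections_ok bl -> size n = num_inf (join bl) ->
  full_word (join bl) n = block_word bl (full_parts bl n).
Proof.
elim: bl n => [|p bl IH] n //= /sections_ok_cons[f2 f1 ok]; rewrite num_inf_join// => sn.
rewrite -[in LHS](cat_take_drop (num_inf p.1) n) join_cons full_word_cat; last first.
  by rewrite size_takel// sn leq_addr.
rewrite full_word_flange_cat//; congr (_ ++ (_ ++ _)).
by rewrite IH// size_drop sn addKn.
Qed.

Lemma block_value_full_parts bl w : sections_ok bl -> size w = num_inf (join bl) ->
  exists C : R, forall n, size n = num_inf (join bl) ->
      block_value bl w (full_parts bl n) = C * monomial_value w n.
Proof.
elim: bl w => [|p bl IH] w /=.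
  by move=> _ _; exists 1 => -[|//] _; rewrite mul1r; case: w.
move=> /sections_ok_cons[f2 f1 ok]; rewrite num_inf_join// => sw.
have sw1 : size (take (num_inf p.1) w) = num_inf p.1 by rewrite size_takel// sw leq_addr.
have sw2 : size (drop (num_inf p.1) w) = num_inf (join bl) by rewrite size_drop sw addKn.
have [C1 C1E] := zigzag_sum_full_word sw1 f1; have [C2 C2E] := IH _ ok sw2.
exists (C1 * C2) => n sn.
have sn1 : size (take (num_inf p.1) n) = num_inf p.1 by rewrite size_takel// sn leq_addr.
have sn2 : size (drop (num_inf p.1) n) = num_inf (join bl) by rewrite size_drop sn addKn.
rewrite zip_take C1E// C2E//.
have -> : monomial_value w n = monomial_value (take (num_inf p.1) w) (take (num_inf p.1) n) *
    monomial_value (drop (num_inf p.1) w) (drop (num_inf p.1) n).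
  by rewrite -monomial_value_cat ?cat_take_drop// sw1 sn1.
by ring.
Qed.

End BlockValues.

(** * The parsed form of a template and phi in terms of it *)

Section ParsedTemplate.
Notation block := (seq signed_cluster * seq signed_cluster)%type.
Implicit Types (t b u : seq signed_cluster) (x y z : word) (bl : seq block) (ls : seq word).

Record parsed t b bl : Prop := Parsed {
  parsed_template : is_template t;
  parsed_join : t = b ++ join bl;
  parsed_flags : flags t = nseq (size b) true ++ jflags bl;
  parsed_intervals : section_intervals t = block_intervals (size b) bl;
  parsed_sections : sections t = map fst bl;
  parsed_flange : flange t = map flange_word (b :: map snd bl);
  parsed_flange_ok : flange_clusters b;
  parsed_sections_ok : sections_ok bl }.

Lemma flags_finite t : all (fun p => p.1 ==> finite_cluster p.2) (zip (flags t) t).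
Proof.
apply/(all_nthP (true, cluster0)) => i; rewrite size_zip size_flags minnn => it.
rewrite nth_zip ?size_flags//= nth_flags leqNgt it /=.
by apply/implyP => /and3P[].
Qed.

Lemma parse_exists t : is_template t -> exists b bl, parsed t b bl.
Proof.
move=> tt; have [b [bl [tE fE wf sE [secE flE]]]] := parse_template tt.
have wft : all cluster_wf t by case/and3P: tt.
have key c f : all cluster_wf c ->
    all (fun p => p.1 ==> finite_cluster p.2) (zip (nseq (size c) true ++ f) c) ->
    flange_clusters c.
  elim: c => // d c IH /= /andP[wd wc] /andP[fd fc]; rewrite wd fd /=; exact: IH.
have zn (d e : seq signed_cluster) f f' : size f = size d ->
    all (fun p => p.1 ==> finite_cluster p.2) (zip (f ++ f') (d ++ e)) ->
    all (fun p => p.1 ==> finite_cluster p.2) (zip f d) /\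
    all (fun p => p.1 ==> finite_cluster p.2) (zip f' e).
  by move=> sfd; rewrite zip_cat// all_cat => /andP[].
have ft := flags_finite t.
exists b, bl; split=> //.
  rewrite fE tE in ft; rewrite tE in wft; apply: (key _ [::]); first by move: wft;
      rewrite all_cat => /andP[].
  by rewrite cats0; have [] := zn _ _ _ _ _ ft; rewrite ?size_nseq.
split; last first.
  by move=> p pbl; apply: (sections_are_section_templates tt); rewrite secE map_f.
rewrite /blocks_ok wf /=; rewrite fE tE in ft; rewrite tE in wft.
have {ft} [_ ft] := zn _ _ _ _ (size_nseq _ _) ft.
have {wft} : all cluster_wf (join bl) by move: wft; rewrite all_cat => /andP[].
elim: bl ft {tE fE wf sE secE flE} => // p bl IH; rewrite jflags_cons join_cons.
move=> /zn[|_]; rewrite ?size_nseq// => /zn[|f1 f2];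
    rewrite ?size_nseq// !all_cat => /and3P[_ w2 wj] /=.
by rewrite IH// andbT; apply: (key _ [::]); rewrite ?cats0.
Qed.

(** A cluster of multiplicity 0 may be kept in place, which removes the case distinction made by
    [decrease_cluster]. *)
Lemma lang_decrease u s k v x :
  lang (u ++ (if k is k'.+2 then [:: (s, Some k'.+1)] else [::]) ++ v) x <->
  lang (u ++ (s, Some k.-1) :: v) x.
Proof.
case: k => [|[|k]] //=.
all: rewrite !lang_cat; split=> -[y [z [uy vz ->]]]; exists y, z; split=> //.
all: try (by exact: lang_cons).
all: by case: vz => i [z' [fi vz ->]]; case: i fi.
Qed.

Lemma template_idealE t x : template_ideal t (Some x) <-> deficient (flags t) t x.
Proof.
have fE i : i < size t -> nth false (flags t) i = nonseparating_finite t i.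
  by move=> it; rewrite (nth_map 0) ?size_iota// nth_iota.
split=> [[i /= ni /zigzags_ofE]|[u [c [v [k [tE fu ck uz]]]]]].
  have /and3P[it fi _] := ni; rewrite /decrease_cluster.
  case ci : (nth cluster0 t i) fi => [s [k|]] // _ /lang_decrease uz.
  exists (take i t), (s, Some k), (drop i.+1 t), k; split=> //.
    by rewrite -ci -drop_nth// cat_take_drop.
  by rewrite size_takel ?(ltnW it)// fE.
have ut : size u < size t by rewrite tE size_cat /= -addSnnS leq_addr.
exists (size u); first by rewrite /= -fE.
apply/zigzags_ofE; rewrite /decrease_cluster tE nth_cat ltnn subnn take_size_cat//.
rewrite /= ck; apply/lang_decrease; rewrite -[X in drop _ X]cat_rcons drop_size_cat//.
by rewrite size_rcons.
Qed.

Lemma template_ideal_subseq t x y : subseq x y -> template_ideal t (Some y) ->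
    template_ideal t (Some x).
Proof. by move=> xy /template_idealE h; apply/template_idealE; exact: deficient_subseq h. Qed.

Section Parsed.
Context t b bl (P : parsed t b bl).

Definition template_word ls := flange_word b ++ block_word bl ls.

Lemma interleaveE ls : size ls = size bl -> interleave (flange t) ls = template_word ls.
Proof.
rewrite (parsed_flange P) /template_word.
have : forall b', size ls = size bl ->
    interleave (flange_word b' :: map flange_word (map snd bl)) ls =
        flange_word b' ++ block_word bl ls.
  elim: (bl) ls => [|p bl' IH] [|x ls] b' //=.
  by move=> [sl]; have /= -> := IH ls p.2 sl.
exact.
Qed.

Lemma decompositionE x ls : decomposition t x ls <-> block_lang bl ls /\ x = template_word ls.
Proof.
rewrite /decomposition (parsed_sections P) size_map; split=> [[sl hl ->]|[bls ->]].
  split; last exact: interleaveE.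
  elim: (bl) ls sl hl => [|p bl' IH] [|x' ls] //= [sl] hl; split.
    by have /zigzags_ofE := hl 0 isT.
  by apply: IH => // i ib; exact: (hl i.+1).
have sl := block_lang_size bls; split=> //; last by rewrite interleaveE.
elim: (bl) ls bls {sl} => [|p bl' IH] [|x' ls] //= [px bls] [|i] ib /=; last exact: IH.
exact/zigzags_ofE.
Qed.

Lemma template_word_lang ls : block_lang bl ls -> lang t (template_word ls).
Proof.
move=> bls; rewrite (parsed_join P); apply/lang_cat; exists (flange_word b), (block_word bl ls).
by split=> //; [exact: lang_flange|exact: block_lang_lang].
Qed.

Lemma template_word_exists x : lang t x -> ~ template_ideal t (Some x) ->
  exists2 ls, block_lang bl ls & x = template_word ls.
Proof.
move=> tx nJ; have [|/template_idealE//] := lang_flang (size_flags t) (flags_finite t) tx.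
rewrite (parsed_flags P) (parsed_join P) => /flang_true[z /flang_blocks[ls bls ->] ->].
by exists ls.
Qed.

Lemma deficient_template_word z : deficient (jflags bl) (join bl) z ->
  template_ideal t (Some (flange_word b ++ z)).
Proof.
move=> dz; apply/template_idealE; rewrite (parsed_flags P) (parsed_join P).
by apply: deficient_cat; rewrite ?size_nseq//; exact: lang_flange.
Qed.

Lemma template_word_uniq ls ls' : block_lang bl ls -> block_lang bl ls' ->
    template_word ls = template_word ls' ->
  ~ template_ideal t (Some (template_word ls)) -> ls = ls'.
Proof.
move=> bls bls' /eqP; rewrite eqseq_cat// eqxx /= => /eqP e nJ.
apply: block_word_uniq bls bls' e _; first exact: (parsed_sections_ok P).1.
by move=> /deficient_template_word.
Qed.

Lemma decompose_template_word ls : block_lang bl ls ->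
    ~ template_ideal t (Some (template_word ls)) ->
  decompose t (template_word ls) = ls.
Proof.
move=> bls nJ; rewrite /decompose; case: xgetP => [l _ /decompositionE[bl_l e]|/(_ ls)[]].
  by apply/esym/template_word_uniq.
exact/decompositionE.
Qed.

Lemma insertion_template_word x ls : block_lang bl ls -> insertion x (template_word ls) ->
    ~ template_ideal t (Some x) ->
  exists l, [/\ block_lang bl l, x = template_word l & ls \in block_insertions l].
Proof.
move=> bls /insertion_cat[[z iz ->]|[z iz ->]] nJ.
  exfalso; apply: nJ; apply/template_idealE.
  have [u [c [v [k [bE ck uz]]]]] := insertion_flange (parsed_flange_ok P) iz.
  rewrite (parsed_flags P) (parsed_join P) -(cat0s z) -[_ ++ block_word bl ls]catA.
  apply: (@deficient_flange [::] b (jflags bl) (join bl) u c v k) => //.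
  rewrite -cat_cons catA; apply/lang_cat; exists z, (block_word bl ls).
  by split=> //; exact: block_lang_lang.
have [[l [bll -> lb]]|/deficient_template_word//] := insertion_block_word (parsed_sections_ok
    P).1 bls iz.
by exists l.
Qed.

Lemma template_word_insertion ls l : size ls = size bl -> l \in block_insertions ls ->
    insertion (template_word ls) (template_word l).
Proof. by move=> sl lb; apply: insertion_catl; exact: block_word_insertion. Qed.

Lemma num_inf_parsed : num_inf t = num_inf (join bl).
Proof. by rewrite (parsed_join P) num_inf_cat (num_inf_flange (parsed_flange_ok P)). Qed.

Lemma full_word_parsed n : size n = num_inf t -> full_word t n = template_word (full_parts bl n).
Proof.
move=> sn; rewrite (parsed_join P) full_word_flange_cat ?(parsed_flange_ok P)//.
rewrite full_word_join -?num_inf_parsed//; exact: parsed_sections_ok P.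
Qed.

Section Phi.
Context (R : realType).
Local Open Scope ring_scope.
Implicit Types w : seq R.

Lemma block_intervals_values u w ls bl' : sections_ok bl' -> size ls = size bl' ->
  \prod_(i < size (block_intervals (size u) bl'))
    Fsum (nth [::] ls i) (oriented_weights (u ++ join bl') w (nth (0,
        0)%N (block_intervals (size u) bl') i)) =
  block_value bl' (drop (num_inf u) w) ls.
Proof.
elim: bl' u ls => [|p bl' IH] u [|x ls] //; first by rewrite big_ord0.
move=> /sections_ok_cons[f2 _ ok] [sl];
    rewrite [block_intervals _ _]/= big_ord_recl [block_value _ _ _]/=.
congr (_ * _).
  rewrite Fsum_zigzag_sum /oriented_weights /= take_size_cat// join_cons /slice /=.
  rewrite catA takel_cat ?size_cat// take_oversize ?size_cat// drop_size_cat//.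
have := IH (u ++ p.1 ++ p.2) ls ok sl.
rewrite join_cons !num_inf_cat (num_inf_flange f2) addn0 !size_cat addnA drop_drop [(num_inf p.1
    + _)%N]addnC -!catA.
exact.
Qed.

Lemma phi_template_word w (x : template_graph t) ls : block_lang bl ls ->
    val x = Some (template_word ls) ->
  ~ template_ideal t (Some (template_word ls)) -> phi w x = (block_value bl w ls)%:E.
Proof.
move=> bls xE nJ; rewrite /phi ifF; last first.
  by rewrite xE; apply/negP => /set_mem.
rewrite xE /= decompose_template_word// (parsed_intervals P) (parsed_join P).
rewrite block_intervals_values ?(block_lang_size bls)//; last exact: parsed_sections_ok P.
by rewrite (num_inf_flange (parsed_flange_ok P)) drop0.
Qed.

End Phi.
End Parsed.
End ParsedTemplate.

(** * The graph Z(t) in terms of words *)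

Section TemplateGraph.
Context (R : realType) (t : seq signed_cluster).
Implicit Types (y z : word) (n : seq nat).
Local Notation G := (template_graph t).

Definition empty_vertex : G := exist _ (None : zigzag_graph) (mem_set (I : zigzags_of t None)).

(* The vertex with binary word [y]; the empty zigzag if [y] is not in Z(t). *)
Definition word_vertex y : G := insubd empty_vertex (Some y : zigzag_graph).

Lemma vertE y : lang t y -> val (word_vertex y) = Some y.
Proof. by move=> ty; rewrite val_insubd ifT//; apply/mem_set/zigzags_ofE. Qed.

Lemma val_word_vertex (x : G) y : val x = Some y -> lang t y /\ x = word_vertex y.
Proof.
move=> xy; have ty : lang t y by apply/zigzags_ofE; rewrite -xy; exact/set_mem/valP.
by split=> //; apply: val_inj; rewrite vertE.
Qed.

Lemma word_vertex_inj y z : lang t y -> lang t z -> word_vertex y = word_vertex z -> y = z.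
Proof. by move=> ty tz /(congr1 val); rewrite !vertE// => -[]. Qed.

Lemma edge_word_vertex y z : lang t y -> lang t z -> edge (word_vertex y) (word_vertex z) <->
    insertion y z.
Proof.
by move=> ty tz; rewrite /edge /= /sub_edge !vertE//; exact: zigzag_edgeP.
Qed.

Lemma edge_word_vertex_l y (x : G) : lang t y -> edge (word_vertex y) x ->
    exists2 z, lang t z & x = word_vertex z.
Proof.
move=> ty; rewrite /edge /= /sub_edge vertE//; case xE : (val x) => [z|] //.
by have [tz ->] := val_word_vertex xE; exists z.
Qed.

Local Open Scope ereal_scope.

Lemma upper_word_vertex (f : G -> \bar R) y : lang t y ->
  \sum_(x <- upper_seq (word_vertex y)) f x =
      \sum_(z <- word_uppers y | `[< lang t z >]) f (word_vertex z).
Proof.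
move=> ty; rewrite -[RHS]big_filter -(big_map word_vertex xpredT f).
apply: perm_big; apply: uniq_perm; first exact: uniq_upper_seq.
  rewrite map_inj_in_uniq ?filter_uniq ?uniq_word_uppers// => z z'.
  by rewrite !mem_filter => /andP[/asboolP tz _] /andP[/asboolP tz' _]; exact: word_vertex_inj.
move=> x; rewrite mem_upper_seq; apply/idP/mapP => [yx|[z]].
  have [z tz xz] := edge_word_vertex_l ty yx; exists z => //.
  by rewrite mem_filter asboolT//=; apply/mem_word_uppers/edge_word_vertex => //; rewrite -xz.
rewrite mem_filter => /andP[/asboolP tz /mem_word_uppers yz] ->; exact/edge_word_vertex.
Qed.

Lemma upper_empty (f : G -> \bar R) : \sum_(x <- upper_seq empty_vertex) f x = f (word_vertex [::]).
Proof.
transitivity (\sum_(x <- [:: word_vertex [::]]) f x); last by rewrite big_seq1.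
apply: perm_big; apply: uniq_perm => //.
  exact: uniq_upper_seq.
have t0 : lang t [::] by exact: lang_nil.
move=> x; rewrite mem_upper_seq inE /edge /= /sub_edge; case xE : (val x) => [z|].
  have [tz ->] := val_word_vertex xE; rewrite /=.
  by apply/eqP/eqP => [->|/word_vertex_inj -> //].
by apply/esym/negbTE/eqP => xv; rewrite xv vertE in xE.
Qed.

(** Harmonicity distributes [f] over the upper neighbours of [y]; each word of [s] lies above at
    least one of them, so it is counted at least once. *)
Lemma sum_above (f : G -> \bar R) k y (s : seq word) : harmonic_function f ->
  uniq s -> (forall z, z \in s -> [/\ lang t z, size z = (k + size y)%N & subseq y z]) ->
  \sum_(z <- s) f (word_vertex z) <= f (word_vertex y).
Proof.
move=> fh; have f0 := fh.1; elim: k y s => [|k IH] y s us sP.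
  have sy : {subset s <= [:: y]}.
    move=> z /sP[_ sz yz]; rewrite inE; apply/eqP/esym/eqP.
    by rewrite -(size_subseq_leqif yz) sz.
  case: s us sP sy => [|z [|z' s]] us sP sy; first by rewrite big_nil.
    by rewrite big_seq1; have := sy z; rewrite !inE eqxx => /(_ isT)/eqP ->.
  have := sy z; have := sy z'; rewrite !inE !eqxx !orbT => /(_ isT)/eqP z'y /(_ isT)/eqP zy.
  by move: us; rewrite z'y zy /= inE eqxx.
case: s us sP => [|z0 s0]; first by rewrite big_nil.
set s := z0 :: s0 => us sP.
have ty : lang t y by have [tz _ yz] := sP z0 (mem_head _ _); exact: lang_subseq yz tz.
rewrite [leRHS]fh.2 upper_sumE upper_word_vertex//.
apply: (@le_trans _ _ (\sum_(z <- word_uppers y | `[< lang t z >])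
    \sum_(v <- s | subseq z v) f (word_vertex v))); last first.
  rewrite [leLHS]big_seq_cond [leRHS]big_seq_cond; apply: lee_sum => z /andP[/mem_word_uppers yz _].
  rewrite -big_filter; apply: IH; first exact: filter_uniq.
  move=> v; rewrite mem_filter => /andP[zv /sP[tv sv yv]]; split=> //.
  by rewrite sv (insertion_size yz) addSnnS.
rewrite (exchange_big_dep xpredT)//= [leLHS]big_seq [leRHS]big_seq.
apply: lee_sum => v /sP[tv sv yv].
have [|z yz zv] := subseq_insertion yv; first by rewrite sv addSn ltnS leq_addl.
have zu : z \in word_uppers y by apply/mem_word_uppers.
have tz := lang_subseq zv tv; rewrite (big_rem z zu)/= zv asboolT//=.
by rewrite leeDl// sume_ge0.
Qed.

Lemma harmonic_subseq (f : G -> \bar R) y z : harmonic_function f -> lang t z ->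
  subseq y z -> f (word_vertex z) <= f (word_vertex y).
Proof.
move=> fh tz yz; have := @sum_above f (size z - size y) y [:: z] fh isT.
rewrite big_seq1; apply=> v; rewrite inE => /eqP ->; split=> //.
by rewrite subnK// size_subseq.
Qed.

Definition full_vertex n : G := word_vertex (full_word t n).

Lemma embedded_full_vertex : alternating t -> all cluster_wf t ->
    embedded_lattice (num_inf t) full_vertex.
Proof.
move=> at_ wf; split=> [n n'|n nm x].
  rewrite !inE => /eqP sn /eqP sn' /word_vertex_inj e; apply: (full_word_inj at_ wf sn sn');
      apply: e;
  exact: lang_full_word.
have tn : lang t (full_word t n) by exact: lang_full_word.
split=> [gx|[j jm ->]].
  have [z tz xz] := edge_word_vertex_l tn gx; rewrite xz in gx *.
  have [j jm ->] := full_word_upper at_ wf nm tz ((edge_word_vertex tn tz).1 gx).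
  by exists j.
apply/edge_word_vertex => //; first exact: lang_full_word.
exact: full_word_insertion.
Qed.

Lemma harmonic_le_empty (f : G -> \bar R) : harmonic_function f ->
    f (word_vertex [::]) <= f empty_vertex.
Proof. by move=> fh; rewrite [leRHS]fh.2 upper_sumE upper_empty. Qed.

End TemplateGraph.

(** * phi off the ideal: positivity, harmonicity and lattice values *)

Section GrowthModelFunction.
Context (R : realType) (t : seq signed_cluster).
Hypothesis st : semifinite_template t.
Notation block := (seq signed_cluster * seq signed_cluster)%type.
Implicit Types (y z : word) (n : seq nat) (ls : seq word).

Let tt : is_template t. Proof. by case/andP: st. Qed.
Let wft : all cluster_wf t. Proof. by case/and3P: tt. Qed.
Let altt : alternating t. Proof. by case/and3P: tt. Qed.

Lemma none_in_ideal : template_ideal t None.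
Proof.
case/andP: st => tt'; rewrite /finite_template tt' /= => /allPn[i _].
by rewrite negbK => ni; exists i.
Qed.

Lemma fits_full_mults_le u s k k' v n :
  fits_all (full_mults (u ++ (s, Some k) :: v) n) (u ++ (s, Some k') :: v) -> k <= k'.
Proof.
elim: u n => [|[s' [k2|]] u IH] n /=; first by case/andP.
  by move=> /andP[_ /IH].
by move=> /= /IH.
Qed.

(** The exponents of a full word are forced by [run_unique], so the lowered cluster would have to
    hold [k] symbols with multiplicity [k - 1]. *)
Lemma full_word_not_ideal n : ~ template_ideal t (Some (full_word t n)).
Proof.
move=> /template_idealE[u [[s k0] [v [k [tE _ /= k0E /langP[l fl e]]]]]].
rewrite {}k0E in tE.
have sr : size (u ++ (s, Some k.-1) :: v) = size t by rewrite tE !size_cat.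
have [|_ _ lE] := run_unique altt (size_full_mults t n) (full_mults_gt0 n wft) (fits_all_size fl)
    (esym e).
  by rewrite sr.
rewrite lE tE in fl; have := fits_full_mults_le fl.
move: wft; rewrite tE all_cat => /andP[_ /andP[]].
by case: k {tE fl lE e sr} => //= k _ _; rewrite ltnn.
Qed.

Context (b : seq signed_cluster) (bl : seq block).
Hypothesis P : parsed t b bl.

Let ok := parsed_sections_ok P.

Section Weights.
Context (w : seq R).
Hypotheses (sw : size w = num_inf t) (w0 : all (fun a => 0 < a)%R w) (w1 : (\sum_(a <- w) a = 1)%R).

Let swb : size w = num_inf (join bl). Proof. by rewrite sw (num_inf_parsed P). Qed.

Local Open Scope ereal_scope.

Lemma phi_ideal (x : template_graph t) : template_ideal t (val x) -> phi w x = +oo.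
Proof. by move=> xJ; rewrite /phi ifT//; exact/mem_set. Qed.

Lemma phi_word_vertex ls : block_lang bl ls -> ~ template_ideal t (Some (template_word b bl ls)) ->
  phi w (word_vertex t (template_word b bl ls)) = (block_value bl w ls)%:E.
Proof.
move=> bls nJ; apply: (phi_template_word P) => //; apply: vertE; exact: (template_word_lang P).
Qed.

Lemma not_ideal_template_word (x : template_graph t) : ~ template_ideal t (val x) ->
  exists ls, [/\ block_lang bl ls, x = word_vertex t (template_word b bl ls) &
    ~ template_ideal t (Some (template_word b bl ls))].
Proof.
case xE : (val x) => [y|] nJ; last by case: nJ; exact: none_in_ideal.
have [ty ->] := val_word_vertex xE; have [ls bls yE] := template_word_exists P ty nJ.
by exists ls; rewrite -yE.
Qed.

Lemma phi_fin_not_ideal (x : template_graph t) : phi w x < +oo -> ~ template_ideal t (val x).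
Proof. by move=> + /phi_ideal => /[swap] ->. Qed.

Lemma phi_gt0 (x : template_graph t) : 0 < phi w x.
Proof.
have [/phi_ideal ->//|/not_ideal_template_word[ls [bls ->
    nJ]]] := pselect (template_ideal t (val x)).
by rewrite phi_word_vertex// lte_fin (block_value_gt0 ok swb w0 bls).
Qed.

(** Off the ideal the upper neighbours in Z(t) correspond to insertions into a single part that stay
    in the language of its section. The other insertions have value 0, so the Leibniz rule applies
    with total weight 1. *)
Lemma phi_harmonic_fin (x : template_graph t) : phi w x < +oo ->
  phi w x = \sum_(y <- upper_seq x) phi w y.
Proof.
move=> /phi_fin_not_ideal/not_ideal_template_word[ls [bls -> nJ]].
have sl := block_lang_size bls; have tls := template_word_lang P bls.
rewrite phi_word_vertex// upper_word_vertex// -[RHS]big_filter.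
have nJ' l : l \in block_insertions ls -> ~ template_ideal t (Some (template_word b bl l)).
  move=> lb lJ; apply: nJ; apply: template_ideal_subseq lJ.
  by apply: insertion_subseq; exact: template_word_insertion.
transitivity (\sum_(z <- [seq template_word b bl l | l <- [seq l <- block_insertions ls | `[<
    block_lang bl l >]]]) phi w (word_vertex t z)).
  rewrite big_map big_filter.
  rewrite (_ : \sum_(l <- block_insertions ls | _) _ =
      \sum_(l <- block_insertions ls | `[< block_lang bl l >]) (block_value bl w l)%:E).
    rewrite sumEFin; congr EFin; rewrite -[LHS]mul1r -w1 -block_value_harmonic//.
    rewrite [LHS](bigID (fun l => `[< block_lang bl l >])) /= [X in (_ + X)%R = _]big_seq_cond.
    rewrite [X in (_ + X)%R = _]big1 ?addr0// => l /andP[lb /asboolPn nl].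
    by apply: block_value_out => //; rewrite (size_block_insertions lb).
  rewrite big_seq_cond [RHS]big_seq_cond; apply: eq_bigr => l /andP[lb /asboolP bl_l].
  by rewrite phi_word_vertex//; exact: nJ'.
apply: perm_big; apply: uniq_perm.
- rewrite map_inj_in_uniq ?filter_uniq ?uniq_block_insertions// => l l'; rewrite !mem_filter.
  move=> /andP[/asboolP bl_l lb] /andP[/asboolP bl_l' lb'] e.
  by apply: (template_word_uniq P) => //; exact: nJ'.
- by rewrite filter_uniq// uniq_word_uppers.
move=> z; rewrite mem_filter; apply/mapP/andP => [[l]|[/asboolP tz /mem_word_uppers yz]].
  rewrite mem_filter => /andP[/asboolP bl_l lb] ->.
  by rewrite asboolT; [split=> //; apply/mem_word_uppers;
      exact: template_word_insertion|exact: (template_word_lang P)].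
have nJz : ~ template_ideal t (Some z).
  by move=> zJ; apply: nJ; apply: template_ideal_subseq zJ; exact: insertion_subseq.
have [l bl_l zE] := template_word_exists P tz nJz; rewrite {}zE in tz yz nJz *.
exists l => //; rewrite mem_filter asboolT//=.
have [ls' [bls' e lb]] := insertion_template_word P bl_l yz nJ.
by rewrite (template_word_uniq P bls bls' e nJ).
Qed.

Lemma phi_lattice : exists2 C : R, (0 < C)%R &
  forall n, size n = num_inf t -> phi w (full_vertex t n) = (C * monomial_value w n)%:E.
Proof.
have [C CE] := block_value_full_parts ok swb.
have e n : size n = num_inf t -> phi w (full_vertex t n) = (C * monomial_value w n)%:E.
  move=> sn; have nJ := @full_word_not_ideal n; rewrite /full_vertex; move: nJ;
      rewrite (full_word_parsed P sn) => nJ.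
  by rewrite phi_word_vertex ?CE// -?(num_inf_parsed P)//; exact: block_lang_full_parts.
exists C => //; have := phi_gt0 (full_vertex t (nseq (num_inf t) 0%N)).
by rewrite e ?size_nseq// lte_fin pmulr_lgt0// monomial_value_gt0.
Qed.

Lemma monomial_value_incr n j : size n = size w -> (j < size w)%N ->
  monomial_value w (incr_nth n j) = (nth 0%R w j * monomial_value w n)%R.
Proof.
elim: w n j => [|a w' IH] [|k n] // [|j] //= [sn] jw; first by rewrite exprS mulrA.
by rewrite IH//; ring.
Qed.

End Weights.
End GrowthModelFunction.

(** * Templates with one flange symbol removed *)

Section DecreasedTemplate.
Implicit Types (t u v r : seq signed_cluster) (n l : seq nat).

Lemma alternating_signs t r : map fst t = map fst r -> alternating t = alternating r.
Proof.
have E q : alternating q = sorted (fun a b : bool => a != b) (map fst q) by rewrite sorted_map.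
by rewrite !E => ->.
Qed.

Lemma full_mults_cat t1 t2 n : full_mults (t1 ++ t2) n =
    full_mults t1 n ++ full_mults t2 (drop (num_inf t1) n).
Proof.
elim: t1 n => [|[s [k|]] t1 IH] n /=; rewrite ?drop0 ?IH//.
by rewrite -drop1 drop_drop /num_inf /= addnC.
Qed.

Lemma powers_cat t1 t2 l1 l2 : size l1 = size t1 ->
  cluster_powers (t1 ++ t2) (l1 ++ l2) = cluster_powers t1 l1 ++ cluster_powers t2 l2.
Proof. by move=> sl; rewrite /cluster_powers zip_cat// map_cat flatten_cat. Qed.

(** The two clusters form one run, whose length is the sum of their exponents. One of them is
    finite, so its exponent is constant and the sum determines the other. *)
Lemma full_word_merge_inj u c1 c2 v n n' : c1.1 = c2.1 ->
  ~~ (infinite_cluster c1 && infinite_cluster c2) ->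
  alternating (u ++ c1 :: v) -> all cluster_wf (u ++ [:: c1, c2 & v]) ->
  size n = num_inf (u ++ [:: c1, c2 & v]) -> size n' = num_inf (u ++ [:: c1, c2 & v]) ->
  full_word (u ++ [:: c1, c2 & v]) n = full_word (u ++ [:: c1, c2 & v]) n' -> n = n'.
Proof.
move=> c12 fin at_ wf sn sn' e; apply: (full_mults_inj sn sn').
have [A [B [L [E AB]]]] : exists (A B : seq nat -> nat) (L : seq nat -> seq nat),
    (forall q, full_mults [:: c1, c2 & v] q = [:: A q, B q & L q]) /\
    ((forall q q', A q = A q') \/ (forall q q', B q = B q')).
  case: c1 c2 fin {c12 at_ wf sn sn' e} => s1 [k1|] [s2 [k2|]] //= _.
  - by exists (fun=> k1), (fun=> k2), (full_mults v); split=> //; left.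
  - by exists (fun=> k1), (fun q => (head 0 q).+1), (fun q => full_mults v (behead q));
      split=> //; left.
  - by exists (fun q => (head 0 q).+1), (fun=> k2), (fun q => full_mults v (behead q));
      split=> //; right.
have merged q : full_word (u ++ [:: c1, c2 & v]) q =
    cluster_powers (u ++ c1 ::
        v) (full_mults u q ++ A (drop (num_inf u) q) + B (drop (num_inf u) q) ::
        L (drop (num_inf u) q)).
  rewrite /full_word full_mults_cat E !powers_cat ?size_full_mults//; congr (_ ++ _).
  by rewrite /cluster_powers /= -c12 nseqD catA.
have sL q : size (L q) = size v by have := size_full_mults [:: c1, c2 & v] q; rewrite E => -[].
have sm q : size (full_mults u q ++ A (drop (num_inf u) q) + B (drop (num_inf u) q) ::
    L (drop (num_inf u) q)) =
    size (u ++ c1 :: v) by rewrite !size_cat /= sL size_full_mults.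
have pm q : all (leq 1) (full_mults u q ++ A (drop (num_inf u) q) + B (drop (num_inf u) q) ::
    L (drop (num_inf u) q)).
  have := full_mults_gt0 q wf; rewrite full_mults_cat E !all_cat /= => /and4P[-> A0 _ ->].
  by rewrite andbT ltn_addr.
move: e; rewrite !merged => e.
have [_ _ /eqP] := run_unique at_ (sm n') (pm n') (sm n) e (leqnn _).
rewrite eqseq_cat ?size_full_mults// => /andP[/eqP eu] /eqP[eAB eL].
rewrite !full_mults_cat !E eu eL; move: eAB.
by case: AB => AB; rewrite (AB _ (drop (num_inf u) n')) => /eqP;
    rewrite ?eqn_add2l ?eqn_add2r => /eqP ->.
Qed.

Lemma alternating_skip2 u c1 c c2 v : c1.1 = c2.1 ->
  alternating (u ++ [:: c1, c, c2 & v]) -> alternating (u ++ c1 :: v).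
Proof.
have E q : alternating q = sorted (fun a b : bool => a != b) (map fst q) by rewrite sorted_map.
rewrite !E !map_cat /= => ->; case: (map fst u) => [|a su] /=; first by case/and3P.
by rewrite !cat_path /= => /and5P[-> -> _ _ ->].
Qed.

Lemma separating_between u c1 s c2 v :
  separating (u ++ [:: c1, (s, Some 1), c2 & v]) (size u).+1 =
  infinite_cluster c1 && infinite_cluster c2.
Proof.
have e2 : (size u).+2 - size u = 2 by lia.
rewrite /separating !nth_cat ltnn subnn !ltnNge leqnSn /= subSnn e2 (ltnW (leqnSn _)) /=.
by rewrite size_cat (_ : _ <= _ = false)//=; apply/negbTE; rewrite -ltnNge /=; lia.
Qed.

(** Only an inner cluster of multiplicity 1 is delicate: its neighbours, of equal sign, become one
    run. They are not both infinite precisely because the cluster is not separating. *)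
Lemma full_word_decreased_inj u s k v n n' (t := u ++ (s, Some k) :: v)
    (r := u ++ (s, Some k.-1) :: v) : is_template t -> nonseparating_finite t (size u) ->
  size n = num_inf t -> size n' = num_inf t -> full_word r n = full_word r n' -> n = n'.
Proof.
move=> /and3P[wf at_ _] ns sn sn'; have nr : num_inf t = num_inf r by rewrite /t /r !num_inf_cat.
rewrite nr in sn sn'; rewrite /t in wf at_ ns; rewrite /r {t r nr} in sn sn' *.
case: k wf at_ ns sn sn' => [|[|k]] /= wf at_ ns sn sn'.
- by move: wf; rewrite all_cat => /andP[_].
- have e0 q : full_word (u ++ (s, Some 0) :: v) q = full_word (u ++ v) q.
    by rewrite /full_word !full_mults_cat !powers_cat ?size_full_mults.
  have e1 : num_inf (u ++ (s, Some 0) :: v) = num_inf (u ++ v) by rewrite !num_inf_cat.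
  rewrite !e0 e1 {e0 e1} in sn sn' *.
  have wf' : all cluster_wf (u ++ v) by move: wf; rewrite !all_cat /= => /andP[-> ->].
  case/lastP: u wf wf' at_ ns sn sn' => [|u c1] wf wf' at_ ns sn sn'.
    by apply: full_word_inj => //; move: at_; rewrite /alternating /=; exact: path_sorted.
  case: v wf wf' at_ ns sn sn' => [|c2 v] wf wf' at_ ns sn sn'.
    rewrite cats0 in wf' sn sn' *; apply: full_word_inj => //.
    by move: at_; rewrite /alternating => /cat_sorted2[].
  rewrite cat_rcons in wf' sn sn' *; rewrite cat_rcons in at_ wf ns.
  have /andP[cs sc] : (c1.1 != s) && (s != c2.1).
    by move: at_; rewrite /alternating => /cat_sorted2[_ /=] /and3P[-> ->].
  have c12 : c1.1 = c2.1 by move: cs sc; case: (c1.1) (c2.1) (s) => -[] [].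
  apply: full_word_merge_inj => //; last first.
    exact: alternating_skip2 at_.
  by move: ns; rewrite size_rcons /nonseparating_finite separating_between => /and3P[].
- have wf' : all cluster_wf (u ++ (s, Some k.+1) :: v).
    by move: wf; rewrite !all_cat /= => /andP[-> ->].
  apply: full_word_inj => //; rewrite -(@alternating_signs (u ++ (s, Some k.+2) :: v))//.
  by rewrite !map_cat.
Qed.

End DecreasedTemplate.

(** * phi as the least extension of its lattice values *)

Section PhiIsExtension.
Context (R : realType) (t : seq signed_cluster).
Hypothesis st : semifinite_template t.
Notation block := (seq signed_cluster * seq signed_cluster)%type.
Implicit Types (y z : word) (n : seq nat) (ls : seq word).

Let tt : is_template t. Proof. by case/andP: st. Qed.
Let wft : all cluster_wf t. Proof. by case/and3P: tt. Qed.
Let altt : alternating t. Proof. by case/and3P: tt. Qed.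

Local Open Scope ereal_scope.

(* Every member of the ideal lies below words [full_word r n] lacking a single flange
   symbol; each such word has the word [full_word t n] outside the ideal above it, next
   to the words [full_word r (n + e_j)], so its value exceeds every multiple of [a n]. *)
Lemma ideal_infinite (psi : template_graph t -> \bar R) (a : seq nat -> R) (x : template_graph t) :
  harmonic_function psi -> (forall n, size n = num_inf t -> psi (full_vertex t n) = (a n)%:E) ->
  (forall n, size n = num_inf t -> (0 < a n)%R) -> lattice_harmonic (num_inf t) a ->
  template_ideal t (val x) -> psi x = +oo.
Proof.
move=> ph pa a0 ah xJ.
have [y [ty yJ yx]] : exists y, [/\ lang t y,
    template_ideal t (Some y) & psi (word_vertex t y) <= psi x].
  case xE : (val x) => [y|]; first by have [ty xv] := val_word_vertex xE; exists y; rewrite -xE -xv.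
  exists [::]; split; first exact: lang_nil.
    by have [i ni _] := none_in_ideal st; exists i => //; apply/zigzags_ofE; exact: lang_nil.
  suff -> : x = empty_vertex t by exact: harmonic_le_empty.
  exact: val_inj.
suff : psi (word_vertex t y) = +oo by move=> yoo; apply/eqP; rewrite -leye_eq -yoo.
have /template_idealE[u [[s k0] [v [k [tE fu /= k0E uy]]]]] := yJ; rewrite {}k0E in tE.
have ns : nonseparating_finite t (size u).
  move: fu; rewrite (nth_map 0%N) ?size_iota ?nth_iota//; rewrite tE size_cat /=; lia.
set r := u ++ (s, Some k.-1) :: v in uy.
have nr : num_inf r = num_inf t by rewrite /r tE !num_inf_cat.
have kgt0 : (0 < k)%N.
  by move: wft; rewrite tE all_cat /= => /and3P[_ + _]; case: (k).
have rt z : lang r z -> lang t z.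
  rewrite tE /r !lang_cat => -[z1 [z2 [uz1 [i [z3 [ik vz3 ->]]] ->]]].
  exists z1, (nseq i s ++ z3); split=> //; exists i, z3; split=> //.
  by move: ik; rewrite /fits_multiplicity /=; lia.
have rJ z : lang r z -> template_ideal t (Some z).
  move=> rz; apply/template_idealE; exists u, (s, Some k), v, k; split=> //.
have rins n : insertion (full_word r n) (full_word t n).
  rewrite /full_word tE /r !full_mults_cat !powers_cat ?size_full_mults//; apply: insertion_catl.
  rewrite /cluster_powers /=; apply: insertion_catr; rewrite -{2}(prednK kgt0);
      exact: insertion_cons.
have [n0 sn0 yn0] := lang_full_word_dom uy.
have key M n : size n = num_inf t -> (M%:R * a n)%:E <= psi (word_vertex t (full_word r n)).
  elim: M n => [|M IH] n sn; first by rewrite mul0r ph.1.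
  (* The words built on [r] contribute [M * a n] by induction and harmonicity of [a]; the full word
     of [t], distinct from them because it avoids the ideal, adds one more [a n]. *)
  pose L := full_word t n :: [seq full_word r (incr_nth n j) | j <- iota 0 (num_inf t)].
  have := @sum_above _ _ psi 1 (full_word r n) L ph.
  rewrite big_cons big_map; set S := \sum_(j <- _) _.
  have aS : (M%:R * a n)%:E <= S.
    have -> : S = \sum_(j < num_inf t) psi (word_vertex t (full_word r (incr_nth n j))).
      rewrite -(big_mkord xpredT (fun j => psi (word_vertex t (full_word r (incr_nth n j))))).
      by rewrite /index_iota subn0.
    rewrite ah// mulr_sumr -sumEFin.
    by apply: lee_sum => j _; apply: IH; rewrite size_incr_nth sn ltn_ord.
  move=> h; apply: le_trans (h _ _); last first.
  - move=> z; rewrite inE => /predU1P[->|/mapP[j]].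
      by split; [exact: lang_full_word|exact: insertion_size (rins n)|exact: insertion_subseq].
    rewrite mem_iota add0n => /= jt ->; have i := @full_word_insertion r n j.
    rewrite nr in i; split; [by apply: rt; exact: lang_full_word|exact: insertion_size (i _ _)|].
    exact: insertion_subseq (i _ _).
  - rewrite /= map_inj_in_uniq ?iota_uniq ?andbT => [|i j].
      apply/mapP => -[j _ e]; apply: (@full_word_not_ideal t st n); rewrite e.
      by apply: rJ; exact: lang_full_word.
    rewrite !mem_iota !add0n => /= it jt e; apply: (@incr_nth_inj n).
    move: (@full_word_decreased_inj u s k v (incr_nth n i) (incr_nth n j)); rewrite /= -tE.
    by apply => //; rewrite size_incr_nth sn ?it ?jt.
  - rewrite -/(full_vertex t n) pa//; apply: le_trans (leeD (lexx _) aS).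
    by rewrite -EFinD lee_fin -natr1 mulrDl mul1r addrC.
have le0 : psi (word_vertex t (full_word r n0)) <= psi (word_vertex t y).
  by apply: harmonic_subseq => //; apply: rt; exact: lang_full_word.
rewrite nr in sn0; apply: eq_infty => c.
apply: le_trans le0; apply: le_trans (key (Num.truncn (c / a n0)).+1 n0 sn0).
by rewrite lee_fin -ler_pdivrMr ?a0// ltW// truncnS_gt.
Qed.

Context (w : seq R).
Hypotheses (sw : size w = num_inf t) (w0 : all (fun a => 0 < a)%R w) (w1 : (\sum_(a <- w) a = 1)%R).

Lemma sum_weights : (\sum_(j < num_inf t) nth 0 w j = 1)%R.
Proof. by rewrite -w1 -sw (big_nth 0%R) big_mkord. Qed.

Lemma weights_gt0 j : (j < num_inf t)%N -> (0 < nth 0 w j)%R.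
Proof. by move=> jt; apply: (allP w0); rewrite mem_nth// sw. Qed.

Lemma phi_is_extension : exists a : seq nat -> R,
  [/\ forall n, size n = num_inf t -> (0 < a n)%R,
      multiplicative_on (num_inf t) (nth 0%R w) a,
      forall n, size n = num_inf t -> phi w (full_vertex t n) = (a n)%:E &
      @phi R t w = lattice_ext (num_inf t) (full_vertex t) a].
Proof.
have [b [bl P]] := parse_exists tt.
have [C C0 CE] := phi_lattice st P sw w0.
pose a n := (C * monomial_value w n)%R.
have a0 n : size n = num_inf t -> (0 < a n)%R by move=> _; rewrite mulr_gt0// monomial_value_gt0.
have a00 n : size n = num_inf t -> (0 <= a n)%R by move=> /a0/ltW.
have am : multiplicative_on (num_inf t) (nth 0%R w) a.
  by move=> n j sn jt; rewrite /a monomial_value_incr ?sw//; ring.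
have ah := multiplicative_harmonic sum_weights am.
have gL := @embedded_full_vertex t altt wft.
have phi0 x : 0 <= @phi R t w x by apply: ltW; exact: (phi_gt0 st P sw w0 x).
have fh := phi_harmonic_fin st P sw w1.
have ph := lattice_ext_harmonic gL a00 ah.
have pa := lattice_ext_lattice gL ah.
exists a; split=> //; apply/funext => x; apply/esym.
have [xJ|xnJ] := pselect (template_ideal t (val x)).
  by rewrite (phi_ideal _ xJ); exact: (ideal_infinite ph pa).
have xfin : phi w x < +oo.
  have [ls [bls -> nJ]] := not_ideal_template_word st P xnJ.
  by rewrite (phi_word_vertex P) ?ltry.
apply: (lattice_ext_eq gL a00 ah phi0 CE fh C0 _ xfin) => {xnJ xfin}x.
move=> /(phi_fin_not_ideal)/(not_ideal_template_word st P)[ls [bls -> nJ]].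
rewrite (phi_word_vertex P)// (block_value_splits (parsed_sections_ok P) (block_lang_size bls));
    last first.
  by rewrite sw (num_inf_parsed P).
pose s := block_splits bl ls.
have sz n : n \in s -> size n = num_inf t.
  move=> ns; rewrite (num_inf_parsed P).
  exact: (size_block_splits (parsed_sections_ok P) (block_lang_size bls) ns).
(* The comparison constant is [C]: phi here is the sum of the monomials of all splittings, while the
   extension has the value [C] times the monomial at each full word. These full words are distinct,
   lie above the given word, and share a level, so the head of [s] can stand for any of them. *)
have key := @sum_above R t _ (size (full_word t (head [::] s)) - size (template_word b bl ls))
  (template_word b bl ls) [seq full_word t n | n <- s] ph.
apply: le_trans (key _ _).
- rewrite big_map -EFinM mulr_sumr -sumEFin [leLHS]big_seq [leRHS]big_seq.
  by apply: lee_sum => n ns; rewrite -/(full_vertex t n) pa ?sz.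
- rewrite map_inj_in_uniq ?uniq_block_splits// => n n' /sz sn /sz sn'; exact: full_word_inj.
- move=> _ /mapP[n ns ->].
  have sub n' : n' \in s -> subseq (template_word b bl ls) (full_word t n').
    move=> n's; rewrite (parsed_join P) full_word_flange_cat ?(parsed_flange_ok P)//.
    apply: cat_subseq => //.
    exact: (block_splits_subseq (parsed_sections_ok P) (block_lang_size bls) n's).
  split; [exact: lang_full_word| |exact: sub].
  have hs : head [::] s \in s by case: (s) ns => //= ? ? _; rewrite mem_head.
  rewrite subnK ?size_subseq ?sub// !size_full_word ?sz//; congr (_ + _)%N.
  by rewrite !(block_splits_sumn (parsed_sections_ok P) (block_lang_size bls)).
Qed.

Lemma phi_semifinite : semifinite_harmonic (@phi R t w).
Proof.
have [a [a0 am pa pE]] := phi_is_extension.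
have a00 n : size n = num_inf t -> (0 <= a n)%R by move=> /a0/ltW.
have ah := multiplicative_harmonic sum_weights am.
have [[_ fin]|] := lattice_ext_semifinite (@embedded_full_vertex t altt wft) a00 ah;
    last by rewrite -pE.
have := fin (empty_vertex t); rewrite -pE phi_ideal ?ltxx//.
exact: none_in_ideal.
Qed.

Lemma phi_indecomposable : indecomposable (@phi R t w).
Proof.
have [a [a0 am pa pE]] := phi_is_extension.
exact: (lattice_ext_indecomposable (@embedded_full_vertex t altt wft) weights_gt0 sum_weights am
    a0 pE).
Qed.

End PhiIsExtension.

(** * Translated lattices, and templates recovered from their words *)

Section Reconstruction.
Implicit Types (t : seq signed_cluster) (n : seq nat).

Definition shift_by (n0 n : seq nat) : seq nat := [seq p.1 + p.2 | p <- zip n0 n].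

Lemma size_shift_by n0 n : size n0 = size n -> size (shift_by n0 n) = size n.
Proof. by move=> s; rewrite size_map size_zip s minnn. Qed.

Lemma nth_shift_by n0 n i : size n0 = size n -> nth 0 (shift_by n0 n) i = nth 0 n0 i + nth 0 n i.
Proof.
move=> s; have [ni|ni] := leqP (size n) i.
  by rewrite !nth_default ?size_shift_by// s.
by rewrite (nth_map (0, 0)) ?nth_zip// size_zip s minnn.
Qed.

Lemma shift_by_incr n0 n j : size n0 = size n -> j < size n ->
  shift_by n0 (incr_nth n j) = incr_nth (shift_by n0 n) j.
Proof.
move=> s jn; have s' : size n0 = size (incr_nth n j) by rewrite size_incr_nth jn.
apply: (@eq_from_nth _ 0) => [|i _].
  by rewrite size_shift_by// !size_incr_nth size_shift_by// jn.
by rewrite nth_shift_by// !nth_incr_nth nth_shift_by// addnCA.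
Qed.

Lemma shift_by_inj n0 n n' : size n0 = size n -> size n0 = size n' ->
    shift_by n0 n = shift_by n0 n' -> n = n'.
Proof.
move=> s s' e; apply: (@eq_from_nth _ 0) => [|i _]; first by rewrite -s -s'.
have := congr1 (fun l => nth 0 l i) e; rewrite !nth_shift_by// => /eqP.
by rewrite eqn_add2l => /eqP.
Qed.

Lemma embedded_shift (G : graded_graph) m (g : seq nat -> G) n0 : size n0 = m ->
  embedded_lattice m g -> embedded_lattice m (g \o shift_by n0).
Proof.
move=> s0 [ginj gup]; split=> [n n'|n nm y].
  rewrite !inE => /eqP sn /eqP sn' /= /ginj; rewrite !inE !size_shift_by ?s0 ?sn ?sn'//.
  by move=> /(_ (eqxx _) (eqxx _)) /shift_by_inj; apply; rewrite s0.
rewrite /= gup ?size_shift_by ?s0//; split=> -[j jm ->]; exists j => //=;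
by rewrite shift_by_incr ?s0 ?nm.
Qed.

Lemma full_word_subseq t n n' : size n = num_inf t -> size n' = num_inf t ->
  (forall i, nth 0 n i <= nth 0 n' i) -> subseq (full_word t n) (full_word t n').
Proof.
elim: t n n' => [|[s [k|]] t IH] n n' //.
  by move=> sn sn' le; rewrite !full_word_finite; apply: cat_subseq => //; exact: IH.
case: n n' => // a n [|a' n'] // [sn] [sn'] le.
rewrite !full_word_infinite; apply: cat_subseq; last by apply: IH => // i; exact: (le i.+1).
have -> : nseq a'.+1 s = nseq a.+1 s ++ nseq (a' - a) s.
  by rewrite -nseqD addSn subnKC//; exact: (le 0).
exact: prefix_subseq.
Qed.

Lemma fits_all_eq t t' : (forall n, fits_all (full_mults t n) t') ->
    (forall n, fits_all (full_mults t' n) t) ->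
  map fst t = map fst t' -> t = t'.
Proof.
elim: t t' => [|[s k] t IH] [|[s' k'] t'] //= h h' [-> e].
have [kk' {}h {}h'] : [/\ k = k', forall n, fits_all (full_mults t n) t' & forall n,
    fits_all (full_mults t' n) t].
  case: k k' h h' => [k|] [k'|] h h'.
  - split=> [|n|n]; last 2 first.
    + by have /andP[] := h n.
    + by have /andP[] := h' n.
    have /andP[kk _] := h [::]; have /andP[kk' _] := h' [::]; congr Some.
    by apply/eqP; rewrite eqn_leq; apply/andP.
  - by have /andP[] := h' [:: k]; rewrite /fits_multiplicity /= ltnn.
  - by have /andP[] := h [:: k']; rewrite /fits_multiplicity /= ltnn.
  - by split=> // n; [have := h (0 :: n)|have := h' (0 :: n)].
by rewrite kk' (IH t').
Qed.

(** A full word of the template with more clusters has one run per cluster, so the other template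
    needs as many clusters with the same signs. Then the exponents of the full words of each fit the
    other, which equates the multiplicities. *)
Lemma lang_template_inj t t' : is_template t -> is_template t' ->
  (forall y, lang t y <-> lang t' y) -> t = t'.
Proof.
have run u u' : is_template u -> (forall y, lang u y -> lang u' y) -> size u' <= size u ->
    [/\ size u' = size u, map fst u' = map fst u & forall n, fits_all (full_mults u n) u'].
  move=> /and3P[wf at_ _] uu' su; have key n : [/\ size u' = size u, map fst u' = map fst u &
      fits_all (full_mults u n) u'].
    have /uu'/langP[l fl e] := lang_full_word u n.
    have [s1 s2 lE] := run_unique at_ (size_full_mults u n) (full_mults_gt0 n wf) (fits_all_size
        fl) (esym e) su.
    by rewrite -lE.
  by have [-> -> _] := key [::]; split=> // n; have [] := key n.
move=> tt tt' e; wlog s : t t' tt tt' e / size t' <= size t.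
  move=> wl; have [|/ltnW] := leqP (size t') (size t); first exact: wl.
  by move=> s; apply/esym/wl => // y; rewrite e.
have [s1 s2 f1] := run t t' tt (fun y => (e y).1) s.
have [_ _ f2] := run t' t tt' (fun y => (e y).2) (eq_leq (esym s1)).
by apply: fits_all_eq.
Qed.

End Reconstruction.

(** * Classification of the strictly positive indecomposable functions *)

Section Classification.
Context (R : realType) (t : seq signed_cluster).
Hypothesis st : semifinite_template t.
Implicit Types (n : seq nat).

Let tt : is_template t. Proof. by case/andP: st. Qed.
Let wft : all cluster_wf t. Proof. by case/and3P: tt. Qed.
Let altt : alternating t. Proof. by case/and3P: tt. Qed.
Let gL := @embedded_full_vertex t altt wft.

Local Open Scope ereal_scope.

Lemma finite_somewhere (f : template_graph t -> \bar R) :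
  (forall x, 0 < f x) -> semifinite_harmonic f ->
      exists2 n0, size n0 = num_inf t & f (full_vertex t n0) < +oo.
Proof.
move=> f0 fs; have fh : harmonic_function f by case: fs.
have [x fx] := semifinite_has_finite fs f0.
have [y ty fy] : exists2 y, lang t y & f (word_vertex t y) < +oo.
  case xE : (val x) => [y|]; first by have [ty xv] := val_word_vertex xE; exists y; rewrite -?xv.
  exists [::]; first exact: lang_nil.
  apply: le_lt_trans fx; suff -> : x = empty_vertex t by exact: harmonic_le_empty.
  exact: val_inj.
have [n0 sn0 yn0] := lang_full_word_dom ty; exists n0 => //.
apply: le_lt_trans fy; apply: harmonic_subseq => //; exact: lang_full_word.
Qed.

Lemma classification (f : template_graph t -> \bar R) :
  (forall x, 0 < f x) -> semifinite_harmonic f -> indecomposable f ->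
  exists2 w : seq R, growth_model t w &
    exists2 c : R, (0 < c)%R & forall x, f x = c%:E * phi w x.
Proof.
move=> f0 fs fi; have fh : harmonic_function f by case: fs.
have [n0 sn0 fn0] := finite_somewhere f0 fs.
(* Finiteness of [f] is known only from [n0] upwards; the translate is again an upward closed copy
   of N^m. *)
have hL := embedded_shift sn0 gL; set g := full_vertex t \o shift_by n0 in hL.
have sadd n : size n = num_inf t -> size (shift_by n0 n) = num_inf t by move=> sn;
    rewrite size_shift_by// sn0.
have ffin n : size n = num_inf t -> 0 < f (g n) < +oo.
  move=> sn; rewrite f0; apply: le_lt_trans fn0; apply: harmonic_subseq => //.
    exact: lang_full_word.
  apply: full_word_subseq => //; first exact: sadd.
  by move=> i; rewrite nth_shift_by ?sn0// leq_addr.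
have [v [v0 v1 fm fE]] := indecomposable_lattice hL fs fi ffin.
set a := fun n => fine (f (g n)) in fm fE.
pose w := mkseq v (num_inf t).
have sw : size w = num_inf t by rewrite size_mkseq.
have wv j : (j < num_inf t)%N -> nth 0%R w j = v j by move=> jt; rewrite nth_mkseq.
have w0 : all (fun a => 0 < a)%R w.
  by apply/(all_nthP 0%R) => j; rewrite sw => jt; rewrite wv// v0.
have w1 : (\sum_(a <- w) a = 1)%R.
  by rewrite -v1 (big_nth 0%R) sw big_mkord; apply: eq_bigr => j _; rewrite wv.
exists w; first by split=> //; rewrite sw.
have ps := phi_semifinite st sw w0 w1; have ph : harmonic_function (@phi R t w) by case: ps.
have pi := phi_indecomposable st sw w0 w1.
have [d [d0 dm dE _]] := phi_is_extension st sw w0 w1.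
have pfin n : size n = num_inf t -> 0 < phi w (g n) < +oo.
  by move=> sn; rewrite /g /= dE ?sadd// lte_fin d0 ?sadd// ltry.
(* phi satisfies the same hypotheses on the translated lattice, so it is the least extension from
   there as well, and can be compared with [f]. *)
have [_ [_ _ _ pE]] := indecomposable_lattice hL ps pi pfin.
set e := fun n => fine (phi w (g n)) in pE.
have em : multiplicative_on (num_inf t) v e.
  move=> n j sn jt; rewrite /e /g /= shift_by_incr ?sn0 ?sn// !dE ?size_incr_nth ?sadd ?jt//=.
  by rewrite dm ?sadd// wv.
have a0 n : size n = num_inf t -> (0 < a n)%R.
  move=> sn; rewrite /a -lte_fin fineK; first by case/andP: (ffin n sn).
  by rewrite ge0_fin_numE ?fh.1//; case/andP: (ffin n sn).
have e0 n : size n = num_inf t -> (0 < e n)%R.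
  move=> sn; rewrite /e -lte_fin fineK; first by case/andP: (pfin n sn).
  by rewrite ge0_fin_numE ?ph.1//; case/andP: (pfin n sn).
pose z := nseq (num_inf t) 0%N; have zm : size z = num_inf t by rewrite size_nseq.
pose c := (a z / e z)%R; have c0 : (0 < c)%R by rewrite divr_gt0 ?a0 ?e0.
have aE n : size n = num_inf t -> a n = (c * e n)%R.
  move: n; apply: lattice_ind => [|n j sn jt IH]; first by rewrite /c divfK// gt_eqF ?e0.
  by rewrite fm// em// IH mulrCA.
have fa n : size n = num_inf t -> f (g n) = (a n)%:E.
  by move=> sn; rewrite /a fineK// ge0_fin_numE ?fh.1//; case/andP: (ffin n sn).
have pe n : size n = num_inf t -> phi w (g n) = (e n)%:E.
  by move=> sn; rewrite /e fineK// ge0_fin_numE ?ph.1//; case/andP: (pfin n sn).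
exists c => // x; apply/eqP; rewrite eq_le; apply/andP; split; last first.
  rewrite [in leLHS]pE; apply: (lattice_ext_minZ hL (ltW c0) fh.1).
    by move=> y; rewrite -upper_sumE -fh.2.
  by move=> n sn; rewrite fa// aE.
rewrite muleC -lee_pdivrMr// muleC [in leLHS]fE; apply: (lattice_ext_minZ hL _ ph.1).
- by rewrite invr_ge0 ltW.
- by move=> y; rewrite -upper_sumE -ph.2.
- by move=> n sn; rewrite pe// aE// mulKf// gt_eqF.
Qed.

End Classification.

(** * Distinct growth models give distinct functions *)

Section Distinctness.
Context (R : realType).
Local Open Scope ereal_scope.

Lemma phi_zero_ext_word_vertex t (w : seq R) y : lang t y ->
  phi_zero_ext t w (Some y) = phi w (word_vertex t y).
Proof.
move=> ty; rewrite /phi_zero_ext; case: insubP => [x _ xE|]; last first.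
  by rewrite mem_set//; apply/zigzags_ofE.
by have [_ ->] := val_word_vertex xE.
Qed.

Lemma phi_zero_ext_out t (w : seq R) y : ~ lang t y -> phi_zero_ext t w (Some y) = 0.
Proof.
move=> ty; rewrite /phi_zero_ext insubF//; apply/negbTE/negP => /set_mem.
by move/zigzags_ofE.
Qed.

Lemma growth_model_inj t t' (w w' : seq R) : growth_model t w -> growth_model t' w' ->
  phi_zero_ext t w = phi_zero_ext t' w' -> (t, w) = (t', w').
Proof.
move=> [st sw w0 w1] [st' sw' w0' w1'] e.
have sub s s' v v' : semifinite_template s -> size v = num_inf s -> all (fun a => 0 < a)%R v ->
    @phi_zero_ext R s v = phi_zero_ext s' v' -> forall y, lang s y -> lang s' y.
  move=> ss sv v0 ee y sy; apply: contrapT => /(phi_zero_ext_out v').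
  rewrite -ee phi_zero_ext_word_vertex// => ey.
  have [b [bl P]] : exists b bl, parsed s b bl by apply: parse_exists; case/andP: ss.
  by have := phi_gt0 ss P sv v0 (word_vertex s y); rewrite ey ltxx.
have tE : t = t'.
  apply: lang_template_inj; [by case/andP: st|by case/andP: st'|move=> y; split].
    exact: sub st sw w0 e y.
  exact: sub st' sw' w0' (esym e) y.
subst t'; congr (_, _).
have [a [a0 am aE _]] := phi_is_extension st sw w0 w1.
have [a' [a0' am' aE' _]] := phi_is_extension st sw' w0' w1'.
have aa n : size n = num_inf t -> a n = a' n.
  move=> sn; apply: EFin_inj; rewrite -aE// -aE'//.
  by rewrite -!(phi_zero_ext_word_vertex _ (lang_full_word t n)) e.
apply: (@eq_from_nth _ 0%R) => [|j]; first by rewrite sw sw'.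
rewrite sw => jt; pose z := nseq (num_inf t) 0%N; have zm : size z = num_inf t by rewrite size_nseq.
apply: (mulIf (lt0r_neq0 (a0 z zm))).
by rewrite -am// [in RHS]aa// -am'// aa// size_incr_nth zm jt.
Qed.

End Distinctness.

Local Open Scope ring_scope.
Local Open Scope ereal_scope.

Theorem theorem5p5 (R : realType) :
  (forall (t : seq signed_cluster) (w : seq R), growth_model t w ->
     semifinite_harmonic (@phi R t w) /\ indecomposable (@phi R t w)) /\
  (forall t : seq signed_cluster, semifinite_template t ->
     forall f : template_graph t -> \bar R,
       (forall x, 0 < f x) -> semifinite_harmonic f -> indecomposable f ->
       exists2 w : seq R, growth_model t w &
         exists2 c : R, (0 < c)%R & forall x, f x = c%:E * phi w x) /\
  (forall (t t' : seq signed_cluster) (w w' : seq R),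
     growth_model t w -> growth_model t' w' -> (t, w) <> (t', w') ->
     @phi_zero_ext R t w <> @phi_zero_ext R t' w').
Proof.
split; [|split].
- move=> t w [st sw w0 w1].
  by split; [exact: phi_semifinite|exact: phi_indecomposable].
- by move=> t st f f0 fs fi; exact: classification.
- by move=> t t' w w' gw gw' ne e; apply: ne; exact: growth_model_inj.
Qed.
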